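(* Let $g\geq 7$ with $g\equiv 1\pmod 3$. Then \[ \dim\bigl(\mathbb{M}_{g,\underline{4}}^{\mathrm{nd}}\bigr)=\lfloor U(g,4)\rfloor, \] where $U(g,d)=g+\frac{2g}{d-1}+2d-3$ (so $U(g,4)=\frac{5g}{3}+5$).
   Context: Lattice polygon: convex hull of a nonempty finite subset of $\mathbb{Z}^2$; genus $g(P)$ = number of interior lattice points; $P^{(1)}$ = convex hull of interior lattice points. Lattice width $\mathrm{lw}$: least $s$ such that some map $x\mapsto Ax+b$ ($A\in\mathrm{GL}_2(\mathbb{Z})$, $b\in\mathbb{Z}^2$) sends the polygon into $\mathbb{R}\times[0,s]$; segments/points have lattice width $0$, the empty set $-1$. Expected gonality $\mathrm{egon}(P)=\mathrm{lw}(P^{(1)})+2$, except $\mathrm{egon}(P)=3$ for $P$ equivalent to $\mathrm{conv}\{(-2,-2),(2,0),(0,2)\}$. $\mathbb{M}_P$: set of metric graphs arising as skeletons (delete infinite rays, retract leaves, smooth 2-valent vertices) of smooth tropical plane curves with Newton polygon $P$ (min-plus tropical polynomials with finite coefficients at all lattice points of $P$ inducing a regular unimodular triangulation); a finite union of polyhedral cones indexed by regular unimodular triangulations, with $\dim\mathbb{M}_P$ the maximal cone dimension. $\mathbb{M}_{g,\underline{d}}^{\mathrm{nd}}=\bigcup\{\mathbb{M}_P:g(P)=g,\ \mathrm{egon}(P)=d\}$, with dimension $\max\dim\mathbb{M}_P$ over such $P$. *)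

(* Defs.v *)
From HB Require Import structures.
From mathcomp Require Import all_boot all_order all_algebra finmap.
From mathcomp Require Import boolp classical_sets cardinality reals.
From mathcomp Require Import topology normedtype.
Import Order.TTheory GRing.Theory Num.Theory.
Import numFieldNormedType.Exports.

Set Implicit Arguments.
Unset Strict Implicit.
Unset Printing Implicit Defensive.

Local Open Scope classical_set_scope.
Local Open Scope ring_scope.

(* Junk value 0 when there is no least (resp. greatest) element. *)
Definition min_of (S : set nat) : nat :=
  xget 0%N [set k | S k /\ forall j, S j -> (k <= j)%N].

Definition max_of (S : set nat) : nat :=
  xget 0%N [set k | S k /\ forall j, S j -> (j <= k)%N].

(* Points of Z^2 and R^2 are column vectors. *)
Definition zvec (R : realType) (p : 'cV[int]_2) : 'cV[R]_2 := map_mx intr p.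

Definition hull (R : realType) (V : {fset 'cV[int]_2}) : set 'cV[R]_2 :=
  [set x | exists w : V -> R,
     [/\ forall i, 0 <= w i, \sum_i w i = 1 &
         x = \sum_i w i *: zvec R (val i)]].
Arguments hull : clear implicits.

Definition lattice_polygon (R : realType) (P : set 'cV[R]_2) : Prop :=
  exists V : {fset 'cV[int]_2}, V != fset0 /\ P = hull R V.

(* [fset_set] is the finite set underlying a finite [set]; both sets below are
   finite because lattice polygons are bounded. *)
Definition lattice_points (R : realType) (P : set 'cV[R]_2) :
  {fset 'cV[int]_2} := fset_set [set p | P (zvec R p)].

Definition interior_points (R : realType) (P : set 'cV[R]_2) :
  {fset 'cV[int]_2} := fset_set [set p | interior P (zvec R p)].

Definition genus (R : realType) (P : set 'cV[R]_2) : nat :=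
  #|` interior_points P|.

(* P^(1); it is empty when P has no interior lattice point. *)
Definition inner_polygon (R : realType) (P : set 'cV[R]_2) : set 'cV[R]_2 :=
  hull R (interior_points P).

Definition lattice_map (R : realType) (A : 'M[int]_2) (b : 'cV[int]_2)
  (x : 'cV[R]_2) : 'cV[R]_2 := map_mx intr A *m x + zvec R b.

Definition equivalent (R : realType) (P Q : set 'cV[R]_2) : Prop :=
  exists A b, A \in unitmx /\ Q = [set lattice_map A b x | x in P].

(* The row index 1 selects the second coordinate. *)
Definition lw (R : realType) (P : set 'cV[R]_2) : int :=
  if `[< P = set0 >] then -1 else
  (min_of [set s | exists A b, A \in unitmx /\
     forall x, P x -> 0 <= lattice_map A b x 1 0 <= s%:R])%:Z.

Definition point (x y : int) : 'cV[int]_2 :=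
  \col_i (if i == 0 then x else y).

Definition exceptional_triangle (R : realType) : set 'cV[R]_2 :=
  hull R [fset point (-2) (-2); point 2 0; point 0 2]%fset.
Arguments exceptional_triangle : clear implicits.

Definition egon (R : realType) (P : set 'cV[R]_2) : int :=
  if `[< equivalent P (exceptional_triangle R) >] then 3
  else lw (inner_polygon P) + 2.

(* In what follows A is a finite set of exponents, and c : A -> R gives the
   coefficients of the min-plus polynomial min_(a in A) (c a + <a, v>).  The
   set of monomials attaining this minimum at v : *)
Definition argmin (R : realType) (A : {fset 'cV[int]_2}) (c : A -> R)
  (v : 'cV[R]_2) : {set A} :=
  let value a := c a + ((zvec R (val a))^T *m v) 0 0 in
  [set a | [forall b, value a <= value b]]%SET.

(* Twice the signed area of the triangle with vertices a, b, d. *)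
Definition area2 (a b d : 'cV[int]_2) : int :=
  \det (row_mx (b - a) (d - a) : 'M_2).

Definition two_dimensional (A : {fset 'cV[int]_2}) (T : {set A}) : Prop :=
  exists a b d, [/\ a \in T, b \in T, d \in T &
                    area2 (val a) (val b) (val d) != 0].

Definition unimodular_triangle (A : {fset 'cV[int]_2}) (T : {set A}) : Prop :=
  exists a b d, T = [set a; b; d]%SET /\
                `|area2 (val a) (val b) (val d)| = 1.

(* A subdivision is given by its two-dimensional cells.  The cells of the
   regular subdivision induced by c are the sets [argmin c v]: the affine
   function a |-> m - <a, v>, with m the minimum, supports the lower hull of
   the points (a, c a) exactly over [argmin c v]. *)
Definition induces (R : realType) (A : {fset 'cV[int]_2}) (c : A -> R)
  (D : {set {set A}}) : Prop :=
  forall T, T \in D <-> two_dimensional T /\ exists v, argmin c v = T.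

Definition regular_unimodular (R : realType) (A : {fset 'cV[int]_2})
  (D : {set {set A}}) : Prop :=
  (forall T, T \in D -> unimodular_triangle T) /\
  exists c : A -> R, induces c D.

(* The tropical curve as a graph, read off from the dual triangulation D: its
   vertices are the triangles T of D, its bounded edges are dual to the edges
   e of D shared by two triangles (its rays are dual to those lying in only
   one), and the vertex T is an endpoint of the edge e iff e \subset T. *)
Definition bounded_edges (A : {fset 'cV[int]_2}) (D : {set {set A}}) :
  {set {set A}} :=
  [set e : {set A} |
     (#|e| == 2%N) && (#|[set T in D | e \subset T]%SET| == 2%N)]%SET.

Definition valence (A : {fset 'cV[int]_2}) (F : {set {set A}}) (T : {set A}) :
  nat := #|[set e in F | e \subset T]%SET|.

(* One round of retraction: drop the edges having a 1-valent endpoint. *)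
Definition retract_leaves (A : {fset 'cV[int]_2}) (D F : {set {set A}}) :
  {set {set A}} :=
  [set e in F | [forall T in D, (e \subset T) ==> (valence F T != 1%N)]]%SET.

(* Each round that is not stationary removes an edge, so no leaf remains. *)
Definition core (A : {fset 'cV[int]_2}) (D : {set {set A}}) :
  {set {set A}} :=
  iter #|bounded_edges D| (retract_leaves D) (bounded_edges D).

Definition smooth_rel (A : {fset 'cV[int]_2}) (D : {set {set A}}) :
  rel {set A} :=
  fun e e' => [&& e \in core D, e' \in core D &
    [exists T in D, [&& valence (core D) T == 2%N, e \subset T & e' \subset T]]].

(* An edge of the skeleton is the set of the edges of the core that are merged
   into it when the 2-valent vertices are smoothed. *)
Definition skeleton_edges (A : {fset 'cV[int]_2}) (D : {set {set A}}) :
  {set {set {set A}}} :=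
  equivalence_partition (connect (smooth_rel D)) (core D).

Definition lattice_length (R : realType) (v w : 'cV[R]_2) (l : R) : Prop :=
  0 <= l /\ exists u : 'cV[int]_2,
    coprimez (u 0 0) (u 1 0) /\ w - v = l *: zvec R u.

(* The edge of the curve dual to e is the set of the v such that
   e \subset argmin c v; its endpoints are the v where a further monomial
   attains the minimum. *)
Definition edge_length (R : realType) (A : {fset 'cV[int]_2}) (c : A -> R)
  (e : {set A}) (l : R) : Prop :=
  exists v w, [/\ v != w, e \proper argmin c v, e \proper argmin c w &
                  lattice_length v w l].

(* The cone of the metrics on the skeleton of the curves dual to D, inside
   R^E with E the set of edges of the skeleton. *)
Definition skeleton_cone (R : realType) (A : {fset 'cV[int]_2})
  (D : {set {set A}}) : set {ffun {S | S \in skeleton_edges D} -> R^o} :=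
  [set m : {ffun {S | S \in skeleton_edges D} -> R^o} |
     exists (c : A -> R) (len : {set A} -> R),
     [/\ induces c D,
         forall e, e \in bounded_edges D -> edge_length c e (len e) &
         forall S, m S = \sum_(e in val S) len e]].

Definition linear_span (R : realType) (V : vectType R) (C : set V) :
  {vspace V} :=
  xget fullv [set U : {vspace V} | (forall x, C x -> x \in U) /\
    forall W : {vspace V}, (forall x, C x -> x \in W) -> (U <= W)%VS].

(* A polyhedral cone and its relative interior span the same subspace, so it
   does not matter that [skeleton_cone] is not closed. *)
Definition cone_dim (R : realType) (V : vectType R) (C : set V) : nat :=
  \dim (linear_span C).

Definition dim_M_polygon (R : realType) (P : set 'cV[R]_2) : nat :=
  max_of [set cone_dim (@skeleton_cone R (lattice_points P) D)
         | D in @regular_unimodular R (lattice_points P)].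

Definition dim_M_nd (R : realType) (g d : nat) : nat :=
  max_of [set dim_M_polygon P | P in [set P : set 'cV[R]_2 |
            [/\ lattice_polygon P, genus P = g & egon P = d%:Z]]].

Definition U (g d : nat) : rat :=
  g%:R + 2 * g%:R / (d%:R - 1) + 2 * d%:R - 3.

(* Main.v *)
(* The metrics on the skeleton that come from a triangulation are the vectors
   sum_q c(q) col(q), where c ranges over the coefficients inducing it, so the
   dimension of the cone is the rank of the columns col(q).
   Upper bound.  Let g = 3k + 1 >= 7.  Coordinates in which P^(1) has width 2
   put its lattice points in three rows, with n1 + n2 + n3 = g of them, and P in
   the five rows from y0 to y0 + 4, with r0, ..., r4 points.  Affine coefficients
   give three relations between the columns.  Moreover, col(q) = 0 for a point q
   of row y0 which lies in a single triangle, or in exactly two, these having a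
   common apex and their bases in the row; this leaves at most n1 + 1 points of
   row y0, and likewise n3 + 1 of row y0 + 4.  The dimension is thus at most
   (n1 + 1) + r1 + r2 + r3 + (n3 + 1) - 3, and convexity gives rj <= nj + 2 and
   r1 + r3 <= 2 n2 + 4.  This yields 5k + 6, which is the integral part of U(g, 4).
   Equality.  The hexagon 0 <= x <= k + 2, 0 <= y <= 4, -2 <= x - y <= k with its
   honeycomb triangulation attains the bound: the coefficients of a linear
   relation between the columns are determined by those of three vertices of one
   triangle, which leaves only the affine ones. *)
From mathcomp Require Import all_boot all_order all_algebra finmap.
From mathcomp Require Import boolp classical_sets cardinality reals.
From mathcomp Require Import topology normedtype.
From mathcomp Require Import zify ring lra.
Require Import Defs.
Import Order.TTheory GRing.Theory Num.Theory.
Import numFieldNormedType.Exports.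

Set Implicit Arguments.
Unset Strict Implicit.
Unset Printing Implicit Defensive.

Local Open Scope classical_set_scope.
Local Open Scope ring_scope.

(** Why columns vanish: a point in a single triangle is opposite to a dangling edge only, and
    retraction removes that edge; a point with two triangles on a common apex only redistributes
    length among three edges which are merged. Why [n1 + 1]: over the consecutive unit segments of
    the bottom row the apexes, all in the next row, move weakly to the right, and strictly so at a
    point whose column survives. By convexity, an apex beyond which the polygon continues on both
    sides is interior. So sending a surviving point to the apex over the segment on its right is
    injective, with a single extra value for all points that have no interior apex. All incidence
    arguments rest on one fact: a common point of the hulls of two cells has the same height over
    both, so cells cannot overlap. The existence of a triangle over a unit segment is derived by
    tilting a supporting line. The hypothesis on [g] serves to confine [P] to five rows; in smaller
    genus a vertex further out cannot be excluded by counting. For equality, the coefficients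
    inducing the honeycomb form an open set, so the cone spans the span of all columns. *)

Lemma sum_ord2 (V : nmodType) (F : 'I_2 -> V) : \sum_i F i = F 0 + F 1.
Proof.
by rewrite !big_ord_recl big_ord0 addr0; congr (_ + F _); apply: val_inj.
Qed.

Lemma cV2P (K : Type) (u v : 'cV[K]_2) :
  u 0 0 = v 0 0 -> u 1 0 = v 1 0 -> u = v.
Proof.
move=> h0 h1; apply/matrixP => i j; rewrite (ord1 j).
case: i => [[|[|//]]] hi.
- by rewrite (_ : Ordinal hi = 0) //; exact: val_inj.
- by rewrite (_ : Ordinal hi = 1) //; exact: val_inj.
Qed.

Lemma pointE0 x y : point x y 0 0 = x. Proof. by rewrite mxE. Qed.
Lemma pointE1 x y : point x y 1 0 = y. Proof. by rewrite mxE. Qed.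
Lemma pointE (p : 'cV[int]_2) : p = point (p 0 0) (p 1 0).
Proof. by apply: cV2P; rewrite ?pointE0 ?pointE1. Qed.

Lemma mul_mx_cV2 (K : pzSemiRingType) (M : 'M[K]_2) (v : 'cV[K]_2) i :
  (M *m v) i 0 = M i 0 * v 0 0 + M i 1 * v 1 0.
Proof. by rewrite mxE sum_ord2. Qed.

(** * Convex sets, their interiors, and the lattice points of a lattice polygon *)

Section Convex.
Variable R : realType.
Implicit Types (P : set 'cV[R]_2) (x y z : 'cV[R]_2) (V : {fset 'cV[int]_2}).

Lemma zvecE (p : 'cV[int]_2) i : zvec R p i 0 = (p i 0)%:~R.
Proof. by rewrite mxE. Qed.

Definition convex_set P := forall x y t, 0 <= t <= 1 -> P x -> P y ->
  P ((1 - t) *: x + t *: y).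

Lemma hull_convex V : convex_set (hull R V).
Proof.
move=> x y t /andP[t0 t1] [w [w0 w1 ->]] [w' [w'0 w'1 ->]].
exists (fun i => (1 - t) * w i + t * w' i); split.
- by move=> i; rewrite addr_ge0 // mulr_ge0 // subr_ge0.
- by rewrite big_split -!mulr_sumr /= w1 w'1; ring.
- rewrite !scaler_sumr -big_split /=; apply: eq_bigr => i _.
  by rewrite [in RHS]scalerDl !scalerA.
Qed.

Lemma mem_hull V p : p \in V -> hull R V (zvec R p).
Proof.
move=> pV; exists (fun i => (i == [` pV]%fset)%:R); split.
- by move=> i; rewrite ler0n.
- by rewrite (bigD1 [` pV]%fset) //= eqxx big1 ?addr0 // => i /negbTE ->.
- rewrite (bigD1 [` pV]%fset) //= eqxx scale1r big1 ?addr0 //.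
  by move=> i /negbTE ->; rewrite scale0r.
Qed.

Lemma hull_ineq V (a b k : R) x :
  (forall p, p \in V -> a * (p 0 0)%:~R + b * (p 1 0)%:~R <= k) ->
  hull R V x -> a * x 0 0 + b * x 1 0 <= k.
Proof.
move=> hV [w [w0 w1 ->]].
rewrite !summxE !mulr_sumr -big_split /= -(mulr1 k) -w1 mulr_sumr.
apply: ler_sum => i _; rewrite !mxE.
rewrite (mulrC k); apply: le_trans (ler_wpM2l (w0 i) (hV _ (valP i))).
by rewrite le_eqVlt; apply/orP; left; apply/eqP; ring.
Qed.

Lemma interiorP P z : interior P z <->
  exists2 r : R, 0 < r & forall z', `|z' 0 0 - z 0 0| < r ->
    `|z' 1 0 - z 1 0| < r -> P z'.
Proof.
rewrite /interior nbhs_ballP; split=> [[r /= r0 h]|[r r0 h]]; exists r => //.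
  move=> z' h0 h1; apply: h; split=> // i j; rewrite (ord1 j).
  rewrite -ball_normE /= distrC.
  case: i => [[|[|//]]] hi.
  - by rewrite (_ : Ordinal hi = 0) //; exact: val_inj.
  - by rewrite (_ : Ordinal hi = 1) //; exact: val_inj.
move=> z' [_ hz]; apply: h; rewrite distrC.
- by have := hz 0 0; rewrite -ball_normE.
- by have := hz 1 0; rewrite -ball_normE.
Qed.

Lemma interior_sub P z : interior P z -> P z.
Proof. by case/interiorP => r r0; apply; rewrite subrr normr0. Qed.

(** The homothety of centre [x] and ratio [t] carries a square about [y] to a square about the new
    point; convexity keeps the image in [P]. *)
Lemma interior_between P x y t : convex_set P -> P x -> interior P y ->
  0 < t <= 1 -> interior P ((1 - t) *: x + t *: y).
Proof.
move=> cP Px /interiorP[r r0 hr] /andP[t0 t1]; apply/interiorP.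
exists (t * r); first exact: mulr_gt0.
move=> z'; rewrite !mxE => h0 h1.
pose y' := t^-1 *: (z' - (1 - t) *: x).
have -> : z' = (1 - t) *: x + t *: y'.
  by rewrite /y' scalerA divff ?gt_eqF // scale1r addrC subrK.
have tE (a b c : R) : `|a - ((1 - t) * b + t * c)| < t * r ->
    `|t^-1 * (a - (1 - t) * b) - c| < r.
  rewrite (_ : t^-1 * _ - c = t^-1 * (a - ((1 - t) * b + t * c))); last first.
    by field; rewrite gt_eqF.
  by rewrite normrM gtr0_norm ?invr_gt0 // ltr_pdivrMl.
apply: cP => //; first by rewrite ltW.
by apply: hr; rewrite !mxE; exact: tE.
Qed.

(** [fset_set] is meaningful on finite sets only, so membership in [lattice_points] and
    [interior_points] rests on this. The constant [N] bounds both coordinates of all generators,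
    hence of the hull, and confines its lattice points to a finite grid. *)
Lemma hull_finite V : finite_set [set p | hull R V (zvec R p)].
Proof.
pose N := \sum_(p : V) (`|(fsval p 0 0)%R| + `|(fsval p 1 0)%R|)%N.
have N_ge (p : V) i : (`|(fsval p i 0)%R| <= N)%N.
  rewrite /N (bigD1 p) //=; apply: leq_trans (leq_addr _ _).
  case: i => [[|[|//]]] hi.
  - by rewrite (_ : Ordinal hi = 0) ?leq_addr //; exact: val_inj.
  - by rewrite (_ : Ordinal hi = 1) ?leq_addl //; exact: val_inj.
pose s := [seq i%:Z - N%:Z | i <- iota 0 (2 * N + 1)].
have sP (a : int) : `|a%:~R| <= N%:R :> R -> a \in s.
  rewrite -intr_norm (_ : N%:R = N%:Z%:~R) // ler_int => h.
  by apply/mapP; exists `|(a + N%:Z)%R|%N; rewrite ?mem_iota; lia.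
apply: (@finite_subfset _ [fset point x y | x in s, y in s]%fset) => p /= hp.
apply/imfset2P; exists (p 0 0); last first.
  exists (p 1 0); last exact: pointE.
all: apply: sP; case: hp => w [w0 w1 /(congr1 (fun v : 'cV[R]_2 => (v 0 0, v 1 0)))].
all: rewrite !zvecE !summxE => -[h0 h1]; rewrite ?h0 ?h1.
all: rewrite (_ : N%:R = \sum_i w i * N%:R :> R); last by rewrite -mulr_suml w1 mul1r.
all: apply: le_trans (ler_norm_sum _ _ _) _.
all: apply: ler_sum => i _; rewrite !mxE normrM ger0_norm // ler_wpM2l //.
all: by rewrite -intr_norm (_ : N%:R = N%:Z%:~R) // ler_int -abszE lez_nat; exact: N_ge.
Qed.
End Convex.

Section LatticePolygon.
Variables (R : realType) (P : set 'cV[R]_2).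
Hypothesis hP : lattice_polygon P.

Lemma lattice_polygon_convex : convex_set P.
Proof. by case: hP => V [_ ->]; exact: hull_convex. Qed.

Lemma mem_lattice_points p : (p \in lattice_points P) <-> P (zvec R p).
Proof.
case: hP => V [_ PV]; rewrite /lattice_points in_fset_set.
  by split=> [/set_mem|/mem_set].
by rewrite PV; exact: hull_finite.
Qed.

Lemma mem_interior_points p :
  (p \in interior_points P) <-> interior P (zvec R p).
Proof.
case: hP => V [_ PV]; rewrite /interior_points in_fset_set.
  by split=> [/set_mem|/mem_set].
apply: sub_finite_set (hull_finite R V) => q /=.
by rewrite -PV; exact: interior_sub.
Qed.

Lemma interior_lattice_points p :
  p \in interior_points P -> p \in lattice_points P.
Proof. by move/mem_interior_points/interior_sub/mem_lattice_points. Qed.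

End LatticePolygon.

(** * Cells of a regular subdivision *)

Lemma det_mx2 (K : comPzRingType) (M : 'M[K]_2) :
  \det M = M 0 0 * M 1 1 - M 0 1 * M 1 0.
Proof.
have l0 : lift 0 (0 : 'I_1) = 1 :> 'I_2 by exact: val_inj.
have l1 : lift 1 (0 : 'I_1) = 0 :> 'I_2 by exact: val_inj.
rewrite (expand_det_row _ 0) sum_ord2 /cofactor !det_mx11 !mxE l0 l1 /=.
by ring.
Qed.

Lemma area2E (a b d : 'cV[int]_2) : area2 a b d =
  (b 0 0 - a 0 0) * (d 1 0 - a 1 0) - (d 0 0 - a 0 0) * (b 1 0 - a 1 0).
Proof.
have E0 (u w : 'cV[int]_2) i : row_mx u w i 0 = u i 0.
  by rewrite -(row_mxEl u w); congr (row_mx _ _ _ _); exact: val_inj.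
have E1 (u w : 'cV[int]_2) i : row_mx u w i 1 = w i 0.
  by rewrite -(row_mxEr u w); congr (row_mx _ _ _ _); exact: val_inj.
by rewrite /area2 det_mx2 !E0 !E1 !mxE.
Qed.

Lemma coprimez_opp (x y : int) :
  coprimez x y -> coprimez (- x) y /\ coprimez x (- y).
Proof.
move=> /coprimezP[[s t] /= st]; split; apply/coprimezP.
  by exists (- s, t); rewrite /= mulrNN.
by exists (s, - t); rewrite /= mulrNN.
Qed.

Section Cells.
Variables (R : realType) (A : {fset 'cV[int]_2}).
Implicit Types (c : A -> R) (v w : 'cV[R]_2) (a b d p q s : A).
Implicit Types (T e S : {set A}) (D F : {set {set A}}).

Definition px a : int := val a 0 0.
Definition py a : int := val a 1 0.

Lemma pxy_inj a b : px a = px b -> py a = py b -> a = b.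
Proof. by move=> h0 h1; apply/val_inj/cV2P. Qed.

Definition value c v a : R :=
  c a + ((px a)%:~R * v 0 0 + (py a)%:~R * v 1 0).

Lemma argminP c v a :
  reflect (forall b, value c v a <= value c v b) (a \in argmin c v).
Proof.
have dotE b : ((zvec R (val b))^T *m v) 0 0 =
    (px b)%:~R * v 0 0 + (py b)%:~R * v 1 0.
  by rewrite mxE sum_ord2 !mxE.
rewrite inE; apply: (iffP forallP) => h b.
  by have := h b; rewrite !dotE.
by rewrite !dotE; exact: h.
Qed.

Lemma argmin_eq c v a b :
  a \in argmin c v -> b \in argmin c v -> value c v a = value c v b.
Proof.
by move=> /argminP ha /argminP hb; apply/le_anti; rewrite ha hb.
Qed.

Lemma argmin_ext c v a b :
  a \in argmin c v -> value c v b <= value c v a -> b \in argmin c v.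
Proof.
by move=> /argminP ha hb; apply/argminP => x; apply: le_trans hb (ha x).
Qed.

Lemma argmin_lt c v a b :
  a \in argmin c v -> b \notin argmin c v -> value c v a < value c v b.
Proof.
move=> ha hb; rewrite ltNge; apply: contra hb; exact: argmin_ext ha.
Qed.

(* A point of the convex hulls of two cells lies over both of them at the same
   height of the lower hull, so the smallest faces through it agree. *)
Lemma exchange c v w q s p q' (k1 k2 k3 k4 : int) :
  [/\ 0 <= k1, 0 <= k2, 0 <= k3 & 0 <= k4] ->
  [/\ k1 + k2 = k3 + k4,
      k1 * px q + k2 * px s = k3 * px p + k4 * px q' &
      k1 * py q + k2 * py s = k3 * py p + k4 * py q'] ->
  q \in argmin c v -> s \in argmin c v ->
  p \in argmin c w -> q' \in argmin c w ->
  (0 < k3 -> p \in argmin c v) /\ (0 < k4 -> q' \in argmin c v).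
Proof.
move=> [k10 k20 k30 k40] [hk hx hy] hq hs hp hq'.
have [qs pq'] := (argmin_eq hs hq, argmin_eq hq' hp).
have p_ge := argminP _ _ _ hq p; have q'_ge := argminP _ _ _ hq q'.
have q_ge := argminP _ _ _ hp q; have s_ge := argminP _ _ _ hp s.
have toR (x y : int) : x = y -> x%:~R = y%:~R :> R by move->.
move: (toR _ _ hk) (toR _ _ hx) (toR _ _ hy); rewrite !(intrD, intrM).
have le0R (x : int) : 0 <= x -> 0 <= x%:~R :> R by rewrite ler0z.
move: (le0R _ k10) (le0R _ k20) (le0R _ k30) (le0R _ k40).
set r1 := k1%:~R; set r2 := k2%:~R; set r3 := k3%:~R; set r4 := k4%:~R.
move=> r10 r20 r30 r40 hrk hrx hry.
(* At a single point the values for [v] and [w] differ by a linear form, since [c] cancels. The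
   affine relation therefore makes these four nonnegative terms add up to zero, and each of them
   vanishes. *)
have key : r3 * (value c v p - value c v q) + r4 * (value c v q' - value c v q)
         + r1 * (value c w q - value c w p) + r2 * (value c w s - value c w p) = 0.
  transitivity (r3 * value c v p + r4 * value c v q' - r1 * value c v q
      - r2 * value c v s - (r3 * value c w p + r4 * value c w q'
      - r1 * value c w q - r2 * value c w s)).
    by rewrite qs pq' (_ : r4 = r1 + r2 - r3); [ring | rewrite hrk; ring].
  transitivity ((r3 * (px p)%:~R + r4 * (px q')%:~R
      - (r1 * (px q)%:~R + r2 * (px s)%:~R)) * (v 0 0 - w 0 0)
    + (r3 * (py p)%:~R + r4 * (py q')%:~R
      - (r1 * (py q)%:~R + r2 * (py s)%:~R)) * (v 1 0 - w 1 0)).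
    by rewrite /value; ring.
  by rewrite hrx hry !subrr !mul0r addr0.
have h1 : 0 <= r3 * (value c v p - value c v q) by rewrite mulr_ge0 ?subr_ge0.
have h2 : 0 <= r4 * (value c v q' - value c v q) by rewrite mulr_ge0 ?subr_ge0.
have h3 : 0 <= r1 * (value c w q - value c w p) by rewrite mulr_ge0 ?subr_ge0.
have h4 : 0 <= r2 * (value c w s - value c w p) by rewrite mulr_ge0 ?subr_ge0.
split=> k_gt0; apply: argmin_ext hq _; rewrite -subr_le0.
  by rewrite -(pmulr_rle0 _ (_ : 0 < r3)) ?ltr0z //; lra.
by rewrite -(pmulr_rle0 _ (_ : 0 < r4)) ?ltr0z //; lra.
Qed.


Lemma exchange1 c v w q s p q' (n : int) : 0 <= n ->
  px q + n * px s = px p + n * px q' -> py q + n * py s = py p + n * py q' ->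
  q \in argmin c v -> s \in argmin c v ->
  p \in argmin c w -> q' \in argmin c w -> p \in argmin c v.
Proof.
move=> n0 hx hy hq hs hp hq'.
have k : [/\ 0 <= 1 :> int, 0 <= n, 0 <= 1 :> int & 0 <= n] by [].
have h : [/\ 1 + n = 1 + n, 1 * px q + n * px s = 1 * px p + n * px q' &
  1 * py q + n * py s = 1 * py p + n * py q'] by rewrite !mul1r.
by case: (exchange k h hq hs hp hq') => /(_ isT).
Qed.

Definition ar a b d : int :=
  (px b - px a) * (py d - py a) - (px d - px a) * (py b - py a).

Lemma area2_ar a b d : area2 (val a) (val b) (val d) = ar a b d.
Proof. exact: area2E. Qed.

(** Cramer's rule in the basis [b - a], [d - a]. When the area is 1 or -1, [sign_solve] turns it
    into integral coordinates of [x]. *)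
Lemma cramer_x a b d x : ar a b d * (px x - px a) =
  ar a x d * (px b - px a) + ar a b x * (px d - px a).
Proof. by rewrite /ar; ring. Qed.

Lemma cramer_y a b d x : ar a b d * (py x - py a) =
  ar a x d * (py b - py a) + ar a b x * (py d - py a).
Proof. by rewrite /ar; ring. Qed.

Lemma sign_solve (k x y : int) : k = 1 \/ k = -1 -> k * x = y -> x = k * y.
Proof. by case=> -> <-; rewrite ?mul1r // !mulN1r opprK. Qed.

(** The local picture at a bounded edge: two triangles on [a b] with opposite vertices [d] and [d'].
    By unimodularity the affine relation between the four points has this form with an integer [n];
    applied to the coefficients, it gives the length of the dual edge. *)
Record flip D e a b d d' (n : int) : Prop := Flip {
  flip_edge : e = [set a; b]%SET;
  flip_neq : [/\ a != b, a != d & b != d];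
  flip_neq' : [/\ a != d', b != d' & d != d'];
  flip_cell : [set a; b; d]%SET \in D;
  flip_cell' : [set a; b; d']%SET \in D;
  flip_only : forall T, T \in D -> e \subset T ->
    T = [set a; b; d]%SET \/ T = [set a; b; d']%SET;
  flip_x : px d + px d' = (2 - n) * px a + n * px b;
  flip_y : py d + py d' = (2 - n) * py a + n * py b }.

Lemma flip_sym D e a b d d' n : flip D e a b d d' n -> flip D e a b d' d n.
Proof.
case=> eE [ab ad bd] [ad' bd' dd'] cD cD' only hx hy; split=> //.
- by split=> //; rewrite eq_sym.
- by move=> T TD eT; case: (only T TD eT); [right | left].
- by rewrite addrC.
- by rewrite addrC.
Qed.

Definition flip_weight a b d d' (n : int) (x : A) : R :=
  (x == d)%:R + (x == d')%:R - (2 - n)%:~R * (x == a)%:R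
  - n%:~R * (x == b)%:R.

Lemma sum_delta (c : A -> R) a : \sum_x (x == a)%:R * c x = c a.
Proof.
by rewrite (bigD1 a) //= eqxx mul1r big1 ?addr0 // => x /negbTE ->; rewrite mul0r.
Qed.

Lemma flip_weight_sum (c : A -> R) a b d d' n :
  \sum_x flip_weight a b d d' n x * c x =
  c d + c d' - (2 - n)%:~R * c a - n%:~R * c b.
Proof.
have E (x1 x2 x3 x4 k1 k2 y : R) : (x1 + x2 - k1 * x3 - k2 * x4) * y =
    x1 * y + x2 * y - k1 * (x3 * y) - k2 * (x4 * y) by ring.
rewrite (eq_bigr _ (fun x _ => E _ _ _ _ _ _ _)).
rewrite sumrB; congr (_ - _); last by rewrite -mulr_sumr sum_delta.
rewrite sumrB; congr (_ - _); last by rewrite -mulr_sumr sum_delta.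
by rewrite big_split /= (sum_delta c d) (sum_delta c d').
Qed.

Section Triangulation.
Variable D : {set {set A}}.
Hypothesis unimodD : forall T, T \in D -> unimodular_triangle T.

Lemma cell_card T : T \in D -> #|T| = 3%N.
Proof.
move=> /unimodD[a [b [d [-> /eqP]]]]; rewrite area2_ar => h.
have ab : a != b by apply: contraTneq h => ->; rewrite /ar !subrr !mulr0 !mul0r.
have ad : a != d by apply: contraTneq h => ->; rewrite /ar !subrr !mulr0 !mul0r.
have bd : b != d.
  by apply: contraTneq h => ->; rewrite /ar mulrC subrr.
by rewrite finset.setUC cardsU1 !inE (eq_sym d) (eq_sym d b) (negbTE ad) (negbTE bd) cards2 ab.
Qed.

Lemma cell_eq T a b d : T \in D -> a \in T -> b \in T -> d \in T ->
  [/\ a != b, a != d & b != d] -> T = [set a; b; d]%SET.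
Proof.
move=> TD aT bT dT [ab ad bd]; apply/esym/eqP; rewrite eqEcard cell_card //.
apply/andP; split.
  by apply/fintype.subsetP => x; rewrite !inE -orbA => /or3P[] /eqP->.
by rewrite finset.setUC cardsU1 !inE (eq_sym d) (eq_sym d b) (negbTE ad) (negbTE bd) cards2 ab.
Qed.

Lemma cell_area T a b d : T \in D -> a \in T -> b \in T -> d \in T ->
  [/\ a != b, a != d & b != d] -> ar a b d = 1 \/ ar a b d = -1.
Proof.
move=> TD aT bT dT [ab ad bd].
have [x [y [z [TE]]]] := unimodD TD; rewrite area2_ar => h.
have {}h : ar x y z = 1 \/ ar x y z = -1 by move: (ar x y z) h; clear; lia.
move: aT bT dT; rewrite TE !inE -!orbA.
case/or3P=> /eqP aE; case/or3P=> /eqP bE; case/or3P=> /eqP dE;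
  move: ab ad bd; rewrite aE bE dE ?eqxx // => _ _ _;
  move: h; rewrite /ar; clear; lia.
Qed.

Lemma cell_third T a b : T \in D -> a \in T -> b \in T -> a != b ->
  exists d, [/\ d \in T, [/\ a != b, a != d & b != d] & T = [set a; b; d]%SET].
Proof.
move=> TD aT bT ab.
have : (0 < #|(T :\: [set a; b])%SET|)%N.
  by rewrite cardsDS ?(cell_card TD) ?cards2 ?ab //; apply/fintype.subsetP => x; rewrite !inE => /orP[]/eqP->.
case/card_gt0P => d; rewrite !inE negb_or => /andP[/andP[da db] dT].
have u : [/\ a != b, a != d & b != d] by rewrite ab !(eq_sym _ d) da db.
by exists d; split=> //; exact: cell_eq.
Qed.

Variable c : A -> R.
Hypothesis cD : induces c D.

Lemma cell_argmin T : T \in D -> exists v, argmin c v = T.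
Proof. by case/cD. Qed.

Lemma argmin_cell v a b d : a \in argmin c v -> b \in argmin c v ->
  d \in argmin c v -> ar a b d != 0 -> argmin c v \in D.
Proof.
move=> ha hb hd h; apply/cD; split; last by exists v.
by exists a, b, d; rewrite area2_ar.
Qed.

(** A further point [d] of the cell that is collinear with [a], [b] would be [a + n (b - a)] with
    [n] integral, because [a b] is a side of a unimodular triangle. Then [a] or [b] lies between [d]
    and the other one, and the exchange puts [d] into [T], whose third vertex is off the line. *)
Lemma edge_cell a b T v : T \in D -> a \in T -> b \in T -> a != b ->
  [set a; b]%SET \proper argmin c v -> argmin c v \in D.
Proof.
move=> TD aT bT ab /fintype.properP[/fintype.subsetP sub [d dv dab]].
have av : a \in argmin c v by apply: sub; rewrite !inE eqxx.
have bv : b \in argmin c v by apply: sub; rewrite !inE eqxx orbT.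
apply: (argmin_cell av bv dv); apply/negP => /eqP ar0.
have [d0 [d0T u TE]] := cell_third TD aT bT ab.
have har := cell_area TD aT bT d0T u.
have [w wT] := cell_argmin TD.
have [n [nx ny]] : exists n, px d - px a = n * (px b - px a) /\
    py d - py a = n * (py b - py a).
  exists (ar a b d0 * ar a d d0).
  have := cramer_x a b d0 d; have := cramer_y a b d0 d.
  rewrite ar0 !mul0r !addr0 => /(sign_solve har) -> /(sign_solve har) ->.
  by rewrite !mulrA.
have [aw bw] : a \in argmin c w /\ b \in argmin c w by rewrite wT.
have dT : d \in T.
  rewrite -wT; case: (lerP 1 n) => n1.
    by apply: (exchange1 (n := n - 1) _ _ _ bw bw dv av); clear -n1 nx ny; lia.
  by apply: (exchange1 (n := - n) _ _ _ aw aw dv bv); clear -n1 nx ny; lia.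
move: dT dab; rewrite TE !inE => /orP[-> //|/eqP dd0].
by move: har; rewrite -dd0 ar0 => -[].
Qed.

(** The two opposite vertices lie on different sides of [a b]: if the signed areas agreed, [d' - d]
    would be a multiple of [b - a], and the exchange would put [d] into the second triangle. With
    opposite areas, Cramer's rule is the relation of [flip]. *)
Lemma bounded_edge_flip e : e \in bounded_edges D ->
  exists a b d d' n, flip D e a b d d' n.
Proof.
rewrite inE => /andP[/cards2P[a [b [ab eE]]] /cards2P[T [T' [TT' DE]]]].
have hT X : (X \in [set X in D | e \subset X]%SET) = (X \in [set T; T'])%SET by rewrite DE.
have := hT T; have := hT T'; rewrite !inE !eqxx orbT => /andP[T'D eT'] /andP[TD eT].
have sub (X : {set A}) : e \subset X -> a \in X /\ b \in X.
  by move=> eX; split; apply: (fintype.subsetP eX); rewrite eE !inE eqxx ?orbT.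
have [[aT bT] [aT' bT']] := (sub _ eT, sub _ eT').
have [d [dT u TE]] := cell_third TD aT bT ab.
have [d' [d'T' u' T'E]] := cell_third T'D aT' bT' ab.
have dd' : d != d' by apply: contra_neq TT' => dd'; rewrite TE T'E dd'.
have h := cell_area TD aT bT dT u; have h' := cell_area T'D aT' bT' d'T' u'.
have dT' : d \notin T'.
  by case: u => _ ad bd; rewrite T'E !inE !negb_or dd' !(eq_sym d) ad bd.
have sqr : ar a b d * ar a b d = 1 by case: h => ->.
have [v vT] := cell_argmin TD; have [w wT] := cell_argmin T'D.
have opp : ar a b d' = - ar a b d.
  have [eq_ar|//] : ar a b d' = ar a b d \/ ar a b d' = - ar a b d.
    by case: h h' => -> [] ->; [left | right | right | left].
  have [n [nx ny]] : exists n, px d' - px d = n * (px b - px a) /\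
      py d' - py d = n * (py b - py a).
    exists (ar a b d * ar a d' d).
    have := cramer_x a b d d'; have := cramer_y a b d d'.
    rewrite eq_ar -!mulrA => hy hx.
    by split; apply: (sign_solve h); [move: hx | move: hy]; clear; lia.
  case/negP: dT'; rewrite -wT; rewrite -wT in d'T' aT' bT'; rewrite -vT in aT bT dT.
  case: (lerP 0 n) => n1.
    by apply: (exchange1 (n := n) _ _ _ d'T' aT' dT bT); clear -n1 nx ny; lia.
  by apply: (exchange1 (n := - n) _ _ _ d'T' bT' dT aT); clear -n1 nx ny; lia.
exists a, b, d, d', (ar a b d * ar a d' d); split=> //.
- by case: u'.
- by rewrite -TE.
- by rewrite -T'E.
- move=> X XD eX; have := hT X; rewrite !inE XD eX => /esym/orP[]/eqP->.
    by left.
  by right.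
- have /(sign_solve h) := cramer_x a b d d'; rewrite opp mulrDr mulNr mulrN.
  by rewrite !mulrA sqr; clear; lia.
- have /(sign_solve h) := cramer_y a b d d'; rewrite opp mulrDr mulNr mulrN.
  by rewrite !mulrA sqr; clear; lia.
Qed.


Lemma intr_inj_eq (x y : int) : (x%:~R = y%:~R :> R) <-> x = y.
Proof. by split=> [/intr_inj|->]. Qed.

Lemma value_diff (c' : A -> R) v w a b :
  value c' v a = value c' v b -> value c' w a = value c' w b ->
  (px b - px a)%:~R * (w 0 0 - v 0 0) + (py b - py a)%:~R * (w 1 0 - v 1 0) = 0.
Proof. by rewrite /value !intrB; lra. Qed.

(** Equality of the three minimal values gives two linear equations for [w - v] whose determinant is
    1 or -1, so a cell has only one dual vertex. *)
Lemma cell_point v w : argmin c v \in D -> argmin c w = argmin c v -> v = w.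
Proof.
move=> vD vw; have [x [y [z [TE]]]] := unimodD vD; rewrite area2_ar => h.
have h1 : ar x y z = 1 \/ ar x y z = -1 by move: (ar x y z) h; clear; lia.
have [xv yv zv] : [/\ x \in argmin c v, y \in argmin c v & z \in argmin c v].
  by rewrite TE !inE !eqxx !orbT.
have [xw yw zw] : [/\ x \in argmin c w, y \in argmin c w & z \in argmin c w].
  by rewrite vw.
have ey := value_diff (argmin_eq xv yv) (argmin_eq xw yw).
have ez := value_diff (argmin_eq xv zv) (argmin_eq xw zw).
have har : (ar x y z)%:~R != 0 :> R by rewrite intr_eq0; case: h1 => ->.
have E : (ar x y z)%:~R = (px y - px x)%:~R * (py z - py x)%:~R
   - (px z - px x)%:~R * (py y - py x)%:~R :> R by rewrite /ar !(intrB, intrM).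
apply: cV2P; apply/eqP; rewrite eq_sym -subr_eq0 -(mulrI_eq0 _ (mulfI har)) E; apply/eqP.
  set W := w 0 0 - v 0 0; move: ey ez; rewrite -/W.
  set W' := w 1 0 - v 1 0 => ey ez.
  transitivity ((py z - py x)%:~R * ((px y - px x)%:~R * W + (py y - py x)%:~R * W')
    - (py y - py x)%:~R * ((px z - px x)%:~R * W + (py z - py x)%:~R * W')); first by ring.
  by rewrite ey ez; ring.
set W' := w 1 0 - v 1 0; move: ey ez; rewrite -/W'.
set W := w 0 0 - v 0 0 => ey ez.
transitivity ((px y - px x)%:~R * ((px z - px x)%:~R * W + (py z - py x)%:~R * W')
    - (px z - px x)%:~R * ((px y - px x)%:~R * W + (py y - py x)%:~R * W')); first by ring.
by rewrite ey ez; ring.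
Qed.

Definition flip_length (c' : A -> R) a b d d' (n : int) : R :=
  c' d + c' d' - (2 - n)%:~R * c' a - n%:~R * c' b.

(** The flip relation annihilates affine functions, so the coefficients may be replaced by the
    values at [v], which agree on [a], [b], [d]. The length is thus the height of [d'] above the
    plane through the lifted triangle. *)
Lemma flip_lengthE e a b d d' n v : flip D e a b d d' n ->
  argmin c v = [set a; b; d]%SET ->
  flip_length c a b d d' n = value c v d' - value c v a.
Proof.
move=> f vT.
have [av bv dv] : [/\ a \in argmin c v, b \in argmin c v & d \in argmin c v].
  by rewrite vT !inE !eqxx !orbT.
have hb := argmin_eq av bv; have hd := argmin_eq av dv.
have hx := congr1 (fun z : int => z%:~R : R) (flip_x f).
have hy := congr1 (fun z : int => z%:~R : R) (flip_y f).
move: hx hy; rewrite /= !(intrD, intrM, intrB, intrN) => hx hy.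
rewrite /flip_length !(intrD, intrM, intrB, intrN).
transitivity (value c v d + value c v d' - (2 - n%:~R) * value c v a - n%:~R * value c v b).
  rewrite /value -[LHS]addr0 -[X in _ + X](_ : ((px d)%:~R + (px d')%:~R - ((2%:~R - n%:~R) * (px a)%:~R + n%:~R * (px b)%:~R)) * v 0 0 +
    ((py d)%:~R + (py d')%:~R - ((2%:~R - n%:~R) * (py a)%:~R + n%:~R * (py b)%:~R)) * v 1 0 = 0).
    by ring.
  by rewrite hx hy !subrr !mul0r addr0.
by rewrite -hb -hd; ring.
Qed.

Lemma flip_length_gt0 e a b d d' n : flip D e a b d d' n ->
  0 < flip_length c a b d d' n.
Proof.
move=> f; have [v vT] := cell_argmin (flip_cell f).
rewrite (flip_lengthE f vT) subr_gt0; apply: argmin_lt; rewrite vT !inE ?eqxx //.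
by have [ad' bd' dd'] := flip_neq' f; rewrite !negb_or !(eq_sym d') ad' bd'.
Qed.

(** The primitive direction [u] of [w - v] is orthogonal to [b - a], and unimodularity makes its
    pairing with [d' - a] equal to 1 or -1. Positivity of [flip_length] fixes the sign. *)
Lemma edge_length_dir e a b d d' n v w l : flip D e a b d d' n ->
  argmin c v = [set a; b; d]%SET -> argmin c w = [set a; b; d']%SET ->
  lattice_length v w l \/ lattice_length w v l -> l = flip_length c a b d d' n.
Proof.
move=> f vT wT hl.
have [l0 [u [cu zE0]]] : 0 <= l /\ exists u : 'cV[int]_2,
    coprimez (u 0 0) (u 1 0) /\ w - v = l *: zvec R u.
  case: hl => -[l0 [u [cu zE]]]; first by split=> //; exists u.
  split=> //; exists (- u); split; first by rewrite !mxE /coprimez /gcdz !abszN.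
  by rewrite -opprB zE; apply/cV2P; rewrite !mxE rmorphN mulrN.
have zE i : w i 0 - v i 0 = l * (u i 0)%:~R.
  by move: (congr1 (fun z : 'cV[R]_2 => z i 0) zE0); rewrite !mxE.
have [av bv] : a \in argmin c v /\ b \in argmin c v by rewrite vT !inE !eqxx !orbT.
have [aw bw d'w] : [/\ a \in argmin c w, b \in argmin c w & d' \in argmin c w].
  by rewrite wT !inE !eqxx !orbT.
have pos := flip_length_gt0 f; have LE := flip_lengthE f vT.
have u' : [/\ a != b, a != d' & b != d'] by case: (flip_neq f); case: (flip_neq' f).
have har := cell_area (flip_cell' f) (_ : a \in _) (_ : b \in _) (_ : d' \in _) u'.
rewrite !inE !eqxx !orbT in har; have {}har := har isT isT isT.
have lE : flip_length c a b d d' n =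
    - l * ((px d' - px a) * u 0 0 + (py d' - py a) * u 1 0)%:~R.
  rewrite LE; have := argmin_eq aw d'w; rewrite /value => h.
  rewrite !(intrD, intrM, intrB, intrN); have := zE 0; have := zE 1; nra.
have l_neq0 : l != 0 by apply: contraTneq pos => l0'; rewrite lE l0' oppr0 mul0r ltxx.
have Bu : (px b - px a) * u 0 0 + (py b - py a) * u 1 0 = 0.
  apply/intr_inj_eq; apply: (mulfI l_neq0); rewrite mulr0.
  rewrite -(value_diff (argmin_eq av bv) (argmin_eq aw bw)) !zE.
  have E (x y z t : int) : (x * y + z * t)%:~R = x%:~R * y%:~R + z%:~R * t%:~R :> R.
    by rewrite intrD !intrM.
  by rewrite E; ring.
set m := (X in _ * X%:~R) in lE.
have /coprimezP[[s t] /= st] := cu.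
(* The Bezout coefficients of [u] exhibit [m] as a divisor of an area which is 1 or -1. *)
have mk : (m * (t * (px b - px a) - s * (py b - py a)))%R = ar a b d'.
  rewrite -[RHS]mulr1 -st /m /ar.
  have -> : ((px b - px a) * (py d' - py a) - (px d' - px a) * (py b - py a)) * (s * u 0 0 + t * u 1 0)
    = s * (((px b - px a) * u 0 0 + (py b - py a) * u 1 0) * (py d' - py a) - ((px d' - px a) * u 0 0 + (py d' - py a) * u 1 0) * (py b - py a))
    + t * (((px d' - px a) * u 0 0 + (py d' - py a) * u 1 0) * (px b - px a) - ((px b - px a) * u 0 0 + (py b - py a) * u 1 0) * (px d' - px a)) by ring.
  by rewrite Bu; ring.
have m1 : m = 1 \/ m = -1.
  move: (_ - s * _) mk => k mk; have : (`|m| * `|k| = 1)%N by rewrite -abszM mk; case: har => ->.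
  by move/eqP; rewrite muln_eq1 => /andP[/eqP h _]; move: h; clear; lia.
by case: m1 lE => ->; rewrite /= ?rmorphN1 ?mulrN1 ?mulr1 ?opprK //; lra.
Qed.

Lemma edge_lengthP e a b d d' n l : flip D e a b d d' n ->
  edge_length c e l <-> l = flip_length c a b d d' n.
Proof.
move=> f; have eE := flip_edge f.
have ab : a != b by case: (flip_neq f).
have [aT bT] : a \in [set a; b; d]%SET /\ b \in [set a; b; d]%SET by rewrite !inE !eqxx orbT.
have dir l' : edge_length c e l' -> l' = flip_length c a b d d' n.
  case=> v [w [vw ev ew ll]].
  have vD : argmin c v \in D by apply: edge_cell (flip_cell f) aT bT ab _; rewrite -eE.
  have wD : argmin c w \in D by apply: edge_cell (flip_cell f) aT bT ab _; rewrite -eE.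
  case: (flip_only f vD (proper_sub ev)) => vT; case: (flip_only f wD (proper_sub ew)) => wT.
  - by case/eqP: vw; apply: cell_point vD _; rewrite vT wT.
  - by apply: edge_length_dir f vT wT _; left.
  - by apply: edge_length_dir f wT vT _; right.
  - by case/eqP: vw; apply: cell_point vD _; rewrite vT wT.
split=> [|->]; first exact: dir.
have [v vT] := cell_argmin (flip_cell f); have [w wT] := cell_argmin (flip_cell' f).
have [av bv] : a \in argmin c v /\ b \in argmin c v by rewrite vT !inE !eqxx !orbT.
have [aw bw] : a \in argmin c w /\ b \in argmin c w by rewrite wT !inE !eqxx !orbT.
have [_ ad bd] := flip_neq f; have [ad' bd' dd'] := flip_neq' f.
have dn : d \notin [set a; b; d']%SET.
  by rewrite !inE !negb_or dd' !(eq_sym d) ad bd.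
have d'n : d' \notin [set a; b; d]%SET.
  by rewrite !inE !negb_or !(eq_sym d') ad' bd' dd'.
have pr x (X : {set A}) : x \in X -> x \notin e -> e \subset X -> e \proper X.
  by move=> xX xe s; apply/fintype.properP; split=> //; exists x.
have sub x : e \subset [set a; b; x]%SET.
  by rewrite eE; apply/fintype.subsetP => y; rewrite !inE => ->.
have ne x : x \notin [set a; b; d]%SET \/ x \notin [set a; b; d']%SET -> x \notin e.
  by rewrite eE !inE => -[]; rewrite !negb_or => /andP[/andP[-> ->]].
(* Any lattice length between the two dual vertices will do, since [dir] then identifies it. *)
suff [l1 ll] : exists l1, lattice_length v w l1.
  have h : edge_length c e l1; last by rewrite -(dir _ h).
  exists v, w; split=> //.
  - by apply: contraNneq dn => vw; rewrite -wT -vw vT !inE eqxx orbT.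
  - by rewrite vT; apply: (pr d); [rewrite !inE eqxx ?orbT | apply: ne; right | exact: sub].
  - by rewrite wT; apply: (pr d'); [rewrite !inE eqxx ?orbT | apply: ne; left | exact: sub].
have har := cell_area (flip_cell f) (_ : a \in _) (_ : b \in _) (_ : d \in _) (flip_neq f).
rewrite !inE !eqxx !orbT in har; have {}har := har isT isT isT.
have Bz := value_diff (argmin_eq av bv) (argmin_eq aw bw).
(* The factor of [w - v] along [b - a] turned by a right angle. That vector is primitive, the area
   of the triangle being a Bezout relation between its coordinates. *)
pose t := (ar a b d)%:~R * ((px d - px a)%:~R * (w 0 0 - v 0 0) + (py d - py a)%:~R * (w 1 0 - v 1 0)).
have cop : coprimez (py b - py a) (px b - px a).
  apply/coprimezP; exists (- ar a b d * (px d - px a), ar a b d * (py d - py a)) => /=.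
  transitivity (ar a b d * ar a b d); first by rewrite {3}/ar; ring.
  by case: har => ->.
have tz : w - v = t *: zvec R (point (- (py b - py a)) (px b - px a)).
  have E : (ar a b d)%:~R = (px b - px a)%:~R * (py d - py a)%:~R
   - (px d - px a)%:~R * (py b - py a)%:~R :> R by rewrite /ar !(intrB, intrM).
  have aa : (ar a b d)%:~R * (ar a b d)%:~R = 1 :> R by rewrite -intrM; case: har => ->.
  have cr (X Y Z : R) : (ar a b d)%:~R * X = Y * Z -> X = (ar a b d)%:~R * Y * Z.
    by move=> h; have := congr1 ( *%R (ar a b d)%:~R) h; rewrite !mulrA aa mul1r.
  move: Bz; rewrite /t.
  have -> : w 0 0 - v 0 0 = (w - v) 0 0 by rewrite !mxE.
  have -> : w 1 0 - v 1 0 = (w - v) 1 0 by rewrite !mxE.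
  move: (w - v) => z Bz.
  apply: cV2P; rewrite [RHS]mxE zvecE ?pointE0 ?pointE1; apply: cr; rewrite E ?intrN.
    apply/eqP; rewrite -subr_eq0 -[X in _ == X](mulr0 (py d - py a)%:~R) -Bz.
    by apply/eqP; ring.
  apply/eqP; rewrite -subr_eq0 -[X in _ == X](mulr0 (- (px d - px a)%:~R)) -Bz.
  by apply/eqP; ring.
exists `|t|; split=> //; case: (lerP 0 t) => t0.
  exists (point (- (py b - py a)) (px b - px a)); rewrite pointE0 pointE1.
  by rewrite ger0_norm //; split=> //; case: (coprimez_opp cop).
exists (point (py b - py a) (- (px b - px a))); rewrite pointE0 pointE1.
split=> //; first by case: (coprimez_opp cop).
rewrite tz ltr0_norm //; apply: cV2P; rewrite [LHS]mxE [RHS]mxE !zvecE ?pointE0 ?pointE1 !intrN.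
  by rewrite mulrN mulNr.
by rewrite mulrN mulNr opprK.
Qed.

End Triangulation.

End Cells.

(** * Edge lengths as linear functions of the coefficients *)

(** The default of [xget] never occurs: a subspace of least dimension containing [C] is contained in
    every other one, as intersecting the two cannot lower the dimension. *)
Lemma linear_spanP (R : realType) (V : vectType R) (C : set V) :
  (forall x, C x -> x \in linear_span C) /\
  forall W : {vspace V}, (forall x, C x -> x \in W) -> (linear_span C <= W)%VS.
Proof.
rewrite /linear_span; case: xgetP => [U _ //|no].
have ex : exists n, `[< exists U : {vspace V}, (forall x, C x -> x \in U) /\ \dim U = n >].
  by exists (\dim (fullv : {vspace V})); apply/asboolP; exists fullv; split=> // x _; exact: memvf.
case: (ex_minnP ex) => n /asboolP[U [CU dU]] min.
exfalso; apply: (no U); split=> // W CW.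
have : (n <= \dim (U :&: W))%N.
  apply: min; apply/asboolP; exists (U :&: W)%VS; split=> // x Cx.
  by rewrite memv_cap CU // CW.
rewrite -dU => h; have /eqP <- : (U :&: W == U)%VS by rewrite eqEdim capvSl.
exact: capvSr.
Qed.

Lemma solve_linear2 (F : fieldType) (x1 y1 x2 y2 c1 c2 : F) :
  x1 * y2 - x2 * y1 != 0 ->
  exists k1 k2, k1 * x1 + k2 * y1 = c1 /\ k1 * x2 + k2 * y2 = c2.
Proof.
move=> h; exists ((c1 * y2 - c2 * y1) / (x1 * y2 - x2 * y1)).
by exists ((x1 * c2 - x2 * c1) / (x1 * y2 - x2 * y1)); split; field.
Qed.

Section Skeleton.
Variables (R : realType) (A : {fset 'cV[int]_2}) (D : {set {set A}}).
Implicit Types (c : A -> R) (v w : 'cV[R]_2) (a b d p q s : A).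
Implicit Types (T e : {set A}) (S : {set {set A}}).

Lemma retract_sub (F : {set {set A}}) : retract_leaves D F \subset F.
Proof. by apply/fintype.subsetP => e; rewrite inE => /andP[]. Qed.

Lemma core_sub : core D \subset bounded_edges D.
Proof.
rewrite /core; elim: #|_| => [//|n IH] /=.
exact: fintype.subset_trans (retract_sub _) IH.
Qed.

Lemma core_stable : retract_leaves D (core D) = core D.
Proof.
have key n : let F := iter n (retract_leaves D) (bounded_edges D) in
    retract_leaves D F = F \/ (#|F| <= #|bounded_edges D| - n)%N.
  elim: n => [|n /= [IH|IH]] /=; first by right; rewrite subn0.
    by left; rewrite !IH.
  set F := iter n _ _ in IH *; have [E|neq] := eqVneq (retract_leaves D F) F.
    by left; rewrite E.
  have : retract_leaves D F \proper F by rewrite finset.properEneq neq retract_sub.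
  by move/proper_card => h; right; rewrite subnS -ltnS; apply: leq_trans h (leq_trans IH (leqSpred _)).
have [//|] := key #|bounded_edges D|.
rewrite subnn leqn0 cards_eq0 -/(core D) => /eqP ->; apply/eqP.
by rewrite -finset.subset0 retract_sub.
Qed.

Lemma core_valence e T : e \in core D -> T \in D -> e \subset T ->
  valence (core D) T != 1%N.
Proof.
rewrite -{1}core_stable inE => /andP[_ /forall_inP h] TD eT.
by move: (h T TD); rewrite eT.
Qed.

Lemma class_sub S : S \in skeleton_edges D -> S \subset core D.
Proof. by case/imsetP => e _ ->; apply/fintype.subsetP => x; rewrite inE => /andP[]. Qed.

Lemma class_closed S e e' : S \in skeleton_edges D -> e \in S ->
  smooth_rel D e e' -> e' \in S.
Proof.
case/imsetP => e0 _ ->; rewrite !inE => /andP[_ h] hr.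
have [_ -> _] := and3P hr; exact: connect_trans h (connect1 hr).
Qed.

(** A bounded edge has several [flip] descriptions, according to the order of its ends and of the
    opposite vertices; one is chosen, and the default 0 is for the sets without any. *)
Definition edge_weight e : A -> R := xget (fun=> 0)
  [set w | exists a b d d' n, flip D e a b d d' n /\ w = flip_weight R a b d d' n].

Definition column (x : A) : {ffun {S | S \in skeleton_edges D} -> R^o} :=
  [ffun S : {S | S \in skeleton_edges D} => (\sum_(e in val S) edge_weight e x : R^o)].

Hypothesis unimodD : forall T, T \in D -> unimodular_triangle T.

Lemma edge_weightP c e : induces c D -> e \in bounded_edges D ->
  exists a b d d' n, flip D e a b d d' n /\ edge_weight e = flip_weight R a b d d' n.
Proof.
move=> cD eb; rewrite /edge_weight; case: xgetP => [w _ //|no].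
have [a [b [d [d' [n f]]]]] := bounded_edge_flip unimodD cD eb.
by exfalso; apply: (no (flip_weight R a b d d' n)); exists a, b, d, d', n.
Qed.

Lemma edge_length_weight c e l : induces c D -> e \in bounded_edges D ->
  edge_length c e l <-> l = \sum_x edge_weight e x * c x.
Proof.
move=> cD eb; have [a [b [d [d' [n [f ->]]]]]] := edge_weightP cD eb.
by rewrite (edge_lengthP unimodD cD l f) flip_weight_sum.
Qed.

Lemma sum_columnE (k : A -> R) (S : {S | S \in skeleton_edges D}) :
  (\sum_x k x *: column x) S = \sum_(e in val S) \sum_x edge_weight e x * k x.
Proof.
rewrite exchange_big /= sum_ffunE; apply: eq_bigr => x _; rewrite !ffunE.
by rewrite -mulr_suml mulrC.
Qed.

(** Lengths are linear in the coefficients, so the cone is the linear image of the set of inducing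
    coefficients. *)
Lemma skeleton_coneP m : skeleton_cone (R := R) (D := D) m <->
  exists2 c, induces c D & m = \sum_x c x *: column x.
Proof.
have eb (S : {S | S \in skeleton_edges D}) e : e \in val S -> e \in bounded_edges D.
  by move=> /(fintype.subsetP (class_sub (valP S))) /(fintype.subsetP core_sub).
split=> [[c [len [cD hlen hm]]]|[c cD ->]].
  exists c => //; apply/ffunP => S; rewrite hm sum_columnE; apply: eq_bigr => e eS.
  by apply/(edge_length_weight _ cD (eb _ _ eS)); apply: hlen; apply: eb eS.
exists c, (fun e => \sum_x edge_weight e x * c x); split=> //.
  by move=> e he; apply/(edge_length_weight _ cD he).
by move=> S; rewrite sum_columnE.
Qed.

(** Adding an affine function to the coefficients merely translates the curve; algebraically, every
    flip relation annihilates it. *)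
Lemma column_affine c k0 k1 k2 : induces c D ->
  \sum_x (k0 + k1 * (px x)%:~R + k2 * (py x)%:~R) *: column x = 0.
Proof.
move=> cD; apply/ffunP => S; rewrite sum_columnE ffunE big1 // => e eS.
have eb : e \in bounded_edges D.
  by move: eS => /(fintype.subsetP (class_sub (valP S))) /(fintype.subsetP core_sub).
have [a [b [d [d' [n [f ->]]]]]] := edge_weightP cD eb.
rewrite flip_weight_sum.
have hx := congr1 (fun z : int => z%:~R : R) (flip_x f).
have hy := congr1 (fun z : int => z%:~R : R) (flip_y f).
move: hx hy; rewrite /= 2!intrD 2!intrD !intrM => hx hy.
rewrite -[RHS](_ : k1 * ((px d)%:~R + (px d')%:~R - ((2 - n)%:~R * (px a)%:~R + n%:~R * (px b)%:~R))
  + k2 * ((py d)%:~R + (py d')%:~R - ((2 - n)%:~R * (py a)%:~R + n%:~R * (py b)%:~R)) = 0); last first.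
  by rewrite hx hy !subrr !mulr0 addr0.
by rewrite !intrB; ring.
Qed.

(** Subtracting the affine function that interpolates the coefficients at [t0], [t1], [t2] removes
    these three columns without changing the metric, so the columns outside [N] and these points
    span the cone. *)
Lemma cone_dim_le c (N : {set A}) t0 t1 t2 : induces c D ->
  (forall q, q \in N -> column q = 0) ->
  [/\ t0 \notin N, t1 \notin N & t2 \notin N] -> ar t0 t1 t2 != 0 ->
  (cone_dim (skeleton_cone (R := R) (D := D)) + #|N| + 3 <= #|{: A}|)%N.
Proof.
move=> cD Ncol [t0N t1N t2N] art.
pose N' := (N :|: [set t0; t1; t2])%SET.
have cN' : #|N'| = (#|N| + 3)%N.
  have n01 : t0 != t1 by apply: contraNneq art => ->; rewrite /ar !subrr !mul0r mulr0 subrr.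
  have n02 : t0 != t2 by apply: contraNneq art => ->; rewrite /ar !subrr !mul0r mulr0 subrr.
  have n12 : t1 != t2 by apply: contraNneq art => ->; rewrite /ar mulrC subrr.
  rewrite /N' cardsU (_ : N :&: _ = finset.set0)%SET ?cards0 ?subn0.
    congr (_ + _)%N.
    by rewrite finset.setUC cardsU1 !inE !(eq_sym t2) negb_or n02 n12 cards2 n01.
  apply/setP => x; rewrite !inE; apply/andP => -[xN /orP[/orP[]|]] /eqP xE;
    by move: xN; rewrite xE (negbTE t0N) || rewrite xE (negbTE t1N) || rewrite xE (negbTE t2N).
have -> : #|{: A}| = (#|(~: N')%SET| + #|N| + 3)%N by rewrite -addnA -cN' addnC cardsC.
rewrite !leq_add2r cardE -(size_map column).
apply: leq_trans (dim_span _); apply: dimvS; apply: (proj2 (linear_spanP _)).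
move=> m /skeleton_coneP[c' c'D ->].
have [k1 [k2 [h1 h2]]] : exists k1 k2 : R,
    k1 * (px t1 - px t0)%:~R + k2 * (py t1 - py t0)%:~R = c' t1 - c' t0 /\
    k1 * (px t2 - px t0)%:~R + k2 * (py t2 - py t0)%:~R = c' t2 - c' t0.
  by apply: solve_linear2; rewrite -!intrM -intrB intr_eq0.
pose k0 := c' t0 - k1 * (px t0)%:~R - k2 * (py t0)%:~R.
pose f (x : A) := k0 + k1 * (px x)%:~R + k2 * (py x)%:~R.
have ft0 : f t0 = c' t0 by rewrite /f /k0; ring.
have ft1 : f t1 = c' t1.
  by rewrite -[RHS](subrK (c' t0)) -h1 /f /k0 !intrB; ring.
have ft2 : f t2 = c' t2.
  by rewrite -[RHS](subrK (c' t0)) -h2 /f /k0 !intrB; ring.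
have -> : \sum_x c' x *: column x = \sum_x (c' x - f x) *: column x.
  have aff : \sum_x f x *: column x = 0 by exact: column_affine c'D.
  rewrite [RHS](eq_bigr _ (fun x _ => scalerBl (c' x) (f x) (column x))).
  by rewrite sumrB aff subr0.
apply: memv_suml => x _; have [xN'|xN'] := boolP (x \in N').
  suff -> : (c' x - f x) *: column x = 0 by exact: mem0v.
  move: xN'; rewrite !inE => /orP[/Ncol ->|/orP[/orP[]|]]; first by rewrite scaler0.
  - by move/eqP->; rewrite ft0 subrr scale0r.
  - by move/eqP->; rewrite ft1 subrr scale0r.
  - by move/eqP->; rewrite ft2 subrr scale0r.
by apply/memvZ/memv_span/map_f; rewrite mem_enum inE.
Qed.

(** Since coefficients near [c] still induce [D], each column is a difference quotient of two
    members of the cone and lies in its span. The last hypothesis says that the columns indexed by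
    [B] are independent. *)
Lemma cone_dim_ge c (B : {set A}) : induces c D ->
  (forall k : A -> R, exists2 r : R, 0 < r & induces (fun x => c x + r * k x) D) ->
  (forall k : A -> R, (forall x, x \notin B -> k x = 0) ->
     \sum_x k x *: column x = 0 -> forall x, k x = 0) ->
  (#|B| <= cone_dim (skeleton_cone (R := R) (D := D)))%N.
Proof.
move=> cD near_c inj; have [sp _] := linear_spanP (skeleton_cone (R := R) (D := D)).
have col_in b : column b \in linear_span (skeleton_cone (R := R) (D := D)).
  have [r r0 cD'] := near_c (fun x => (x == b)%:R).
  have mem_sp c' : induces c' D ->
      \sum_x c' x *: column x \in linear_span (skeleton_cone (R := R) (D := D)).
    by move=> c'D; apply: sp; apply/skeleton_coneP; exists c'.
  have -> : column b = r^-1 *: (\sum_x (c x + r * (x == b)%:R) *: column x - \sum_x c x *: column x).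
    rewrite [X in X - _](eq_bigr _ (fun x _ => scalerDl (column x) (c x) (r * (x == b)%:R))).
    rewrite big_split /= addrAC subrr add0r (bigD1 b) //= eqxx mulr1.
    rewrite big1 ?addr0 ?scalerA ?mulVf ?gt_eqF ?scale1r // => x /negbTE ->.
    by rewrite mulr0 scale0r.
  by apply: memvZ; apply: memvB; exact: mem_sp.
have fr : free [seq column b | b <- enum B].
  pose s := [seq column b | b <- enum B].
  have sE : size s = size (enum B) by rewrite size_map.
  change (free (tval (in_tuple s))); apply/freeP => k k0 i.
  (* Coefficients indexed by positions in [enum B] are turned into a function on all points, zero
     outside [B], to which [inj] applies. *)
  pose K j := oapp k 0 (insub j : option 'I_(size s)).
  have KE (j : 'I_(size s)) : K j = k j by rewrite /K valK.
  have [b0 b0B] : exists b0, b0 \in enum B.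
    have : (0 < size (enum B))%N by rewrite -sE; apply: leq_ltn_trans (ltn_ord i).
    by case: (enum B) => // b0 l _; exists b0; rewrite inE eqxx.
  pose k' x := if x \in B then K (index x (enum B)) else 0.
  have k'0 x : k' x = 0.
    apply: inj => [y /negbTE yB|]; first by rewrite /k' yB.
    rewrite (bigID (mem B)) /= [X in _ + X]big1 ?addr0; last first.
      by move=> y /negbTE yB; rewrite /k' yB scale0r.
    rewrite -[RHS]k0 -big_enum /= (big_nth b0) -sE big_mkord; apply: eq_bigr => j _.
    have jB : (j < size (enum B))%N by rewrite -sE.
    have := mem_nth b0 jB; rewrite mem_enum /k' => ->.
    by rewrite index_uniq ?enum_uniq // KE (nth_map b0).
  have iB : (i < size (enum B))%N by rewrite -sE.
  have := k'0 (nth b0 (enum B) i); have := mem_nth b0 iB.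
  by rewrite mem_enum /k' => ->; rewrite index_uniq ?enum_uniq // KE.
rewrite cardE -(size_map column) -(eqP fr) /cone_dim; apply: dimvS.
by apply/span_subvP => u /mapP[b _ ->].
Qed.

End Skeleton.

(** * Points whose coefficient does not affect the metric *)

Section Irrelevant.
Variables (R : realType) (A : {fset 'cV[int]_2}) (D : {set {set A}}).
Implicit Types (a b d p q s : A) (T e : {set A}) (S : {set {set A}}).

Lemma subset_triple e a b d : #|e| = 2%N -> e \subset [set a; b; d]%SET ->
  [\/ e = [set a; b]%SET, e = [set a; d]%SET | e = [set b; d]%SET].
Proof.
move/eqP/cards2P => [x [y [xy ->]]] /fintype.subsetP sub.
have := sub x; rewrite !inE eqxx -orbA => /(_ isT).
have := sub y; rewrite !inE eqxx orbT -orbA => /(_ isT).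
case/or3P=> /eqP yE; case/or3P=> /eqP xE; move: xy; rewrite xE yE ?eqxx // => _.
- by constructor 1; rewrite finset.setUC.
- by constructor 2; rewrite finset.setUC.
- by constructor 1.
- by constructor 3; rewrite finset.setUC.
- by constructor 2.
- by constructor 3.
Qed.

Lemma core_card e : e \in core D -> #|e| = 2%N.
Proof.
by move=> /(fintype.subsetP (core_sub D)); rewrite inE => /andP[/eqP].
Qed.

(** No vertex of the core is 1-valent, so a triangle with [e0] in the core and room for at most one
    more core edge has valence exactly 2; smoothing merges the two edges. *)
Lemma core_pair T e0 e1 : T \in D -> e0 \in core D -> e0 \subset T ->
  e1 \subset T -> e0 != e1 ->
  (forall e, e \in core D -> e \subset T -> e = e0 \/ e = e1) ->
  e1 \in core D /\ smooth_rel D e0 e1.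
Proof.
move=> TD e0C e0T e1T e01 only.
have val_neq1 := core_valence e0C TD e0T.
have e1C : e1 \in core D.
  apply: contraNT val_neq1 => e1C; rewrite /valence (_ : [set e in core D | e \subset T]%SET = [set e0]%SET) ?cards1 //.
  apply/setP => x; rewrite !inE; apply/andP/eqP => [[xC xT]|->//].
  by case: (only x xC xT) => // xE; rewrite -xE xC in e1C.
split=> //; apply/and3P; split=> //; apply/exists_inP; exists T => //.
rewrite e0T e1T !andbT /valence (_ : [set e in core D | e \subset T]%SET = [set e0; e1]%SET).
  by rewrite cards2 e01.
apply/setP => x; rewrite !inE; apply/andP/orP => [[xC xT]|[]/eqP->//].
by case: (only x xC xT) => ->; [left | right].
Qed.

Hypothesis unimodD : forall T, T \in D -> unimodular_triangle T.
Variable c : A -> R.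
Hypothesis cD : induces c D.

Lemma bounded_edge_two_cells e q : e \in bounded_edges D -> q \in e ->
  exists T T', [/\ T \in D, T' \in D, T != T', q \in T & q \in T'] /\ e \subset T :&: T'.
Proof.
move=> /(bounded_edge_flip unimodD cD)[a [b [d [d' [n f]]]]] qe.
exists [set a; b; d]%SET, [set a; b; d']%SET.
have [ad' bd' dd'] := flip_neq' f; have [ab ad bd] := flip_neq f.
move: qe; rewrite (flip_edge f) => qe; split; [split|].
- exact: flip_cell f.
- exact: flip_cell' f.
- apply/negP => /eqP/setP/(_ d); rewrite !inE eqxx orbT (negbTE dd') orbF !(eq_sym d).
  by rewrite (negbTE ad) (negbTE bd).
- by rewrite inE qe.
- by rewrite inE qe.
by apply/fintype.subsetP => x; rewrite !inE => ->.
Qed.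

Lemma flip_weight_neq0 a b d d' n q : flip_weight R a b d d' n q != 0 ->
  q \in [set a; b]%SET \/ (q = d \/ q = d').
Proof.
rewrite /flip_weight !inE; have [->|_] := eqVneq q a; first by left.
have [->|_] := eqVneq q b; first by left.
have [->|_] := eqVneq q d; first by right; left.
have [->|_] := eqVneq q d'; first by right; right.
by rewrite !mulr0 !subr0 addr0 eqxx.
Qed.

(** The edges at [q] lie in one triangle, so they are rays. The third edge of [T0] would then end in
    a 1-valent vertex, so it is not in the core, and [q] has weight in no core edge. *)
Lemma lone_column (q : A) T0 : (forall T, T \in D -> q \in T -> T = T0) ->
  column R D q = 0.
Proof.
move=> only; apply/ffunP => S; rewrite !ffunE big1 // => e eS.
have eC := fintype.subsetP (class_sub (valP S)) _ eS.
have eB := fintype.subsetP (core_sub D) _ eC.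
have notin e' : e' \in bounded_edges D -> q \notin e'.
  move=> e'B; apply/negP => qe'; have [T [T' [[TD T'D /eqP TT' qT qT'] _]]] := bounded_edge_two_cells e'B qe'.
  by apply: TT'; rewrite (only _ TD qT) (only _ T'D qT').
have noflip a b d d' n : flip D e a b d d' n -> q <> d.
  move=> f qd; have eT : e \subset [set a; b; d]%SET.
    by rewrite (flip_edge f); apply/fintype.subsetP => x; rewrite !inE => ->.
  have /negP := core_valence eC (flip_cell f) eT; apply.
  rewrite /valence (_ : [set e in core D | e \subset [set a; b; d]]%SET = [set e]%SET) ?cards1 //.
  apply/setP => x; rewrite !inE; apply/andP/eqP => [[xC xT]|->//].
  have qx := notin _ (fintype.subsetP (core_sub D) _ xC).
  case: (subset_triple (core_card xC) xT) => xE.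
  - by rewrite xE (flip_edge f).
  - by move: qx; rewrite xE qd !inE eqxx orbT.
  - by move: qx; rewrite xE qd !inE eqxx orbT.
have [a [b [d [d' [n [f ->]]]]]] := edge_weightP unimodD cD eB.
apply/eqP; apply: contraTT isT => /flip_weight_neq0[qe|[qd|qd']].
- by move: (notin _ eB); rewrite (flip_edge f) qe.
- by case: (noflip _ _ _ _ _ f).
- by case: (noflip _ _ _ _ _ (flip_sym f)).
Qed.

(* The lengths of the three edges dual to [p q1], [p q] and [p q2] change by
   [1], [-2] and [1] times the coefficient of [q], and these edges are merged
   in the skeleton. *)
Lemma fan_column q p q1 q2 :
  [/\ q != p, q != q1, q != q2 & [/\ p != q1, p != q2 & q1 != q2]] ->
  px q1 + px q2 = 2 * px q -> py q1 + py q2 = 2 * py q ->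
  [set p; q; q1]%SET \in D -> [set p; q; q2]%SET \in D ->
  (forall T, T \in D -> q \in T -> T = [set p; q; q1]%SET \/ T = [set p; q; q2]%SET) ->
  column R D q = 0.
Proof.
move=> [qp qq1 qq2 [pq1 pq2 q12]] hx hy T1D T2D only.
set T1 := [set p; q; q1]%SET in T1D only; set T2 := [set p; q; q2]%SET in T2D only.
have T12 : (T1 :&: T2 = [set p; q])%SET.
  apply/setP => x; rewrite !inE; have [->|xp] := eqVneq x p => //=.
  have [->|xq] := eqVneq x q => //=; apply/andP => -[/eqP-> /eqP h].
  by rewrite h eqxx in q12.
have edge_q e : e \in bounded_edges D -> q \in e -> e = [set p; q]%SET.
  move=> eB qe; have [T [T' [[TD T'D TT' qT qT'] sub]]] := bounded_edge_two_cells eB qe.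
  have {}sub : e \subset [set p; q]%SET.
    by rewrite -T12; case: (only _ TD qT) (only _ T'D qT') TT' sub => -> [] ->; rewrite ?eqxx // => _; rewrite finset.setIC.
  apply/eqP; rewrite eqEcard sub cards2 (eq_sym p) qp.
  by move: eB; rewrite inE => /andP[/eqP->].
apply/ffunP => S; rewrite !ffunE.
have SC := fintype.subsetP (class_sub (valP S)).
have CB := fintype.subsetP (core_sub D).
pose e0 := [set p; q]%SET; pose e1 := [set p; q1]%SET; pose e2 := [set p; q2]%SET.
have e01 : e0 != e1 by apply/negP => /eqP/setP/(_ q); rewrite !inE eqxx orbT (negbTE qp) (negbTE qq1).
have e02 : e0 != e2 by apply/negP => /eqP/setP/(_ q); rewrite !inE eqxx orbT (negbTE qp) (negbTE qq2).
have e12 : e1 != e2.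
  by apply/negP => /eqP/setP/(_ q1); rewrite !inE eqxx orbT (eq_sym q1 p) (negbTE pq1) (negbTE q12).
have tri q' : q != q' -> forall e, e \in core D -> e \subset [set p; q; q']%SET ->
    e = e0 \/ e = [set p; q']%SET.
  move=> qq' e eC eT; case: (subset_triple (core_card eC) eT) => eE; [by left|by right|].
  by left; apply: (edge_q e (CB _ eC)); rewrite eE !inE eqxx.
have sub0 q' : e0 \subset [set p; q; q']%SET by apply/fintype.subsetP => x; rewrite !inE => ->.
have subp q' : [set p; q']%SET \subset [set p; q; q']%SET.
  by apply/fintype.subsetP => x; rewrite !inE => /orP[]->; rewrite ?orbT.
have weight0 e : e \in val S -> e != e0 -> e != e1 -> e != e2 -> edge_weight R D e q = 0.
  move=> eS ne0 ne1 ne2; have eB := CB _ (SC _ eS).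
  have [a [b [d [d' [n [f ->]]]]]] := edge_weightP unimodD cD eB.
  have opp d0 T : T = [set a; b; d0]%SET -> T \in D -> q \in T -> q = d0 -> False.
    move=> TE TD qT qd.
    have eT : e \subset T by rewrite TE (flip_edge f); apply/fintype.subsetP => x; rewrite !inE => ->.
    case: (only T TD qT) => TE'; move: eT; rewrite TE'.
      by case/(tri q1 qq1 e (SC _ eS)) => /eqP; rewrite ?(negbTE ne0) ?(negbTE ne1).
    by case/(tri q2 qq2 e (SC _ eS)) => /eqP; rewrite ?(negbTE ne0) ?(negbTE ne2).
  apply/eqP; apply: contraTT isT => /flip_weight_neq0[qe|[qd|qd']].
  - by rewrite -(flip_edge f) in qe; move: ne0; rewrite (edge_q _ eB qe) eqxx.
  - by case: (opp d _ erefl (flip_cell f)) => //; rewrite qd !inE eqxx orbT.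
  - by case: (opp d' _ erefl (flip_cell' f)) => //; rewrite qd' !inE eqxx orbT.
(* In the triangle on [p], [q], [q'] the edge [q q'] is dual to a ray, so the other two are merged
   as soon as one is in the core. A class contains all three of [e0], [e1], [e2] or none. *)
have step q' : q != q' -> e0 != [set p; q']%SET -> [set p; q; q']%SET \in D ->
    ([set p; q']%SET \in val S) = (e0 \in val S).
  move=> qq' ne TD; apply/idP/idP => eS; apply: (class_closed (valP S) (eS)).
    have ne' : [set p; q']%SET != e0 by rewrite eq_sym.
    have tri' e : e \in core D -> e \subset [set p; q; q']%SET ->
        e = [set p; q']%SET \/ e = e0.
      by move=> eC eT; case: (tri q' qq' e eC eT); [right | left].
    by case: (core_pair TD (SC _ eS) (subp q') (sub0 q') ne' tri').
  by case: (core_pair TD (SC _ eS) (sub0 q') (subp q') ne (tri q' qq')).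
have e1S := step q1 qq1 e01 T1D; have e2S := step q2 qq2 e02 T2D.
have [e0S|e0S] := boolP (e0 \in val S); last first.
  rewrite big1 // => e eS; apply: weight0 => //.
  - by apply: contraNneq e0S => <-.
  - by apply: contraNneq e0S => eE; rewrite -e1S -/e1 -eE.
  - by apply: contraNneq e0S => eE; rewrite -e2S -/e2 -eE.
rewrite e0S in e1S e2S.
have w1 q' : q != q' -> [set p; q; q']%SET \in D -> [set p; q']%SET \in val S ->
    edge_weight R D [set p; q']%SET q = 1.
  move=> qq' TD eS; have [a [b [d [d' [n [f ->]]]]]] := edge_weightP unimodD cD (CB _ (SC _ eS)).
  have : q \notin [set a; b]%SET.
    by rewrite -(flip_edge f) !inE (negbTE qp) (negbTE qq').
  rewrite !inE negb_or /flip_weight => /andP[/negbTE qa /negbTE qb].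
  rewrite qa qb !mulr0 !subr0; have [_ _ /negbTE dd'] := flip_neq' f.
  have : q \in [set p; q; q']%SET by rewrite !inE eqxx orbT.
  case: (flip_only f TD (subp q')) => ->; rewrite !inE qa qb /= => /eqP->.
    by rewrite eqxx dd' addr0.
  by rewrite eqxx eq_sym dd' add0r.
(* As the opposite vertices of [e0] add up to [2 q], the integer [n] of the flip is 0 or 2 according
   to whether [q] is its first or second end; the weight is -2 either way. *)
have w0 : edge_weight R D e0 q = - 2.
  have [a [b [d [d' [n [f ->]]]]]] := edge_weightP unimodD cD (CB _ (SC _ e0S)).
  have opp q' : [set p; q; q']%SET \in D -> q' \notin e0 -> q' = d \/ q' = d'.
    move=> TD; rewrite (flip_edge f) !inE negb_or => /andP[/negbTE qa /negbTE qb].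
    have : q' \in [set p; q; q']%SET by rewrite !inE eqxx orbT.
    by case: (flip_only f TD (sub0 q')) => ->; rewrite !inE qa qb /= => /eqP; [left | right].
  have dE : px d + px d' = 2 * px q /\ py d + py d' = 2 * py q.
    rewrite -hx -hy.
    have /(opp _ T1D) h1 : q1 \notin e0 by rewrite !inE negb_or !(eq_sym q1) pq1 qq1.
    have /(opp _ T2D) h2 : q2 \notin e0 by rewrite !inE negb_or !(eq_sym q2) pq2 qq2.
    case: h1 h2 q12 => -> [] ->; rewrite ?eqxx // => _.
    by rewrite (addrC (px d')) (addrC (py d')).
  have zero (m : int) : m * (px p - px q) = 0 -> m * (py p - py q) = 0 -> m = 0.
    move=> /eqP; rewrite mulf_eq0 => /orP[/eqP //|/eqP h1] /eqP.
    rewrite mulf_eq0 => /orP[/eqP //|/eqP h2]; case/eqP: qp; apply: pxy_inj.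
      by apply/esym/eqP; rewrite -subr_eq0 h1.
    by apply/esym/eqP; rewrite -subr_eq0 h2.
  have [/negbTE ad' /negbTE bd' _] := flip_neq' f; have [/negbTE ab /negbTE ad /negbTE bd] := flip_neq f.
  case: dE => hdx hdy; move: (flip_x f) (flip_y f); rewrite hdx hdy => fx fy.
  have : p \in [set a; b]%SET by rewrite -(flip_edge f) !inE eqxx.
  have : q \in [set a; b]%SET by rewrite -(flip_edge f) !inE eqxx orbT.
  rewrite !inE => /orP[]/eqP qE /orP[]/eqP pE; try by rewrite qE pE eqxx in qp.
    have n0 : n = 0 by apply: zero; rewrite pE qE; move: fx fy; rewrite qE; clear; lia.
    by rewrite /flip_weight n0 qE eqxx ad ad' mul0r subr0 subr0 mulr1 addr0 sub0r.
  have n2 : 2 - n = 0 by apply: zero; rewrite pE qE; move: fx fy; rewrite qE; clear; lia.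
  have -> : n = 2 by apply/eqP; rewrite eq_sym -subr_eq0 n2.
  by rewrite /flip_weight qE eqxx bd bd' eq_sym ab subrr mul0r mulr1 addr0 subr0 sub0r.
rewrite (bigD1 e0) //= (bigD1 e1) /=; last by rewrite e1S eq_sym.
rewrite (bigD1 e2) /=; last by rewrite e2S (eq_sym e2 e0) e02 eq_sym.
rewrite w0 (w1 q1) // (w1 q2) // big1 ?addr0; first by ring.
by move=> e /andP[/andP[/andP[eS n0] n1] n2]; exact: weight0.
Qed.

End Irrelevant.

(** * Triangles with an edge in the bottom row *)

Lemma finite_min (R : realType) (T : finType) (P : pred T) (f : T -> R) x0 :
  P x0 -> exists2 x, P x & forall y, P y -> f x <= f y.
Proof.
by move=> Px0; case: (arg_minP f Px0) => x Px h; exists x.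
Qed.

Section Row.
Variables (R : realType) (A : {fset 'cV[int]_2}) (D : {set {set A}}).
Hypothesis unimodD : forall T, T \in D -> unimodular_triangle T.
Variable c : A -> R.
Hypothesis cD : induces c D.
Variables m00 m01 m10 m11 : int.
Hypothesis detM : m00 * m11 - m01 * m10 = 1 \/ m00 * m11 - m01 * m10 = -1.
Implicit Types (a b d p q s : A) (T : {set A}) (v w : 'cV[R]_2).

(** Coordinates after a unimodular change of basis. The matrix remains a parameter so that negating
    its second row turns the top row of the polygon into the bottom row. *)
Definition cx a := m00 * px a + m01 * py a.
Definition cy a := m10 * px a + m11 * py a.

Lemma px_cxy a : px a = (m00 * m11 - m01 * m10) * (m11 * cx a - m01 * cy a).
Proof. by apply: sign_solve detM _; rewrite /cx /cy; ring. Qed.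

Lemma py_cxy a : py a = (m00 * m11 - m01 * m10) * (m00 * cy a - m10 * cx a).
Proof. by apply: sign_solve detM _; rewrite /cx /cy; ring. Qed.

Lemma cxy_inj a b : cx a = cx b -> cy a = cy b -> a = b.
Proof. by move=> hx hy; apply: pxy_inj; rewrite ?px_cxy ?py_cxy hx hy. Qed.

Definition car a b d : int :=
  (cx b - cx a) * (cy d - cy a) - (cx d - cx a) * (cy b - cy a).

Lemma carE a b d : car a b d = (m00 * m11 - m01 * m10) * ar a b d.
Proof. by rewrite /car /ar /cx /cy; ring. Qed.

Lemma cell_car T a b d : T \in D -> a \in T -> b \in T -> d \in T ->
  [/\ a != b, a != d & b != d] -> car a b d = 1 \/ car a b d = -1.
Proof.
move=> TD aT bT dT n; rewrite carE; move: (cell_area unimodD TD aT bT dT n).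
by case: detM => -> [] ->; [left|right|right|left].
Qed.

Lemma exchange_c v w q s p q' (k1 k2 k3 k4 : int) :
  [/\ 0 <= k1, 0 <= k2, 0 <= k3 & 0 <= k4] ->
  [/\ k1 + k2 = k3 + k4,
      k1 * cx q + k2 * cx s = k3 * cx p + k4 * cx q' &
      k1 * cy q + k2 * cy s = k3 * cy p + k4 * cy q'] ->
  q \in argmin c v -> s \in argmin c v ->
  p \in argmin c w -> q' \in argmin c w ->
  (0 < k3 -> p \in argmin c v) /\ (0 < k4 -> q' \in argmin c v).
Proof.
move=> k0 [hk hx hy]; apply: exchange k0 _; split=> //.
  rewrite !px_cxy; set e := _ - _ * _.
  transitivity (e * (m11 * (k1 * cx q + k2 * cx s) - m01 * (k1 * cy q + k2 * cy s))); first by ring.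
  by rewrite hx hy; ring.
rewrite !py_cxy; set e := _ - _ * _.
transitivity (e * (m00 * (k1 * cy q + k2 * cy s) - m10 * (k1 * cx q + k2 * cx s))); first by ring.
by rewrite hx hy; ring.
Qed.

Definition cvalue_vec (xi eta : R) : 'cV[R]_2 :=
  \col_i (if i == 0 then xi * m00%:~R + eta * m10%:~R
          else xi * m01%:~R + eta * m11%:~R).

Lemma cvalueE xi eta a : value c (cvalue_vec xi eta) a =
  c a + (xi * (cx a)%:~R + eta * (cy a)%:~R).
Proof. by rewrite /value !mxE /= /cx /cy !intrD !intrM; ring. Qed.

Variable y0 : int.
Hypothesis y0_le : forall a, y0 <= cy a.

Definition apex q p := exists q', [/\ cx q' = cx q + 1, cy q' = y0 &
  [set q; q'; p]%SET \in D].

(** The lower hull of the bottom row has a segment [a b] covering the unit segment [q q']. Tilting a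
    plane about the lifted segment until it meets a first point [s] above the row produces a cell,
    and unimodularity forces [a = q], [b = q']. *)
Lemma apex_exists q q' s0 : cy q = y0 -> cy q' = y0 -> cx q' = cx q + 1 ->
  y0 < cy s0 -> exists p, apex q p.
Proof.
move=> qy q'y qq' s0y.
pose L := [pred a | (cy a == y0) && (cx a <= cx q)].
pose B := [pred b | (cy b == y0) && (cx q' <= cx b)].
pose slope a b := (c b - c a) / (cx b - cx a)%:~R.
have LB a b : L a -> B b -> 0 < (cx b - cx a)%:~R :> R.
  by move=> /andP[_ al] /andP[_ bl]; rewrite ltr0z; clear -al bl qq'; lia.
have Lq : L q by rewrite /= qy eqxx lexx.
have Bq' : B q' by rewrite /= q'y eqxx lexx.
(* A max-min of slopes: for each left point [a] the right point of least slope, then the [a] for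
   which this slope is greatest. *)
have /boolp.choice[f fP] : forall a, exists e, B e /\ forall b, B b -> slope a e <= slope a b.
  by move=> a; have [b Bb h] := finite_min (slope a) Bq'; exists b.
have [a La amax] := finite_min (fun a => - slope a (f a)) Lq.
set b := f a; have [Bb bmin] := fP a; rewrite -/b in Bb bmin.
set t := slope a b; have tE : c b = c a + t * (cx b - cx a)%:~R.
  by rewrite /t /slope divfK ?gt_eqF ?LB //; ring.
(* The max-min choice makes the line through [a] and [b] a supporting line of the whole row. *)
have line d : cy d = y0 -> c a + t * (cx d - cx a)%:~R <= c d.
  move=> dy; have [dl|dl] := lerP (cx d) (cx q).
    have Ld : L d by rewrite /= dy eqxx.
    have [Be emin] := fP d; set e := f d in Be emin.
    have h1 : slope d e <= t by rewrite -lerN2; exact: amax.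
    have h2 : t <= slope a e by exact: bmin.
    move: h1 h2; rewrite /slope ler_pdivrMr ?LB // ler_pdivlMr ?LB // !intrB; lra.
  have Bd : B d by rewrite /= dy eqxx /=; clear -dl qq'; lia.
  have := bmin _ Bd; rewrite -/t /slope ler_pdivlMr ?LB //; lra.
pose S := [pred s | y0 < cy s].
(* The slope of the plane through the supporting line and the lifted point [s]; the least one
   belongs to the first point met. *)
pose g s := (c s - t * (cx s)%:~R - (c a - t * (cx a)%:~R)) / (cy s - y0)%:~R.
have [s Ss smin] := @finite_min _ _ S g s0 s0y.
have Spos d : S d -> 0 < (cy d - y0)%:~R :> R by rewrite /= ltr0z subr_gt0.
have aE : cy a = y0 by case/andP: La => /eqP.
have bE : cy b = y0 by case/andP: Bb => /eqP.
set v := cvalue_vec (- t) (- g s).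
have va d : c a - t * (cx a)%:~R - g s * y0%:~R <= value c v d.
  rewrite cvalueE; have [dy|dy] := lerP (cy d) y0.
    have {}dy : cy d = y0 by apply/le_anti; rewrite dy y0_le.
    by rewrite dy; move: (line d dy); rewrite intrB; lra.
  have := smin d dy; rewrite {2}/g ler_pdivlMr ?Spos //; rewrite !intrB; lra.
have vaE : value c v a = c a - t * (cx a)%:~R - g s * y0%:~R.
  by rewrite cvalueE aE; ring.
have vbE : value c v b = c a - t * (cx a)%:~R - g s * y0%:~R.
  by rewrite cvalueE bE tE intrB; ring.
have vsE : value c v s = c a - t * (cx a)%:~R - g s * y0%:~R.
  rewrite cvalueE; have : g s * (cy s - y0)%:~R = c s - t * (cx s)%:~R - (c a - t * (cx a)%:~R).
    by rewrite /g divfK // gt_eqF ?Spos.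
  by rewrite !intrB; lra.
have av : a \in argmin c v by apply/argminP => d; rewrite vaE.
have bv : b \in argmin c v by apply/argminP => d; rewrite vbE.
have sv : s \in argmin c v by apply/argminP => d; rewrite vsE.
have ab_gt : 0 < cx b - cx a by have := LB a b La Bb; rewrite ltr0z.
have sy_gt : 0 < cy s - y0 by rewrite subr_gt0.
have abs : car a b s = (cx b - cx a) * (cy s - y0).
  by rewrite /car aE bE subrr mulr0 subr0.
have vD : argmin c v \in D.
  apply: (argmin_cell cD av bv sv); apply/eqP => h.
  by have := mulr_gt0 ab_gt sy_gt; rewrite -abs carE h mulr0.
have nab : a != b by apply: contraTneq ab_gt => ->; rewrite subrr.
have nas : a != s by apply: contraTneq sy_gt => <-; rewrite aE subrr.
have nbs : b != s by apply: contraTneq sy_gt => <-; rewrite bE subrr.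
(* The area is base times height, both positive integers, and equals 1. *)
have ab1 : cx b - cx a = 1.
  have := cell_car vD av bv sv (And3 nab nas nbs); rewrite abs.
  by move: ab_gt sy_gt; clear; nia.
have [aq bq] : a = q /\ b = q'.
  case/andP: La => _ La; case/andP: Bb => _ Bb.
  split; apply: cxy_inj; rewrite ?aE ?bE //; move: La Bb ab1 qq'; clear; lia.
exists s, q'; split=> //.
by rewrite -bq -aq -(cell_eq unimodD vD av bv sv (And3 nab nas nbs)).
Qed.


Lemma apex_cell q p : cy q = y0 -> apex q p -> exists q', [/\ cx q' = cx q + 1,
  cy q' = y0, [set q; q'; p]%SET \in D, cy p = y0 + 1 &
  [/\ q != q', q != p & q' != p]].
Proof.
move=> qy [q' [hx hy TD]]; exists q'.
have qq' : q != q' by apply/eqP => E; move: hx; rewrite -E; clear; lia.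
have [qp q'p] : q != p /\ q' != p.
  move: (cell_card unimodD TD); rewrite finset.setUC cardsU1 cards2 qq' !inE.
  by rewrite !(eq_sym p); case: (q == p); case: (q' == p).
split=> //; have := cell_car TD _ _ _ (And3 qq' qp q'p).
rewrite !inE !eqxx !orbT => /(_ isT isT isT); rewrite /car hx hy qy subrr mulr0 subr0.
by rewrite [cx q + 1]addrC addrK mul1r; have := y0_le p; clear; lia.
Qed.

(** Otherwise the segments [q1 p1] and [q2' p2] are the diagonals of a trapezoid. They cross in the
    ratio of the parallel sides, which supplies the weights of the exchange, and [p2] would be a
    vertex of the first triangle. *)
Lemma apex_mono q1 q2 p1 p2 : cy q1 = y0 -> cy q2 = y0 -> apex q1 p1 ->
  apex q2 p2 -> cx q1 <= cx q2 -> cx p1 <= cx p2.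
Proof.
move=> q1y q2y /(apex_cell q1y)[q1' [x1 y1 T1 p1y [n1 n1' n1'']]].
move=> /(apex_cell q2y)[q2' [x2 y2 T2 p2y [n2 n2' n2'']]] q12.
rewrite leNgt; apply/negP => lt.
have [v vT] := cell_argmin cD T1; have [w wT] := cell_argmin cD T2.
have p2T : p2 \in argmin c v.
  apply: (proj1 (@exchange_c v w p1 q1 p2 q2' (cx q2' - cx q1) (cx p1 - cx p2) (cx q2' - cx q1) (cx p1 - cx p2) _ _ _ _ _ _) _).
  - split; move: lt q12 x2; clear; lia.
  - rewrite p1y p2y q1y y2; split; [by []| |by []].
    by clear; lia.
  - by rewrite vT !inE eqxx !orbT.
  - by rewrite vT !inE eqxx.
  - by rewrite wT !inE eqxx !orbT.
  - by rewrite wT !inE eqxx !orbT.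
  - by rewrite subr_gt0 x2; move: q12; clear; lia.
move: p2T; rewrite vT !inE -orbA => /or3P[]/eqP E.
- by move: p2y; rewrite E q1y; clear; lia.
- by move: p2y; rewrite E y1; clear; lia.
- by rewrite E ltxx in lt.
Qed.

Lemma apex_uniq q p1 p2 : cy q = y0 -> apex q p1 -> apex q p2 -> p1 = p2.
Proof.
move=> qy a1 a2; apply: cxy_inj.
  by apply: le_anti; rewrite (apex_mono qy qy a1 a2) // (apex_mono qy qy a2 a1).
have [_ [_ _ _ -> _]] := apex_cell qy a1.
by have [_ [_ _ _ -> _]] := apex_cell qy a2.
Qed.

(* Horizontal position of [s] relative to the line [q p], when [p] lies one row
   above [q]. *)
Definition side q p s : int := cx s - cx q - (cy s - cy q) * (cx p - cx q).

Lemma side_exchange k q q' p s T : k = 1 \/ k = -1 -> cy q = y0 -> cy q' = y0 ->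
  cy p = y0 + 1 -> cx q' = cx q + k -> [set q; q'; p]%SET \in D -> T \in D ->
  q \in T -> s \in T -> y0 < cy s -> 0 <= k * side q p s ->
  p \in T /\ (0 < k * side q p s -> q' \in T).
Proof.
move=> k1 qy q'y py qq' T1 TD qT sT sy sd.
have [v vT] := cell_argmin cD TD; have [w wT] := cell_argmin cD T1.
have kk : k * k = 1 by case: k1 => ->.
have [h1 h2] : (0 < cy s - y0 -> p \in argmin c v) /\ (0 < k * side q p s -> q' \in argmin c v).
  apply: (@exchange_c v w q s p q' (cy s - y0 + k * side q p s - 1) 1).
  - by split=> //; move: sy sd; clear; lia.
  - split; first by ring.
    + rewrite qq' (mulrDr (k * side q p s)) [_ * k]mulrAC kk mul1r /side qy.
      by ring.
    + by rewrite qy py q'y; ring.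
  - by rewrite vT.
  - by rewrite vT.
  - by rewrite wT !inE eqxx !orbT.
  - by rewrite wT !inE eqxx !orbT.
by rewrite -vT; split=> //; apply: h1; rewrite subr_gt0.
Qed.

Lemma cell_above q T : T \in D -> q \in T -> exists2 s, s \in T & y0 < cy s.
Proof.
move=> TD qT; apply: contrapT => no.
have row s : s \in T -> cy s = y0.
  move=> sT; apply/le_anti; rewrite y0_le andbT leNgt; apply/negP => h.
  by apply: no; exists s.
have [a [b [d [TE]]]] := unimodD TD; rewrite area2_ar => h.
have [aT bT dT] : [/\ a \in T, b \in T & d \in T] by rewrite TE !inE !eqxx !orbT.
have := carE a b d; rewrite /car (row a aT) (row b bT) (row d dT) !subrr !mulr0.
by move: h; clear -detM; case: detM => ->; lia.
Qed.

(* [k = 1] (resp. [-1]): [p] is the apex over the edge from [q] to its right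
   (resp. left) neighbour [q'], and no vertex of [T] lies on the other side of
   the line [q p]. *)
Lemma cell_side k q q' p T : k = 1 \/ k = -1 -> cy q = y0 -> cy q' = y0 ->
  cy p = y0 + 1 -> cx q' = cx q + k -> q != p -> q' != p -> q != q' ->
  [set q; q'; p]%SET \in D -> T \in D -> q \in T -> p \in T ->
  (forall s, s \in T -> 0 <= k * side q p s) -> T = [set q; q'; p]%SET.
Proof.
move=> k1 qy q'y py qq' qp q'p nqq' T1 TD qT pT sd.
have [r [rT [_ qr pr] TE]] := cell_third unimodD TD qT pT qp.
have := cell_car TD qT pT rT (And3 qp qr pr).
have -> : car q p r = - side q p r by rewrite /car /side qy py; ring.
have := sd r rT => s0 s1.
have ks : k * side q p r = 1.
  by move: s0 s1; clear -k1; case: k1 => ->; lia.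
have q'T : q' \in T.
  have [ry|ry] := lerP (cy r) y0; last first.
    by apply: (proj2 (side_exchange k1 qy q'y py qq' T1 TD qT rT ry s0)); rewrite ks.
  have {}ry : cy r = y0 by apply/le_anti; rewrite ry y0_le.
  suff -> : q' = r by [].
  apply: cxy_inj; last by rewrite q'y ry.
  rewrite qq'; move: ks; rewrite /side ry qy subrr mul0r subr0; clear -k1.
  by case: k1 => ->; lia.
by apply: (cell_eq unimodD TD qT q'T pT); split.
Qed.

Lemma side_self q p : side q p q = 0.
Proof. by rewrite /side !subrr mul0r subr0. Qed.

Lemma side_apex q p : cy q = y0 -> cy p = y0 + 1 -> side q p p = 0.
Proof. by move=> qy py; rewrite /side qy py; ring. Qed.

(** The two triangles on [p] fill the half-plane above the row near [q]. Hence every cell at [q]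
    contains [p], and its third vertex decides which of the two it is; [fan_column] applies. *)
Lemma fan_apex q q1 p : cy q = y0 -> cy q1 = y0 -> cx q = cx q1 + 1 ->
  apex q1 p -> apex q p -> column R D q = 0.
Proof.
move=> qy q1y q1q /(apex_cell q1y)[q0 [x0 yq0 T1 yp [n1 n2 n3]]].
have q0E : q0 = q by apply: cxy_inj; rewrite ?x0 ?q1q ?yq0.
rewrite {q0 x0 yq0}q0E in T1 n1 n3 *.
move=> /(apex_cell qy)[q2 [x2 q2y T2 _ [m1 m2 m3]]].
have n12 : q1 != q2 by apply/eqP => E; move: q1q x2; rewrite E; clear; lia.
have swap a b d : [set a; b; d]%SET = [set d; b; a]%SET.
  by apply/setP => x; rewrite !inE; case: (x == a); case: (x == b); case: (x == d).
have rot a b d : [set a; b; d]%SET = [set d; a; b]%SET.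
  by apply/setP => x; rewrite !inE; case: (x == a); case: (x == b); case: (x == d).
have tw a b d : [set a; b; d]%SET = [set b; a; d]%SET.
  by apply/setP => x; rewrite !inE; case: (x == a); case: (x == b); case: (x == d).
have T1' : [set q; q1; p]%SET \in D by rewrite tw.
have pin T : T \in D -> q \in T -> p \in T.
  move=> TD qT; have [s sT sy] := cell_above TD qT.
  have [sd|sd] := lerP 0 (side q p s).
    apply: (proj1 (@side_exchange 1 q q2 p s T _ qy q2y yp x2 T2 TD qT sT sy _)); first by left.
    by rewrite mul1r.
  apply: (proj1 (@side_exchange (-1) q q1 p s T _ qy q1y yp _ T1' TD qT sT sy _)); first by right.
    by rewrite q1q; clear; lia.
  by rewrite mulN1r oppr_ge0 ltW.
have px_lin : px q1 + px q2 = 2 * px q /\ py q1 + py q2 = 2 * py q.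
  have hx : cx q1 + cx q2 = 2 * cx q by rewrite x2 q1q; clear; lia.
  have hy : cy q1 + cy q2 = 2 * cy q by rewrite q1y q2y qy; clear; lia.
  rewrite !px_cxy !py_cxy; set k := _ - _ * _; split.
    transitivity (k * (m11 * (cx q1 + cx q2) - m01 * (cy q1 + cy q2))); first by ring.
    by rewrite hx hy; ring.
  transitivity (k * (m00 * (cy q1 + cy q2) - m10 * (cx q1 + cx q2))); first by ring.
  by rewrite hx hy; ring.
case: px_lin => hpx hpy.
have neqs : [/\ q != p, q != q1, q != q2 & [/\ p != q1, p != q2 & q1 != q2]].
  split; [exact: m2 | by rewrite eq_sym | exact: m1 | split].
  - by rewrite eq_sym.
  - by rewrite eq_sym.
  - exact: n12.
have T1p : [set p; q; q1]%SET \in D by rewrite swap.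
have T2p : [set p; q; q2]%SET \in D by rewrite -rot.
apply: (fan_column unimodD cD neqs hpx hpy T1p T2p) => T TD qT.
 have pT := pin T TD qT.
have [r [rT [_ qr pr] TE]] := cell_third unimodD TD qT pT m2.
have := cell_car TD qT pT rT (And3 m2 qr pr).
have -> : car q p r = - side q p r by rewrite /car /side qy yp; ring.
have all_ge k : 0 <= k * side q p r -> forall s, s \in T -> 0 <= k * side q p s.
  move=> kr s; rewrite TE !inE => /orP[/orP[]|] /eqP -> //.
    by rewrite side_self mulr0.
  by rewrite side_apex // mulr0.
case=> sr; have {}sr := canRL opprK sr; [left|right].
  rewrite -rot; apply: (@cell_side (-1) q q1 p T _ qy q1y yp) => //; first by right.
  - by rewrite q1q; clear; lia.
  - by rewrite eq_sym.
  - by apply: all_ge; rewrite sr.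
rewrite -rot; apply: (@cell_side 1 q q2 p T _ qy q2y yp) => //; first by left.
by apply: all_ge; rewrite sr.
Qed.

(** The situation at an end of the row: with nothing beyond the line [q p], only one cell contains
    [q]. *)
Lemma lone_apex k q q' p : k = 1 \/ k = -1 -> cy q = y0 -> cy q' = y0 ->
  cy p = y0 + 1 -> cx q' = cx q + k -> q != p -> q' != p -> q != q' ->
  [set q; q'; p]%SET \in D -> (forall s, 0 <= k * side q p s) ->
  column R D q = 0.
Proof.
move=> k1 qy q'y py qq' qp q'p nqq' T1 sd.
apply: (lone_column unimodD cD (T0 := [set q; q'; p]%SET)) => T TD qT.
apply: (cell_side k1 qy q'y py) => //.
have [s sT sy] := cell_above TD qT.
exact: (proj1 (side_exchange k1 qy q'y py qq' T1 TD qT sT sy (sd s))).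
Qed.

Variable I : {set A}.
Hypothesis row_contiguous : forall q1 q2 (x : int), cy q1 = y0 -> cy q2 = y0 ->
  cx q1 <= x <= cx q2 -> exists2 a, cy a = y0 & cx a = x.
Hypothesis side_interior : forall q s p p', cy q = y0 -> y0 < cy s ->
  cy p = y0 + 1 -> cy p' = y0 + 1 -> p' \in I ->
  (side q p s < 0 /\ cx p < cx p') \/ (0 < side q p s /\ cx p' < cx p) ->
  p \in I.
Variable p0 : A.
Hypotheses (p0I : p0 \in I) (p0y : cy p0 = y0 + 1).

(** Injectivity of the apex map [f] on the points with nonzero column. The summand 1 is the value
    [None], shared by the points with a non-interior apex and by the right end, which has no apex;
    only one surviving point can take it. *)
Lemma row_columns : exists2 N : {set A},
  (forall q, q \in N -> cy q = y0 /\ column R D q = 0) &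
  (#|[set q | cy q == y0]%SET| <=
   #|N| + #|[set p in I | cy p == (y0 + 1)%R]%SET| + 1)%N.
Proof.
pose N := [set q | (cy q == y0) && (column R D q == 0)]%SET.
exists N; first by move=> q; rewrite inE => /andP[/eqP -> /eqP ->].
pose rel := [set q | (cy q == y0) && (column R D q != 0)]%SET.
have -> : [set q | cy q == y0]%SET = (N :|: rel)%SET.
  by apply/setP => q; rewrite !inE -andb_orr orbN andbT.
apply: leq_trans (leq_card_setU _ _) _; rewrite -addnA leq_add2l.
pose f q := [pick p | (p \in I) && `[< apex q p >]].
have f_apex q p : cy q = y0 -> apex q p -> f q = if p \in I then Some p else None.
  move=> qy qp; rewrite /f; case: pickP => [p' /andP[p'I /asboolP qp']|no].
    by rewrite (apex_uniq qy qp qp') p'I.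
  by have := no p; rewrite (asboolT qp) andbT => ->.
have f_none q : (forall p, ~ apex q p) -> f q = None.
  by move=> no; rewrite /f; case: pickP => // p /andP[_ /asboolP /no].
have relP q : q \in rel -> cy q = y0 /\ column R D q <> 0.
  by rewrite inE => /andP[/eqP -> /eqP].
have apexR q q' : cy q = y0 -> cy q' = y0 -> cx q < cx q' -> exists p, apex q p.
  move=> qy q'y lt; have [a ay ax] : exists2 a, cy a = y0 & cx a = cx q + 1.
    by apply: (row_contiguous qy q'y); move: lt; clear; lia.
  by apply: (apex_exists qy ay ax (s0 := p0)); rewrite p0y; clear; lia.
(* Equal apexes on both sides of [q] would be a fan, and the column of [q] would vanish. *)
have strict q1 q p1 p : cy q1 = y0 -> q \in rel -> cx q = cx q1 + 1 ->
    apex q1 p1 -> apex q p -> cx p1 < cx p.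
  move=> q1y /relP[qy qc] q1q a1 a; rewrite lt_neqAle (apex_mono q1y qy a1 a) ?andbT; last by rewrite q1q; clear; lia.
  apply/eqP => E; apply: qc; apply: (fan_apex qy q1y q1q a1).
  suff -> : p1 = p by [].
  apply: cxy_inj => //; have [_ [_ _ _ -> _]] := apex_cell q1y a1.
  by have [_ [_ _ _ -> _]] := apex_cell qy a.
have between p1 p2 p q : cy q = y0 -> cy p1 = y0 + 1 -> cy p2 = y0 + 1 -> cy p = y0 + 1 ->
    p2 \in I -> (cx p1 < cx p /\ cx p < cx p2) \/ (cx p2 < cx p /\ cx p < cx p1) -> p \in I.
  move=> qy p1y p2y py p2I h; apply: (@side_interior q p1 p p2) => //.
    by rewrite p1y; clear; lia.
  by rewrite /side p1y qy; move: h; clear; lia.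
have step q1 q2 : q1 \in rel -> q2 \in rel -> cx q1 < cx q2 -> f q1 = f q2 -> False.
  move=> r1 r2 lt; have [q1y c1] := relP _ r1; have [q2y c2] := relP _ r2.
  have [p1 a1] := apexR q1 q2 q1y q2y lt.
  have [q3 q3y q3x] : exists2 a, cy a = y0 & cx a = cx q2 - 1.
    by apply: (row_contiguous q1y q2y); move: lt; clear; lia.
  have q23 : cx q2 = cx q3 + 1 by rewrite q3x; clear; lia.
  have [r a3] : exists r, apex q3 r by apply: (apexR q3 q2) => //; rewrite q23; clear; lia.
  have p1r : cx p1 <= cx r.
    by apply: (apex_mono q1y q3y a1 a3); move: lt q23; clear; lia.
  have [q1' [x1 y1 T1 p1y [n1 n2 n3]]] := apex_cell q1y a1.
  have [q2' [x2 y2 T3 ry [m1 m2 m3]]] := apex_cell q3y a3.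
  have q2'E : q2' = q2 by apply: cxy_inj; rewrite ?x2 ?q23 ?y2.
  rewrite {}q2'E in T3 m1 m3 x2 y2.
  rewrite (f_apex q1 p1) //; have [p1I|p1I] := boolP (p1 \in I).
    have [ex2|no2] := pselect (exists p, apex q2 p); last first.
      by rewrite f_none // => p a2; apply: no2; exists p.
    case: ex2 => p2 a2; rewrite (f_apex q2 p2) //; case: (p2 \in I) => // -[E].
    have := strict _ _ _ _ q3y r2 q23 a3 a2; rewrite -E => h.
    by move: h p1r; clear; lia.
  have np10 : cx p1 != cx p0.
    by apply: contraNneq p1I => E; rewrite (_ : p1 = p0) //; apply: cxy_inj; rewrite ?p1y.
  (* Here [p1] is not interior. If it is to the left of [p0], a left neighbour of [q1] would have an
     apex still further left and make [p1] interior. So [q1] is the left end, no point lies beyond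
     the line [q1 p1], and the column of [q1] vanishes. *)
  have [lt0|ge0] := ltrP (cx p1) (cx p0).
    move=> _; have [ex0|no0] := pselect (exists2 a, cy a = y0 & cx a = cx q1 - 1).
      case: ex0 => q0 q0y q0x; have q01 : cx q1 = cx q0 + 1 by rewrite q0x; clear; lia.
      have [r0 a0] : exists r, apex q0 r by apply: (apexR q0 q1) => //; rewrite q01; clear; lia.
      have [_ [_ _ _ r0y _]] := apex_cell q0y a0.
      have := strict _ _ _ _ q0y r1 q01 a0 a1 => h.
      by case/negP: p1I; apply: (between r0 p0 p1 q1) => //; left.
    apply: c1; apply: (@lone_apex 1 q1 q1' p1) => //; first by left.
    move=> s; rewrite mul1r leNgt; apply/negP => sneg.
    have [sy|sy] := lerP (cy s) y0; last first.
      by case/negP: p1I; apply: (@side_interior q1 s p1 p0) => //; left.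
    have {}sy : cy s = y0 by apply/le_anti; rewrite sy y0_le.
    apply: no0; apply: (row_contiguous sy q1y).
    by move: sneg; rewrite /side sy q1y subrr mul0r; clear; lia.
  (* The mirror image at [q2]: it must be the right end, and the apex [r] of the segment before it
     must be [p1], so the column of [q2] vanishes. *)
  have gt0 : cx p0 < cx p1 by rewrite lt_neqAle ge0 eq_sym np10.
  have [ex2|no2] := pselect (exists p, apex q2 p).
    case: ex2 => p2 a2 _; have := strict _ _ _ _ q3y r2 q23 a3 a2 => h.
    have [_ [_ _ _ p2y _]] := apex_cell q2y a2.
    by case/negP: p1I; apply: (between p2 p0 p1 q1) => //; right; move: h p1r gt0; clear; lia.
  move=> _; have [eqr|ltr] := eqVneq (cx p1) (cx r); last first.
    case/negP: p1I; apply: (between r p0 p1 q1) => //; right; split=> //.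
    by rewrite lt_neqAle ltr.
  have {eqr} eqr : p1 = r by apply: cxy_inj; rewrite ?p1y.
  rewrite -{}eqr {r p1r} in T3 m1 m2 m3 a3 ry *.
  apply: c2; apply: (@lone_apex (-1) q2 q3 p1) => //.
  - by right.
  - by rewrite eq_sym.
  - by rewrite (_ : [set q2; q3; p1]%SET = [set q3; q2; p1]%SET) //; apply/setP => x; rewrite !inE; case: (x == q2); case: (x == q3).
  move=> s; rewrite mulN1r oppr_ge0 leNgt; apply/negP => spos.
  have [sy|sy] := lerP (cy s) y0; last first.
    by case/negP: p1I; apply: (@side_interior q2 s p1 p0) => //; right.
  have {}sy : cy s = y0 by apply/le_anti; rewrite sy y0_le.
  apply: no2; apply: (apexR q2 s) => //.
  by move: spos; rewrite /side sy q2y subrr mul0r; clear; lia.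
have finj : {in rel &, injective f}.
  move=> q1 q2 r1 r2 E; apply: cxy_inj; last by rewrite (proj1 (relP _ r1)) (proj1 (relP _ r2)).
  by case: (ltrgtP (cx q1) (cx q2)) => // lt; exfalso; [apply: (step q1 q2) | apply: (step q2 q1)].
rewrite -(card_in_imset finj).
apply: (@leq_trans #|None |: (Some @: [set p in I | cy p == (y0 + 1)%R])|)%SET.
  apply: subset_leq_card; apply/fintype.subsetP => o /imsetP[q qr ->].
  rewrite !inE /f; case: pickP => // p /andP[pI /asboolP qp]; rewrite imset_f ?orbT //.
  by have [_ [_ _ _ py _]] := apex_cell (proj1 (relP _ qr)) qp; rewrite inE pI py eqxx.
rewrite cardsU1 card_imset; last exact: Some_inj.
by rewrite addnC leq_add2l leq_b1.
Qed.

End Row.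

(** * Counting the points of the rows *)

Lemma card_le_range (T : finType) (f : T -> int) (S : {set T}) (lo hi : int) :
  {in S &, injective f} -> (forall a, a \in S -> lo <= f a <= hi) ->
  lo <= hi + 1 -> #|S|%:Z <= hi - lo + 1.
Proof.
move=> finj frange lohi; pose n := `|(hi - lo + 1)%R|%N.
have nE : n%:Z = hi - lo + 1 by rewrite /n; clear -lohi; lia.
rewrite -nE lez_nat; case: n nE => [|n] nE.
  rewrite leqn0 cards_eq0; apply/eqP/setP => a; rewrite inE; apply/negbTE/negP.
  by move/frange; clear -nE; lia.
pose g a : 'I_n.+1 := inord `|(f a - lo)%R|%N.
rewrite -[n.+1]card_ord -(@card_in_imset _ _ g S); first exact: max_card.
move=> a b aS bS /(congr1 val); rewrite /= !inordK.
- by move=> h; apply: finj => //; move: h (frange a aS) (frange b bS); clear; lia.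
- by move: (frange b bS); clear -nE; lia.
- by move: (frange a aS); clear -nE; lia.
Qed.

Lemma card_ge_range (T : finType) (f : T -> int) (S : {set T}) (lo hi : int) :
  (forall z : int, lo <= z <= hi -> exists2 a, a \in S & f a = z) ->
  hi - lo + 1 <= #|S|%:Z.
Proof.
move=> fsurj; have [lohi|lohi] := lerP lo hi; last by apply: le_trans (_ : 0 <= _) => //; clear -lohi; lia.
pose n := `|(hi - lo + 1)%R|%N.
have nE : n%:Z = hi - lo + 1 by rewrite /n; clear -lohi; lia.
have /boolp.choice[g gP] : forall i : 'I_n, exists a, a \in S /\ f a = lo + i%:Z.
  move=> i; have [|a aS fa] := fsurj (lo + i%:Z); last by exists a.
  by have := ltn_ord i; clear -nE; lia.
have ginj : injective g.
  move=> i j gij; apply: val_inj; have := (gP i).2; rewrite gij (gP j).2 /=.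
  by clear; lia.
rewrite -nE lez_nat -[n]card_ord -(card_imset _ ginj); apply: subset_leq_card.
by apply/fintype.subsetP => a /imsetP[i _ ->]; exact: (gP i).1.
Qed.

Lemma finite_extremes (T : finType) (f : T -> int) (S : {set T}) a0 : a0 \in S ->
  exists a b, [/\ a \in S, b \in S & forall x, x \in S -> f a <= f x <= f b].
Proof.
move=> a0S; case: (arg_minP f a0S) => a aS amin.
case: (arg_maxP f a0S) => b bS bmax.
by exists a, b; split=> // x xS; apply/andP; split; [exact: amin | exact: bmax].
Qed.

Section Planar.
Variables (R : realType) (T : finType) (cx cy : T -> int) (I : {set T}).
Variables (P Q : R -> R -> Prop).
Hypothesis cxy_injective : forall a b, cx a = cx b -> cy a = cy b -> a = b.
Hypothesis P_convex : forall x y x' y' t, 0 <= t <= 1 -> P x y -> P x' y' ->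
  P ((1 - t) * x + t * x') ((1 - t) * y + t * y').
Hypothesis Q_between : forall x y x' y' t, 0 < t <= 1 -> P x y -> Q x' y' ->
  Q ((1 - t) * x + t * x') ((1 - t) * y + t * y').
Hypothesis Q_P : forall x y, Q x y -> P x y.
Hypothesis P_point : forall a, P (cx a)%:~R (cy a)%:~R.
Hypothesis point_P : forall x y : int, P x%:~R y%:~R ->
  exists a, cx a = x /\ cy a = y.
Hypothesis IQ : forall a, a \in I <-> Q (cx a)%:~R (cy a)%:~R.

(** One interior point anywhere on the line suffices: [x] lies between it and one of [x1], [x2], and
    differs from the latter. *)
Lemma Q_segment x1 x2 x0 x y : P x1 y -> P x2 y -> Q x0 y -> x1 < x < x2 -> Q x y.
Proof.
move=> P1 P2 Q0 /andP[x1x xx2].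
have onseg x' : P x' y -> x' != x0 -> 0 < (x - x') / (x0 - x') <= 1 -> Q x y.
  move=> P' n0 ht; have := Q_between ht P' Q0.
  set t := _ / _; rewrite (_ : (1 - t) * x' + t * x0 = x); last first.
    rewrite (_ : _ + _ = x' + t * (x0 - x')); last by ring.
    by rewrite /t divfK ?subr_eq0 1?eq_sym // addrC subrK.
  by rewrite (_ : (1 - t) * y + t * y = y) //; ring.
have [le|lt] := lerP x x0.
  apply: (onseg x1 P1); first by rewrite lt_eqF //; lra.
  have h : 0 < x0 - x1 by lra.
  by apply/andP; split; [apply: divr_gt0; lra | rewrite ler_pdivrMr //; lra].
apply: (onseg x2 P2); first by rewrite gt_eqF //; lra.
have h : x0 - x2 < 0 by lra.
by apply/andP; split; [rewrite ltr_ndivlMr // | rewrite ler_ndivrMr //]; lra.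
Qed.

Definition row (y : int) := [set a | cy a == y]%SET.
Definition irow (y : int) := [set a in I | cy a == y]%SET.

Lemma card_rows (y0 : int) : (forall a, y0 <= cy a <= y0 + 4) ->
  #|T| = (#|row y0| + #|row (y0 + 1)| + #|row (y0 + 2)| + #|row (y0 + 3)|
          + #|row (y0 + 4)|)%N.
Proof.
move=> h; have rowE y : #|row y| = (\sum_a (cy a == y))%N.
  by rewrite -sum1_card big_mkcond; apply: eq_bigr => a _; rewrite inE; case: eqP.
rewrite !rowE -!big_split -sum1_card; apply: eq_bigr => a _ /=.
by have := h a; clear; lia.
Qed.

Lemma row_inj y : {in row y &, injective cx}.
Proof. by move=> a b; rewrite !inE => /eqP ay /eqP b_y h; apply: cxy_injective; rewrite ?ay. Qed.

Lemma irow_inj y : {in irow y &, injective cx}.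
Proof.
move=> a b; rewrite !inE => /andP[_ /eqP ay] /andP[_ /eqP b_y] h.
by apply: cxy_injective; rewrite ?ay.
Qed.

Lemma interior_point (x y : int) : Q x%:~R y%:~R ->
  exists2 a, a \in irow y & cx a = x.
Proof.
move=> h; have [a [ax ay]] := point_P (Q_P h).
by exists a => //; rewrite inE ay eqxx andbT; apply/IQ; rewrite ax ay.
Qed.

(** On a line meeting the interior, only the two extreme points of the row can be non-interior. *)
Lemma row_le_irow (y : int) x0 : Q x0 y%:~R -> (#|row y| <= #|irow y| + 2)%N.
Proof.
move=> Q0; have [->|] := eqVneq (row y) finset.set0; first by rewrite cards0.
case/set0Pn => a0 /(finite_extremes cx)[a [b [ar br ab]]].
have h1 : #|row y|%:Z <= cx b - cx a + 1.
  by apply: (card_le_range (@row_inj y) ab); move: (ab b br); clear; lia.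
have h2 : (cx b - 1) - (cx a + 1) + 1 <= #|irow y|%:Z.
  apply: (@card_ge_range _ cx) => z hz; apply: interior_point.
  move: ar br; rewrite !inE => /eqP ay /eqP b_y.
  have Pa := P_point a; have Pb := P_point b; rewrite ay in Pa; rewrite b_y in Pb.
  by apply: (Q_segment Pa Pb Q0); rewrite !ltr_int; move: hz; clear; lia.
by move: h1 h2; clear; lia.
Qed.

Variables (y0 : int) (p1 p3 : T).
Hypotheses (p1I : p1 \in I) (p3I : p3 \in I).
Hypotheses (p1y : cy p1 = y0 + 1) (p3y : cy p3 = y0 + 3).

Lemma middle_interior : exists x0, Q x0 (y0 + 2)%:~R.
Proof.
have h : 0 < (2^-1 : R) <= 1 by apply/andP; split; lra.
have := Q_between h (P_point p1) (proj1 (IQ p3) p3I).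
set x := (X in Q X _); exists x; move: H; rewrite p1y p3y.
by congr (Q _ _); rewrite !intrD; field.
Qed.

(** The midpoints of the left ends and of the right ends of the two rows lie in [P] at height
    [y0 + 2], and the lattice points strictly between them are interior. An open interval with
    half-integral ends contains at least its length minus 1 of them. *)
Lemma middle_row :
  (#|row (y0 + 1)| + #|row (y0 + 3)| <= 2 * #|irow (y0 + 2)| + 4)%N.
Proof.
have [x0 Q0] := middle_interior.
have p1r : p1 \in row (y0 + 1) by rewrite inE p1y.
have p3r : p3 \in row (y0 + 3) by rewrite inE p3y.
have [a1 [b1 [a1r b1r ab1]]] := finite_extremes cx p1r.
have [a3 [b3 [a3r b3r ab3]]] := finite_extremes cx p3r.
have h1 : #|row (y0 + 1)|%:Z <= cx b1 - cx a1 + 1.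
  by apply: (card_le_range (@row_inj _) ab1); move: (ab1 _ b1r); clear; lia.
have h3 : #|row (y0 + 3)|%:Z <= cx b3 - cx a3 + 1.
  by apply: (card_le_range (@row_inj _) ab3); move: (ab3 _ b3r); clear; lia.
have mid a b : a \in row (y0 + 1) -> b \in row (y0 + 3) ->
    P ((cx a + cx b)%:~R / 2) (y0 + 2)%:~R.
  rewrite !inE => /eqP ay /eqP b_y.
  have h : 0 <= (2^-1 : R) <= 1 by apply/andP; split; lra.
  have := P_convex h (P_point a) (P_point b); rewrite ay b_y.
  by congr (P _ _); rewrite !intrD; field.
have [lo [lo1 lo2]] : exists lo : int, cx a1 + cx a3 < 2 * lo /\ 2 * lo <= cx a1 + cx a3 + 2.
  by exists (divz (cx a1 + cx a3) 2 + 1); clear; lia.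
have [hi [hi1 hi2]] : exists hi : int, 2 * hi < cx b1 + cx b3 /\ cx b1 + cx b3 - 2 <= 2 * hi.
  by exists (divz (cx b1 + cx b3 - 1) 2); clear; lia.
have h2 : hi - lo + 1 <= #|irow (y0 + 2)|%:Z.
  apply: (@card_ge_range _ cx) => z hz; apply: interior_point.
  apply: (Q_segment (mid _ _ a1r a3r) (mid _ _ b1r b3r) Q0).
  rewrite ltr_pdivrMr // ltr_pdivlMr // -[2]/(2%:~R) -!intrM !ltr_int.
  by move: hz lo1 hi1; clear; lia.
by move: h1 h2 h3 lo2 hi2; clear; lia.
Qed.

Hypothesis I_rows : forall a, a \in I -> y0 + 1 <= cy a <= y0 + 3.

Lemma card_irows : #|I| = (#|irow (y0 + 1)| + #|irow (y0 + 2)| + #|irow (y0 + 3)|)%N.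
Proof.
have -> : I = (irow (y0 + 1) :|: irow (y0 + 2) :|: irow (y0 + 3))%SET.
  apply/setP => a; rewrite !inE; apply/idP/idP => [aI|]; last by case/orP=> [/orP[]|] /andP[].
  rewrite aI /=; have := I_rows aI; clear; lia.
rewrite !cardsU (_ : _ :&: irow (y0 + 3) = finset.set0)%SET; last first.
  by apply/setP => a; rewrite !inE; apply/negbTE; clear; lia.
rewrite (_ : irow (y0 + 1) :&: irow (y0 + 2) = finset.set0)%SET; last first.
  by apply/setP => a; rewrite !inE; apply/negbTE; clear; lia.
by rewrite cards0 !subn0.
Qed.

(* A lattice point at height [y0 + 5] or more pulls the interior rows together
   so much that few interior lattice points fit below the (empty) row
   [y0 + 4]. *)
Lemma interior_row_below (v : T) (j : int) : y0 + 5 <= cy v -> 1 <= j <= 3 ->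
  (cy v - y0 - 4) * (#|irow (y0 + j)|%:Z - 1) <= cy v - y0 - j - 2.
Proof.
move=> vy hj; have [->|] := eqVneq (irow (y0 + j)) finset.set0.
  by rewrite cards0; move: vy hj; clear; lia.
case/set0Pn => a0 /(finite_extremes cx)[a [b [ar br ab]]].
have h1 : #|irow (y0 + j)|%:Z <= cx b - cx a + 1.
  by apply: (card_le_range (@irow_inj _) ab); move: (ab _ br); clear; lia.
suff h : (cy v - y0 - 4) * (cx b - cx a) <= cy v - y0 - j - 2.
  apply: le_trans h; apply: ler_wpM2l; first by move: vy; clear; lia.
  by move: h1; clear; lia.
rewrite leNgt; apply/negP => h.
(* The segment from [a] to [v] crosses row [y0 + 4] at [L / (H - j)], and [z] is this number rounded
   up. *)
pose H := cy v - y0; pose L := (H - 4) * cx a + (4 - j) * cx v.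
have [z [z1 z2]] : exists z : int, L <= (H - j) * z /\ (H - j) * z <= L + (H - j - 1).
  have Hj : 0 < H - j by rewrite /H; move: vy hj; clear; lia.
  exists (- divz (- L) (H - j)).
  have e1 := divz_eq (- L) (H - j); have e2 := ltz_pmod (- L) Hj.
  have e3 := modz_ge0 (- L) (lt0r_neq0 Hj).
  by rewrite mulrN mulrC; move: e1 e2 e3; clear; lia.
move: ar br; rewrite !inE => /andP[aI /eqP ay] /andP[bI /eqP b_y].
have H4 : 0 < (H - 4)%:~R :> R by rewrite ltr0z /H; move: vy; clear; lia.
have Hj : 0 < (H - j)%:~R :> R by rewrite ltr0z /H; move: vy hj; clear; lia.
(* The point of row [y0 + j] from which [v] is seen through [z]. If the interior row is too long,
   [x] lies between [a] and [b], so [z] is an interior lattice point in row [y0 + 4], which has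
   none. *)
pose x : R := ((H - j) * z - (4 - j) * cx v)%:~R / (H - 4)%:~R.
have Qa : Q (cx a)%:~R (y0 + j)%:~R by rewrite -ay; apply/IQ.
have Qb : Q (cx b)%:~R (y0 + j)%:~R by rewrite -b_y; apply/IQ.
have Qx : Q x (y0 + j)%:~R.
  have xa : (cx a)%:~R <= x by rewrite /x ler_pdivlMr // -intrM ler_int; move: z1; rewrite /L; clear; lia.
  have xb : x <= (cx b)%:~R.
    rewrite /x ler_pdivrMr // -intrM ler_int; move: z2 h; rewrite /L -/H; clear; lia.
  have [->//|nxa] := eqVneq x (cx a)%:~R; have [->//|nxb] := eqVneq x (cx b)%:~R.
  by apply: Q_segment (Q_P Qa) (Q_P Qb) Qa _; rewrite !lt_neqAle xa xb nxb eq_sym nxa.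
have ht : 0 < ((H - 4)%:~R / (H - j)%:~R : R) <= 1.
  by rewrite divr_gt0 //= ler_pdivrMr // mul1r ler_int; move: hj; clear; lia.
have := Q_between ht (P_point v) Qx.
have -> : (1 - (H - 4)%:~R / (H - j)%:~R) * (cx v)%:~R + (H - 4)%:~R / (H - j)%:~R * x = z%:~R :> R.
  rewrite /x; move: H4 Hj; rewrite !(intrB, intrM) => H4 Hj; field.
  by rewrite !gt_eqF.
have -> : (1 - (H - 4)%:~R / (H - j)%:~R) * (cy v)%:~R + (H - 4)%:~R / (H - j)%:~R * (y0 + j)%:~R = (y0 + 4)%:~R :> R.
  have -> : cy v = H + y0 by rewrite /H subrK.
  move: H4 Hj; rewrite !(intrB, intrD) => H4 Hj; field.
  by rewrite gt_eqF.
case/interior_point => e; rewrite inE => /andP[/I_rows] he /eqP ey _.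
by move: he; rewrite ey; clear; lia.
Qed.

(** With [h = cy v - y0 - 4 >= 1] the bounds read h (n1 - 1) <= h + 1, h (n2 - 1) <= h, h (n3 - 1)
    <= h - 1. They leave at most 3 + 2 + 1 = 6 interior points. *)
Lemma height_le : (7 <= #|I|)%N -> forall v, cy v <= y0 + 4.
Proof.
move=> I7 v; rewrite leNgt; apply/negP => lt.
have vy : y0 + 5 <= cy v by move: lt; clear; lia.
have h1 := @interior_row_below v 1 vy isT; have h2 := @interior_row_below v 2 vy isT.
have h3 := @interior_row_below v 3 vy isT.
move: I7 h1 h2 h3; rewrite card_irows.
move: #|_| #|_| #|_| => n3 n2 n1.
have [h hE] : exists h, cy v = h + y0 + 4 by exists (cy v - y0 - 4); ring.
have h0 : 1 <= h by move: vy; rewrite hE; clear; lia.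
rewrite hE {hE}.
move=> n7 e1 e2 e3; have b3 : n3%:Z <= 1.
  rewrite leNgt; apply/negP => b3; have : h * 1 <= h * (n3%:Z - 1).
    by apply: ler_wpM2l; move: b3 h0; clear; lia.
  by move: e3; clear; lia.
have b2 : n2%:Z <= 2.
  rewrite leNgt; apply/negP => b2; have : h * 2 <= h * (n2%:Z - 1).
    by apply: ler_wpM2l; move: b2 h0; clear; lia.
  by move: e2 h0; clear; lia.
have b1 : n1%:Z <= 3.
  rewrite leNgt; apply/negP => b1; have : h * 3 <= h * (n1%:Z - 1).
    by apply: ler_wpM2l; move: b1 h0; clear; lia.
  by move: e1 h0; clear; lia.
by move: n7 b1 b2 b3; clear; lia.
Qed.

Lemma row_contiguous a b (x : int) : cy a = cy b -> cx a <= x <= cx b ->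
  exists2 e, cy e = cy a & cx e = x.
Proof.
move=> ab /andP[ax xb]; have [E|n] := eqVneq (cx a) (cx b).
  by exists a => //; move: ax xb E; clear; lia.
have [//|e [ex ey]] := @point_P x (cy a); last by exists e.
have lt : 0 < (cx b - cx a)%:~R :> R.
  by rewrite ltr0z; move: ax xb n; clear; lia.
have ht : 0 <= ((x - cx a)%:~R / (cx b - cx a)%:~R : R) <= 1.
  apply/andP; split.
    by apply: divr_ge0; [rewrite ler0z subr_ge0 | exact: ltW].
  by rewrite ler_pdivrMr // mul1r ler_int; move: xb; clear; lia.
have := P_convex ht (P_point a) (P_point b); rewrite -ab.
congr (P _ _); last by ring.
by move: lt; rewrite !intrB => lt; field; rewrite gt_eqF.
Qed.

(** The segment from [q] to [s] crosses the row of [p] at a point [z] of [P] on the other side of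
    [p] from [p'], so [p] is strictly between a point of [P] and an interior point. *)
Lemma side_interior q s p p' : cy q < cy s -> cy p = cy q + 1 ->
  cy p' = cy q + 1 -> p' \in I ->
  let side := cx s - cx q - (cy s - cy q) * (cx p - cx q) in
  (side < 0 /\ cx p < cx p') \/ (0 < side /\ cx p' < cx p) -> p \in I.
Proof.
move=> qs py p'y p'I side hs.
have sy0 : 0 < (cy s - cy q)%:~R :> R by rewrite ltr0z subr_gt0.
have ht : 0 <= ((cy s - cy q)%:~R^-1 : R) <= 1.
  rewrite invr_ge0 ltW //= invf_le1 // ler1z.
  by move: qs; clear; lia.
have := P_convex ht (P_point q) (P_point s).
set z := (X in P X _); have -> : (1 - (cy s - cy q)%:~R^-1) * (cy q)%:~R + (cy s - cy q)%:~R^-1 * (cy s)%:~R = (cy q + 1)%:~R :> R.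
  by move: sy0; rewrite intrB intrD => sy0; field; rewrite gt_eqF.
have zE : (cy s - cy q)%:~R * (z - (cx p)%:~R) = side%:~R :> R.
  rewrite /z /side; move: sy0; rewrite !(intrB, intrM) => sy0; field.
  by rewrite gt_eqF.
move=> Pz; have Q' := proj1 (IQ p') p'I; rewrite p'y in Q'.
apply/IQ; rewrite py; case: hs => -[sg lt].
  have zp : z < (cx p)%:~R.
    by rewrite -subr_lt0 -(pmulr_rlt0 _ sy0) zE ltrz0.
  have [E|n] := eqVneq (cx p) (cx p'); first by rewrite E.
  have := @Q_segment z ((cx p')%:~R) _ ((cx p)%:~R) (cy q + 1)%:~R Pz (Q_P Q') Q'.
  by apply; rewrite zp ltr_int.
have zp : (cx p)%:~R < z.
  by rewrite -subr_gt0 -(pmulr_rgt0 _ sy0) zE ltr0z.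
have := @Q_segment ((cx p')%:~R) z _ ((cx p)%:~R) (cy q + 1)%:~R (Q_P Q') Pz Q'.
by apply; rewrite zp ltr_int lt.
Qed.

End Planar.

(** * The polygon in adapted coordinates *)

Section Coordinates.
Variables (R : realType) (P : set 'cV[R]_2).
Hypothesis hP : lattice_polygon P.
Variables m00 m01 m10 m11 : int.
Hypothesis detM : m00 * m11 - m01 * m10 = 1 \/ m00 * m11 - m01 * m10 = -1.

Notation A := (lattice_points P).
Notation I := (fsub A (interior_points P)).
Notation X := (@cx A m00 m01).
Notation Y := (@cy A m10 m11).

(** The inverse of the change of coordinates: the adjugate times the determinant, which is its own
    inverse. *)
Definition of_coords (x y : R) : 'cV[R]_2 := \col_i
  ((m00 * m11 - m01 * m10)%:~R *
   (if i == 0 then m11%:~R * x - m01%:~R * y else m00%:~R * y - m10%:~R * x)).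

Lemma of_coords_convex x y x' y' t :
  of_coords ((1 - t) * x + t * x') ((1 - t) * y + t * y') =
  (1 - t) *: of_coords x y + t *: of_coords x' y'.
Proof. by apply: cV2P; rewrite !mxE /=; ring. Qed.

Lemma of_coords_zvec (a : A) : of_coords (X a)%:~R (Y a)%:~R = zvec R (val a).
Proof.
apply: cV2P; rewrite zvecE mxE /= -!intrM -intrB -intrM; congr (_%:~R).
  exact: esym (px_cxy detM a).
exact: esym (py_cxy detM a).
Qed.

Lemma coords_convex x y x' y' t : 0 <= t <= 1 ->
  P (of_coords x y) -> P (of_coords x' y') ->
  P (of_coords ((1 - t) * x + t * x') ((1 - t) * y + t * y')).
Proof. by rewrite of_coords_convex; exact: lattice_polygon_convex. Qed.

Lemma coords_between x y x' y' t : 0 < t <= 1 ->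
  P (of_coords x y) -> interior P (of_coords x' y') ->
  interior P (of_coords ((1 - t) * x + t * x') ((1 - t) * y + t * y')).
Proof.
move=> ht Pz Qz; rewrite of_coords_convex; apply: interior_between => //.
exact: lattice_polygon_convex.
Qed.

Lemma coords_interior_sub x y : interior P (of_coords x y) -> P (of_coords x y).
Proof. exact: interior_sub. Qed.

Lemma coords_point a : P (of_coords (X a)%:~R (Y a)%:~R).
Proof. by rewrite of_coords_zvec; apply/(mem_lattice_points hP); exact: valP. Qed.

Lemma coords_lattice (x y : int) : P (of_coords x%:~R y%:~R) ->
  exists a, X a = x /\ Y a = y.
Proof.
pose d := m00 * m11 - m01 * m10.
pose p := point (d * (m11 * x - m01 * y)) (d * (m00 * y - m10 * x)).
have -> : of_coords x%:~R y%:~R = zvec R p.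
  by apply: cV2P; rewrite zvecE mxE /= ?pointE0 ?pointE1 !(intrM, intrB).
move/(mem_lattice_points hP) => pA.
have dd : d * d = 1 by rewrite /d; case: detM => ->.
exists [` pA]%fset; rewrite /cx /cy /px /py /= pointE0 pointE1; split.
  by rewrite -[RHS]mul1r -dd /d; ring.
by rewrite -[RHS]mul1r -dd /d; ring.
Qed.

Lemma coords_interior a : a \in I <-> interior P (of_coords (X a)%:~R (Y a)%:~R).
Proof. by rewrite in_fsub of_coords_zvec; exact: mem_interior_points. Qed.

Lemma coords_inj a b : X a = X b -> Y a = Y b -> a = b.
Proof. exact: cxy_inj detM _ _. Qed.

Lemma bottom_row (D : {set {set A}}) (c : A -> R) (y0 : int) p0 :
  (forall T, T \in D -> unimodular_triangle T) -> induces c D ->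
  (forall a, y0 <= Y a) -> p0 \in I -> Y p0 = y0 + 1 ->
  exists2 N : {set A}, forall q, q \in N -> Y q = y0 /\ column R D q = 0 &
    (#|row Y y0| <= #|N| + #|irow Y I (y0 + 1)| + 1)%N.
Proof.
move=> uD cD y0_le p0I p0y.
apply: (row_columns uD cD detM y0_le _ _ p0I p0y).
  move=> q1 q2 x h1 h2 hx.
  have [|e ey ex] := row_contiguous coords_convex coords_point coords_lattice (_ : Y q1 = Y q2) hx.
    by rewrite h1.
  by exists e => //; rewrite ey.
move=> q s p p' hq hs hp hp' p'I; rewrite -hq in hs hp hp'.
exact: (side_interior coords_convex coords_between coords_interior_sub coords_point coords_interior hs hp hp' p'I).
Qed.

End Coordinates.

(** * The upper bound *)

(** The hypotheses give dim <= g + 1 + (r1 + r3). Averaging r1 + r3 <= n1 + n3 + 4 with weight 2/3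
    and r1 + r3 <= 2 n2 + 4 with weight 1/3 bounds the last sum by 2g/3 + 4, whence 5g/3 + 5 = U(g,
    4). *)
Lemma rank_arith (k g n1 n2 n3 r0 r1 r2 r3 r4 N0 N4 dim : nat) :
  g = (n1 + n2 + n3)%N -> g = (3 * k + 1)%N ->
  (r0 <= N0 + n1 + 1)%N -> (r4 <= N4 + n3 + 1)%N ->
  (r1 <= n1 + 2)%N -> (r2 <= n2 + 2)%N -> (r3 <= n3 + 2)%N ->
  (r1 + r3 <= 2 * n2 + 4)%N ->
  (dim + (N0 + N4) + 3 <= r0 + r1 + r2 + r3 + r4)%N -> (dim <= 5 * k + 6)%N.
Proof. lia. Qed.

(** A positive value cannot be the junk value 0. *)
Lemma min_ofP (S : set nat) n : min_of S = n.+1 ->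
  S n.+1 /\ forall j, S j -> (n.+1 <= j)%N.
Proof. by rewrite /min_of; case: xgetP => [m -> h E|_ //]; rewrite -E. Qed.

Section UpperBound.
Variables (R : realType) (P : set 'cV[R]_2).
Hypothesis hP : lattice_polygon P.

Notation A := (lattice_points P).
Notation I := (fsub A (interior_points P)).

Lemma lattice_mapE1 (M : 'M[int]_2) b (p : 'cV[int]_2) :
  lattice_map M b (zvec R p) 1 0 = (M 1 0 * p 0 0 + M 1 1 * p 1 0 + b 1 0)%:~R.
Proof. by rewrite /lattice_map mxE mul_mx_cV2 !mxE !intrD !intrM. Qed.

Lemma inner_bounds (M : 'M[int]_2) (b : 'cV[int]_2) (s : nat) :
  (forall a : A, a \in I -> 0 <= cy (M 1 0) (M 1 1) a + b 1 0 <= s%:Z) ->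
  forall x, inner_polygon P x -> 0 <= lattice_map M b x 1 0 <= s%:R.
Proof.
move=> h x; rewrite /lattice_map mxE mul_mx_cV2 !mxE => hx.
have hp p : p \in interior_points P -> 0 <= M 1 0 * p 0 0 + M 1 1 * p 1 0 + b 1 0 <= s%:Z.
  move=> pI; have pA := interior_lattice_points hP pI.
  by apply: (h [` pA]%fset); rewrite in_fsub.
have e1 := @hull_ineq _ _ (M 1 0)%:~R (M 1 1)%:~R (s%:R - (b 1 0)%:~R) x _ hx.
have e2 := @hull_ineq _ _ (- (M 1 0)%:~R) (- (M 1 1)%:~R) (b 1 0)%:~R x _ hx.
apply/andP; split.
  rewrite -subr_ge0 subr0; suff : - (M 1 0)%:~R * x 0 0 + - (M 1 1)%:~R * x 1 0 <= (b 1 0)%:~R by lra.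
  apply: e2 => p /hp/andP[h0 _]; rewrite !mulNr -!intrM -opprD -intrD -intrN ler_int.
  by move: h0; clear; lia.
suff : (M 1 0)%:~R * x 0 0 + (M 1 1)%:~R * x 1 0 <= s%:R - (b 1 0)%:~R by lra.
apply: e1 => p /hp/andP[_ h0]; rewrite -!intrM -intrD -[s%:R]/(s%:Z%:~R) -intrB ler_int.
by move: h0; clear; lia.
Qed.

(** Minimality of the width makes both outer rows of interior points nonempty; otherwise the same
    matrix, after a shift if the lowest row is empty, would give width 1. *)
Lemma inner_coords : lw (inner_polygon P) = 2 -> exists m00 m01 m10 m11 y0 : int,
  [/\ m00 * m11 - m01 * m10 = 1 \/ m00 * m11 - m01 * m10 = -1,
      forall a : A, a \in I -> y0 + 1 <= cy m10 m11 a <= y0 + 3,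
      exists2 a : A, a \in I & cy m10 m11 a = y0 + 1 &
      exists2 a : A, a \in I & cy m10 m11 a = y0 + 3].
Proof.
rewrite /lw; case: ifP => // _ [] /min_ofP[[M [b [uM hM]]] minS].
have detM : M 0 0 * M 1 1 - M 0 1 * M 1 0 = 1 \/ M 0 0 * M 1 1 - M 0 1 * M 1 0 = -1.
  move: uM; rewrite unitmxE det_mx2; move: (_ - _) => d.
  by rewrite qualifE /= => /orP[]/eqP->; [left | right].
have inI (a : A) : a \in I -> 0 <= cy (M 1 0) (M 1 1) a + b 1 0 <= 2.
  rewrite in_fsub => aI; have := hM _ (mem_hull R aI).
  by rewrite lattice_mapE1 -[2%:R]/(2%:Z%:~R) ler0z ler_int.
(* The choice [- b 1 0 - 1] turns the values 0, 1, 2 of the shifted functional into the heights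
   [y0 + 1] to [y0 + 3]. *)
exists (M 0 0), (M 0 1), (M 1 0), (M 1 1), (- b 1 0 - 1); split=> //.
- by move=> a /inI; clear; lia.
- apply: contrapT => no.
  suff : (2 <= 1)%N by [].
  apply: minS; exists M, (b + point 0 (-1)); split=> //.
  apply: inner_bounds => a aI; rewrite !mxE /=; have := inI a aI.
  have : cy (M 1 0) (M 1 1) a <> - b 1 0 - 1 + 1 by move=> E; apply: no; exists a.
  by clear; lia.
- apply: contrapT => no.
  suff : (2 <= 1)%N by [].
  apply: minS; exists M, b; split=> //.
  apply: inner_bounds => a aI; have := inI a aI.
  have : cy (M 1 0) (M 1 1) a <> - b 1 0 - 1 + 3 by move=> E; apply: no; exists a.
  by clear; lia.
Qed.

Lemma cone_dim_upper k D : genus P = (3 * k + 1)%N -> (2 <= k)%N ->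
  lw (inner_polygon P) = 2 -> @regular_unimodular R A D ->
  (cone_dim (@skeleton_cone R A D) <= 5 * k + 6)%N.
Proof.
move=> gP k2 /inner_coords[m00 [m01 [m10 [m11 [y0 [detM rows [p1 p1I p1y] [p3 p3I p3y]]]]]]].
case=> uD [c cD].
have cardI : #|I| = (3 * k + 1)%N.
  rewrite card_fsub //; apply/fsubsetP => p; exact: interior_lattice_points.
have I7 : (7 <= #|I|)%N by rewrite cardI; clear -k2; lia.
have hi := height_le (coords_inj detM) (@coords_between _ _ hP m00 m01 m10 m11)
  (@coords_interior_sub _ P m00 m01 m10 m11) (coords_point hP detM)
  (coords_lattice hP detM) (coords_interior hP detM) rows I7.
(* Reflection of the heights, with [- (y0 + 4)] in the role of [y0]: it yields the lower bound on
   the heights and the count for the top row. *)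
have detM' : m00 * - m11 - m01 * - m10 = 1 \/ m00 * - m11 - m01 * - m10 = -1.
  by move: detM; clear; lia.
have cyN (a : A) : cy (- m10) (- m11) a = - cy m10 m11 a by rewrite /cy; ring.
have rows' (a : A) : a \in I -> - (y0 + 4) + 1 <= cy (- m10) (- m11) a <= - (y0 + 4) + 3.
  by move/rows; rewrite cyN; clear; lia.
have lo' := height_le (coords_inj detM') (@coords_between _ _ hP m00 m01 (- m10) (- m11))
  (@coords_interior_sub _ P m00 m01 (- m10) (- m11)) (coords_point hP detM')
  (coords_lattice hP detM') (coords_interior hP detM') rows' I7.
have lo (a : A) : y0 <= cy m10 m11 a by have := lo' a; rewrite cyN; clear; lia.
have hi' (a : A) : - (y0 + 4) <= cy (- m10) (- m11) a by have := hi a; rewrite cyN; clear; lia.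
have [N0 N0P N0c] := bottom_row hP detM uD cD lo p1I p1y.
have p3y' : cy (- m10) (- m11) p3 = - (y0 + 4) + 1 by rewrite cyN p3y; clear; lia.
have [N4 N4P N4c] := bottom_row hP detM' uD cD hi' p3I p3y'.
have [x2 Q2] := middle_interior (@coords_between _ _ hP m00 m01 m10 m11) (coords_point hP detM)
  (coords_interior hP detM) p3I p1y p3y.
have mid := middle_row (coords_inj detM) (@coords_convex _ _ hP m00 m01 m10 m11) (@coords_between _ _ hP m00 m01 m10 m11)
  (@coords_interior_sub _ P m00 m01 m10 m11) (coords_point hP detM)
  (coords_lattice hP detM) (coords_interior hP detM) p3I p1y p3y.
have rle y x (Qxy : interior P (of_coords m00 m01 m10 m11 x y%:~R)) :=
  row_le_irow (coords_inj detM) (@coords_between _ _ hP m00 m01 m10 m11)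
  (@coords_interior_sub _ P m00 m01 m10 m11) (coords_point hP detM)
  (coords_lattice hP detM) (coords_interior hP detM) Qxy.
have r2 := rle _ _ Q2.
have r1 : (#|row (@cy A m10 m11) (y0 + 1)| <= #|irow (@cy A m10 m11) I (y0 + 1)| + 2)%N.
  by have /(coords_interior hP detM) := p1I; rewrite p1y => /rle.
have r3 : (#|row (@cy A m10 m11) (y0 + 3)| <= #|irow (@cy A m10 m11) I (y0 + 3)| + 2)%N.
  by have /(coords_interior hP detM) := p3I; rewrite p3y => /rle.
have irows := card_irows rows.
have row4 : row (cy (- m10) (- m11)) (- (y0 + 4)) = row (@cy A m10 m11) (y0 + 4).
  by apply/setP => a; rewrite !inE cyN eqr_opp.
have irow3 : irow (cy (- m10) (- m11)) I (- (y0 + 4) + 1) = irow (@cy A m10 m11) I (y0 + 3).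
  apply/setP => a; rewrite !inE cyN; congr (_ && _); clear; apply/eqP/eqP; lia.
rewrite row4 irow3 in N4c.
have cardA := card_rows (fun a => introT andP (conj (lo a) (hi a))).
have N04 : #|(N0 :|: N4)%SET| = (#|N0| + #|N4|)%N.
  rewrite cardsU (_ : N0 :&: N4 = finset.set0)%SET ?cards0 ?subn0 //.
  apply/setP => q; rewrite !inE; apply/negP => /andP[/N0P[qy _] /N4P[q4 _]].
  by move: q4; rewrite cyN qy; clear; lia.
(* Some interior row has two points, as three rows with at most one each hold fewer than 7; a point
   of another row completes them to a triangle. *)
have [t0 [t1 [t2 [t0I t1I t2I art]]]] : exists t0 t1 t2 : A,
    [/\ t0 \in I, t1 \in I, t2 \in I & ar t0 t1 t2 != 0].
  have wide y d : d \in I -> cy m10 m11 d != y ->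
      (1 < #|irow (@cy A m10 m11) I y|)%N ->
      exists t0 t1 t2 : A, [/\ t0 \in I, t1 \in I, t2 \in I & ar t0 t1 t2 != 0].
    move=> dI dy /card_gt1P[a [b [/setIdP[aI /eqP ay] /setIdP[bI /eqP b_y] ab]]].
    exists a, b, d; split=> //; apply/negP => /eqP ar0; case/negP: ab.
    have := carE m00 m01 m10 m11 a b d; rewrite ar0 mulr0 /car ay b_y subrr mulr0 subr0.
    move/eqP; rewrite mulf_eq0 !subr_eq0 (negbTE dy) orbF => /eqP ba.
    by apply/eqP/(coords_inj detM); rewrite ?ay ?ba.
  have [|] := ltnP 1 #|irow (@cy A m10 m11) I (y0 + 1)|.
    by apply: (wide _ p3 p3I); rewrite p3y; clear; lia.
  have [|] := ltnP 1 #|irow (@cy A m10 m11) I (y0 + 2)|.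
    by move=> h _; apply: (wide _ p3 p3I _ h); rewrite p3y; clear; lia.
  have [|] := ltnP 1 #|irow (@cy A m10 m11) I (y0 + 3)|.
    by move=> h _ _; apply: (wide _ p1 p1I _ h); rewrite p1y; clear; lia.
  by move: I7; rewrite irows; clear; lia.
(* Zero columns were collected from the outer rows, which contain no interior point, so [t0], [t1],
   [t2] avoid them. *)
have NP q : q \in (N0 :|: N4)%SET -> column R D q = 0 /\ q \notin I.
  rewrite inE => /orP[/N0P[qy ->]|/N4P[qy ->]]; split=> //; apply/negP => /rows.
    by rewrite qy; clear; lia.
  by rewrite cyN in qy; clear -qy; lia.
have notN t : t \in I -> t \notin (N0 :|: N4)%SET.
  by move=> tI; apply/negP => /NP[_]; rewrite tI.
have := cone_dim_le uD cD (fun q qN => proj1 (NP q qN)) (And3 (notN _ t0I) (notN _ t1I) (notN _ t2I)) art.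
rewrite N04 cardA => hd.
rewrite irows in cardI.
exact: (rank_arith (erefl _) cardI N0c N4c r1 r2 r3 mid hd).
Qed.

End UpperBound.

(** * The hexagon *)

Lemma min_of_eq (S : set nat) n : S n -> (forall j, S j -> (n <= j)%N) ->
  min_of S = n.
Proof.
move=> Sn minn; rewrite /min_of; case: xgetP => [m _ [Sm mmin]|no].
  by apply/eqP; rewrite eqn_leq mmin // minn.
by case: (no n).
Qed.

Lemma max_of_le (S : set nat) n : (forall j, S j -> (j <= n)%N) ->
  (max_of S <= n)%N.
Proof. by rewrite /max_of => h; case: xgetP => [m _ [/h]|]. Qed.

(** The bound [n] ensures that a greatest element exists, so that [max_of] is not the junk value. *)
Lemma max_of_ge (S : set nat) n m : (forall j, S j -> (j <= n)%N) -> S m ->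
  (m <= max_of S)%N.
Proof.
move=> h Sm; rewrite /max_of; case: xgetP => [x _ [_ hx]|no]; first exact: hx.
have ex : exists i, `[< S i >] by exists m; apply/asboolP.
have bnd i : `[< S i >] -> (i <= n)%N by move/asboolP/h.
case: (ex_maxnP ex bnd) => x /asboolP Sx hx; case: (no x); split=> // j Sj.
by apply: hx; apply/asboolP.
Qed.

Section InteriorCriteria.
Variables (R : realType) (P : set 'cV[R]_2).

(** A small step from [z] in the direction (a, b) stays in [P] and increases the functional by a
    positive multiple of a^2 + b^2. *)
Lemma interior_lt (a b k : R) z : `|a| <= 1 -> `|b| <= 1 -> 0 < a * a + b * b ->
  (forall x, P x -> a * x 0 0 + b * x 1 0 <= k) -> interior P z ->
  a * z 0 0 + b * z 1 0 < k.
Proof.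
move=> a1 b1 ab hP /interiorP[r r0 hr].
have small t : `|t| <= 1 -> `|r / 2 * t| < r.
  move=> t1; rewrite normrM ger0_norm; last by rewrite divr_ge0 // ltW.
  apply: le_lt_trans (_ : r / 2 * 1 < r); last by lra.
  by apply: ler_wpM2l => //; rewrite divr_ge0 // ltW.
have /hP : P (z + (r / 2) *: \col_i (if i == 0 then a else b)).
  by apply: hr; rewrite !mxE /= addrAC subrr add0r; exact: small.
rewrite !mxE /= => h; have : 0 < r / 2 * (a * a + b * b) by rewrite mulr_gt0 // divr_gt0.
lra.
Qed.

(** The hull of the cross contains the open square of half-side 1/2 about [p]: the point with
    offsets [d0], [d1] is the midpoint of the points with offset [2 d0] on one axis and [2 d1] on
    the other. *)
Lemma interior_cross (p : 'cV[int]_2) : convex_set P ->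
  (forall i j : int, `|i| + `|j| = 1 -> P (zvec R (p + point i j))) ->
  interior P (zvec R p).
Proof.
move=> cP h; apply/interiorP; exists 2^-1; first by rewrite invr_gt0.
move=> z' h0 h1; set d0 := _ - _ in h0; set d1 := _ - _ in h1.
have line (i j : int) (d : R) : `|i| + `|j| = 1 -> `|d| < 2^-1 ->
    P (zvec R p + (2 * d) *: zvec R (point i j)).
  move=> ij hd; have ht : 0 <= (2^-1 + d : R) <= 1.
    by move: hd; rewrite ltr_norml => /andP[hd1 hd2]; apply/andP; split; lra.
  have ij' : `|- i| + `|- j| = 1 by rewrite !normrN.
  have := cP _ _ _ ht (h _ _ ij') (h _ _ ij).
  by congr (P _); apply: cV2P; rewrite !mxE /= !(intrD, intrN) /=; field.
have ht : 0 <= (2^-1 : R) <= 1 by apply/andP; split; lra.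
have := cP _ _ _ ht (line 1 0 d0 erefl h0) (line 0 1 d1 erefl h1).
by congr (P _); apply: cV2P; rewrite !mxE /= ?mulr1 ?mulr0; rewrite /d0 /d1 !mxE; field.
Qed.

End InteriorCriteria.

Section Hexagon.
Variables (R : realType) (k : nat).
Hypothesis k2 : (2 <= k)%N.

Definition in_hex (x y : int) : bool :=
  [&& 0 <= x, x <= k%:Z + 2, 0 <= y, y <= 4, -2 <= x - y & x - y <= k%:Z].

Definition inside_hex (x y : int) : bool :=
  [&& 0 < x, x < k%:Z + 2, 0 < y, y < 4, -2 < x - y & x - y < k%:Z].

Definition hex_points : {fset 'cV[int]_2} :=
  [fset p in [fset point i%:Z j%:Z | i in iota 0 (k + 3), j in iota 0 5]
    | in_hex (p 0 0) (p 1 0)]%fset.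

Lemma mem_hex_points (p : 'cV[int]_2) : (p \in hex_points) = in_hex (p 0 0) (p 1 0).
Proof.
have aux (x y : int) : in_hex x y -> [/\ `|x|%N \in iota 0 (k + 3),
    `|y|%N \in iota 0 5, x = `|x|%N%:Z & y = `|y|%N%:Z].
  by rewrite /in_hex !mem_iota => h; split; move: h; clear; lia.
rewrite !inE /=; apply/andP/idP => [[]//|h]; split=> //.
have [hx hy ex ey] := aux _ _ h.
by apply/imfset2P; exists `|(p 0 0)%R|%N => //; exists `|(p 1 0)%R|%N => //; rewrite -ex -ey -pointE.
Qed.

Definition hexagon : set 'cV[R]_2 := hull R hex_points.

Lemma hexagon_lattice : lattice_polygon hexagon.
Proof.
exists hex_points; split=> //; apply/fset0Pn; exists (point 0 0).
by rewrite mem_hex_points pointE0 pointE1.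
Qed.

Lemma hexagon_ineq (a b c : int) x :
  (forall i j, in_hex i j -> a * i + b * j <= c) -> hexagon x ->
  a%:~R * x 0 0 + b%:~R * x 1 0 <= c%:~R.
Proof.
move=> h; apply: hull_ineq => p; rewrite mem_hex_points => /h.
by rewrite -!intrM -intrD ler_int.
Qed.

Lemma mem_hexagon_points (p : 'cV[int]_2) :
  (p \in lattice_points hexagon) = (p \in hex_points).
Proof.
apply/idP/idP => [/(mem_lattice_points hexagon_lattice) hp|pV].
  have H a b c : (forall i j, in_hex i j -> a * i + b * j <= c) ->
      a * p 0 0 + b * p 1 0 <= c.
    by move=> h; have := hexagon_ineq h hp; rewrite !zvecE -!intrM -intrD ler_int.
  rewrite mem_hex_points /in_hex.
  have h1 : -1 * p 0 0 + 0 * p 1 0 <= 0 by apply: H => i j; rewrite /in_hex; clear; lia.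
  have h2 : 1 * p 0 0 + 0 * p 1 0 <= k%:Z + 2 by apply: H => i j; rewrite /in_hex; clear; lia.
  have h3 : 0 * p 0 0 + -1 * p 1 0 <= 0 by apply: H => i j; rewrite /in_hex; clear; lia.
  have h4 : 0 * p 0 0 + 1 * p 1 0 <= 4 by apply: H => i j; rewrite /in_hex; clear; lia.
  have h5 : -1 * p 0 0 + 1 * p 1 0 <= 2 by apply: H => i j; rewrite /in_hex; clear; lia.
  have h6 : 1 * p 0 0 + -1 * p 1 0 <= k%:Z by apply: H => i j; rewrite /in_hex; clear; lia.
  by move: h1 h2 h3 h4 h5 h6; clear; lia.
by apply/(mem_lattice_points hexagon_lattice); exact: mem_hull.
Qed.

Lemma hexagon_points : lattice_points hexagon = hex_points.
Proof. by apply/fsetP => p; exact: mem_hexagon_points. Qed.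

Lemma hexagon_interior (p : 'cV[int]_2) :
  (p \in interior_points hexagon) = inside_hex (p 0 0) (p 1 0).
Proof.
apply/idP/idP => [/(mem_interior_points hexagon_lattice) hp|ps].
  have H (a b c : int) : `|a| <= 1 -> `|b| <= 1 -> 0 < a * a + b * b ->
      (forall i j, in_hex i j -> a * i + b * j <= c) -> a * p 0 0 + b * p 1 0 < c.
    move=> a1 b1 ab h; rewrite -(ltr_int R) intrD !intrM -!zvecE.
    apply: (interior_lt (P := hexagon)) hp.
    - by rewrite -intr_norm lerz1.
    - by rewrite -intr_norm lerz1.
    - by rewrite -!intrM -intrD ltr0z.
    - by move=> x; exact: hexagon_ineq.
  rewrite /inside_hex.
  have h1 : -1 * p 0 0 + 0 * p 1 0 < 0 by apply: H => // i j; rewrite /in_hex; clear; lia.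
  have h2 : 1 * p 0 0 + 0 * p 1 0 < k%:Z + 2 by apply: H => // i j; rewrite /in_hex; clear; lia.
  have h3 : 0 * p 0 0 + -1 * p 1 0 < 0 by apply: H => // i j; rewrite /in_hex; clear; lia.
  have h4 : 0 * p 0 0 + 1 * p 1 0 < 4 by apply: H => // i j; rewrite /in_hex; clear; lia.
  have h5 : -1 * p 0 0 + 1 * p 1 0 < 2 by apply: H => // i j; rewrite /in_hex; clear; lia.
  have h6 : 1 * p 0 0 + -1 * p 1 0 < k%:Z by apply: H => // i j; rewrite /in_hex; clear; lia.
  by move: h1 h2 h3 h4 h5 h6; clear; lia.
apply/(mem_interior_points hexagon_lattice); apply: interior_cross.
  exact: hull_convex.
move=> i j ij; apply: mem_hull; rewrite mem_hex_points !mxE /=.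
by move: ps ij; rewrite /inside_hex /in_hex; clear; lia.
Qed.

Definition row_lo (j : int) : int := Num.max 0 (j - 2).
Definition row_hi (j : int) : int := Num.min (k%:Z + 2) (k%:Z + j).

(** The rows have k + 1, k + 2, k + 3, k + 2, k + 1 points; three fewer than their total is the
    dimension sought. *)
Lemma card_hex_points : #|` hex_points| = (5 * k + 9)%N.
Proof.
pose X (a : hex_points) : int := px a; pose Y (a : hex_points) : int := py a.
have aV (a : hex_points) : in_hex (X a) (Y a) by rewrite -mem_hex_points; exact: valP.
have at_ x y : in_hex x y -> exists2 a : hex_points, Y a = y & X a = x.
  move=> h; have pV : point x y \in hex_points by rewrite mem_hex_points pointE0 pointE1.
  by exists [` pV]%fset; rewrite /X /Y /px /py /= ?pointE0 ?pointE1.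
have rowE j : 0 <= j <= 4 -> #|row Y j|%:Z = row_hi j - row_lo j + 1.
  move=> hj; apply: le_anti; apply/andP; split.
    apply: (card_le_range (f := X)).
    - move=> a b; rewrite !inE => /eqP aj /eqP bj ab; apply: pxy_inj => //.
      by rewrite -/(Y a) -/(Y b) aj bj.
    - by move=> a; rewrite inE => /eqP aj; move: (aV a); rewrite aj /in_hex /row_lo /row_hi; clear; lia.
    - by rewrite /row_lo /row_hi; move: hj; clear; lia.
  apply: (card_ge_range (f := X)) => z hz.
  have [|a ay ax] := @at_ z j; last by exists a => //; rewrite inE ay.
  by move: hj hz; rewrite /in_hex /row_lo /row_hi; clear; lia.
have := @card_rows _ Y 0; rewrite cardfE => ->; last first.
  by move=> a; move: (aV a); rewrite /in_hex; clear; lia.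
have := rowE 0 isT; have := rowE (0 + 1) isT; have := rowE (0 + 2) isT.
have := rowE (0 + 3) isT; have := rowE (0 + 4) isT; rewrite /row_lo /row_hi.
move: #|row Y 0| #|row Y (0 + 1)| #|row Y (0 + 2)| #|row Y (0 + 3)| #|row Y (0 + 4)|.
by clear -k2 => r0 r1 r2 r3 r4; lia.
Qed.

Lemma hexagon_genus : genus hexagon = (3 * k + 1)%N.
Proof.
rewrite /genus; set B := interior_points _.
pose X (a : B) : int := px a; pose Y (a : B) : int := py a.
have aV (a : B) : inside_hex (X a) (Y a) by rewrite -hexagon_interior; exact: valP.
have at_ x y : inside_hex x y -> exists2 a : B, Y a = y & X a = x.
  move=> h; have pV : point x y \in B by rewrite hexagon_interior pointE0 pointE1.
  by exists [` pV]%fset; rewrite /X /Y /px /py /= ?pointE0 ?pointE1.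
have rowE j : 1 <= j <= 3 -> #|irow Y [set: B]%SET j|%:Z = row_hi j - row_lo j - 1.
  move=> hj; transitivity ((row_hi j - 1) - (row_lo j + 1) + 1); last by clear; lia.
  apply: le_anti; apply/andP; split.
    apply: (card_le_range (f := X)).
    - move=> a b; rewrite !inE => /eqP aj /eqP bj ab; apply: pxy_inj => //.
      by rewrite -/(Y a) -/(Y b) aj bj.
    - by move=> a; rewrite !inE => /eqP aj; move: (aV a); rewrite aj /inside_hex /row_lo /row_hi; clear; lia.
    - by rewrite /row_lo /row_hi; move: hj; clear -k2; lia.
  apply: (card_ge_range (f := X)) => z hz.
  have [|a ay ax] := @at_ z j; last by exists a => //; rewrite !inE ay eqxx.
  by move: hj hz; rewrite /inside_hex /row_lo /row_hi; clear; lia.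
have := @card_irows _ Y [set: B]%SET 0; rewrite cardfE cardsT => ->; last first.
  by move=> a _; move: (aV a); rewrite /inside_hex; clear; lia.
have := rowE (0 + 1) isT; have := rowE (0 + 2) isT.
have := rowE (0 + 3) isT; rewrite /row_lo /row_hi.
move: #|irow Y _ (0 + 1)| #|irow Y _ (0 + 2)| #|irow Y _ (0 + 3)|.
by clear -k2 => r1 r2 r3; lia.
Qed.

(** For the lower bound, the point (2, 2) and its four axis neighbours are interior. A functional
    with values in an interval of length at most 1 is constant along both axes through it, so its
    row in the matrix would be zero. *)
Lemma hexagon_lw : lw (inner_polygon hexagon) = 2.
Proof.
have mem i j : inside_hex i j -> inner_polygon hexagon (zvec R (point i j)).
  by move=> h; apply: mem_hull; rewrite hexagon_interior pointE0 pointE1.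
have center : inner_polygon hexagon (zvec R (point 2 2)).
  by apply: mem; rewrite /inside_hex; clear -k2; lia.
rewrite /lw asboolF; last by move=> E; rewrite E in center.
congr (Posz _); apply: min_of_eq.
  exists 1%:M, (point 0 (-1)); split; first exact: unitmx1.
  apply: (inner_bounds hexagon_lattice) => a; rewrite in_fsub hexagon_interior !mxE /=.
  by rewrite /cy -[fsval a 0 0]/(px a) -[fsval a 1 0]/(py a) /inside_hex; clear; lia.
move=> j [M [b [uM hM]]]; rewrite leqNgt; apply/negP => j2.
have hM' x y : inside_hex x y -> 0 <= M 1 0 * x + M 1 1 * y + b 1 0 <= j%:Z.
  move=> /mem/hM; rewrite lattice_mapE1 pointE0 pointE1.
  by rewrite -[j%:R]/(j%:Z%:~R) ler0z ler_int.
have h1 := hM' 2 2; have h2 := hM' 1 2; have h3 := hM' 3 2.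
have h4 := hM' 2 1; have h5 := hM' 2 3.
have [M0 M1] : M 1 0 = 0 /\ M 1 1 = 0.
  move: h1 h2 h3 h4 h5; rewrite /inside_hex; clear -k2 j2; lia.
by move: uM; rewrite unitmxE det_mx2 M0 M1 !mulr0 subr0 unitr0.
Qed.

(** The middle row contains a lattice segment of length 4, for which the exceptional triangle has no
    room. *)
Lemma hexagon_egon : egon hexagon = 4.
Proof.
rewrite /egon asboolF ?hexagon_lw // => -[M [b [uM E]]].
have ineq (a e c : int) x : a * (-2) + e * (-2) <= c -> a * 2 + e * 0 <= c ->
    a * 0 + e * 2 <= c -> exceptional_triangle R x ->
    a%:~R * x 0 0 + e%:~R * x 1 0 <= c%:~R.
  move=> c1 c2 c3; apply: hull_ineq => p; rewrite !inE => /orP[/orP[]|] /eqP->;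
    by rewrite pointE0 pointE1 -!intrM -intrD ler_int.
have img (i : nat) : (i <= 4)%N -> exceptional_triangle R (lattice_map M b (zvec R (point i%:Z 2))).
  move=> i4; rewrite E; exists (zvec R (point i%:Z 2)) => //.
  by apply: mem_hull; rewrite mem_hex_points pointE0 pointE1 /in_hex; move: i4; clear -k2; lia.
have lm i j : lattice_map M b (zvec R (point i 2)) j 0 = (M j 0 * i + M j 1 * 2 + b j 0)%:~R.
  by rewrite /lattice_map mxE mul_mx_cV2 !mxE /= !intrD !intrM.
have img_ineq a b' c i : a * (-2) + b' * (-2) <= c -> a * 2 + b' * 0 <= c ->
    a * 0 + b' * 2 <= c -> (i <= 4)%N ->
    a * (M 0 0 * i%:Z + M 0 1 * 2 + b 0 0) + b' * (M 1 0 * i%:Z + M 1 1 * 2 + b 1 0) <= c.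
  move=> c1 c2 c3 /img/(ineq _ _ _ _ c1 c2 c3).
  by rewrite !lm -!intrM -intrD ler_int.
(* The three inequalities x + y <= 2, -2x + y <= 2, x - 2y <= 2 cut out the triangle; at the two
   ends of the segment they force its image to be a point. *)
have [M0 M1] : M 0 0 = 0 /\ M 1 0 = 0.
  have a1 := @img_ineq 1 1 2 0%N isT isT isT isT; have a2 := @img_ineq 1 1 2 4%N isT isT isT isT.
  have b1 := @img_ineq (-2) 1 2 0%N isT isT isT isT; have b2 := @img_ineq (-2) 1 2 4%N isT isT isT isT.
  have c1 := @img_ineq 1 (-2) 2 0%N isT isT isT isT; have c2 := @img_ineq 1 (-2) 2 4%N isT isT isT isT.
  by move: a1 a2 b1 b2 c1 c2; clear; lia.
by move: uM; rewrite unitmxE det_mx2 M0 M1 mul0r mulr0 subr0 unitr0.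
Qed.

End Hexagon.

(* The norm form of the hexagonal lattice; its six unit vectors are the edge
   directions of the honeycomb triangulation. *)
Definition hex_norm (i j : int) : int := i * i + j * j - i * j.

Lemma hex_normE i j : hex_norm i j = 1 ->
  (i = 1 /\ j = 0) \/ (i = 1 /\ j = 1) \/ (i = 0 /\ j = 1) \/
  (i = -1 /\ j = 0) \/ (i = -1 /\ j = -1) \/ (i = 0 /\ j = -1).
Proof.
rewrite /hex_norm => h.
have sq (x y : int) : x * x + y * y - x * y = 1 -> -1 <= x <= 1.
  move=> xy; have := sqr_ge0 (2 * y - x); rewrite expr2 => h1.
  have : 3 * (x * x) <= 4 by move: xy h1; clear; lia.
  by clear; nia.
have i1 := sq i j h; have j1 : -1 <= j <= 1 by apply: (sq j i); rewrite -h; ring.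
have [iE | [iE | iE]] : i = -1 \/ i = 0 \/ i = 1 by lia.
all: have [jE | [jE | jE]] : j = -1 \/ j = 0 \/ j = 1 by lia.
all: by move: h; rewrite iE jE; clear; lia.
Qed.

Lemma finite_small (R : realType) (T : finType) (p : pred T) (f g : T -> R) :
  (forall i, p i -> 0 < f i) ->
  exists2 r, 0 < r & forall r', 0 < r' <= r -> forall i, p i -> 0 < f i + r' * g i.
Proof.
move=> fpos; have [none|] := pselect (forall i, ~~ p i).
  by exists 1 => // r' _ i pi; have := none i; rewrite pi.
move=> /existsNP[i0 /negP]; rewrite negbK => pi0.
have den i : 0 < `|g i| + 1 by rewrite ltr_wpDl.
have [i pi imin] := finite_min (fun i => f i / (`|g i| + 1)) pi0.
exists (f i / (`|g i| + 1)); first by rewrite divr_gt0 ?fpos.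
move=> r' /andP[r'0 r'le] j pj; have := le_trans r'le (imin j pj).
rewrite ler_pdivlMr // => h; have : - (r' * `|g j|) <= r' * g j.
  by rewrite -mulrN ler_pM2l // lerNnormlW.
by have := fpos j pj; nra.
Qed.

(** * The honeycomb triangulation and the heights inducing it *)

Section Honeycomb.
Variables (R : realType) (k : nat).
Hypothesis k2 : (2 <= k)%N.
Notation A := (hex_points k).
Implicit Types (a b d p q x : A) (T e : {set A}) (c : A -> R).

Lemma in_hexP a : in_hex k (px a) (py a).
Proof. by rewrite -mem_hex_points; exact: valP. Qed.

Lemma hex_at i j : in_hex k i j -> exists a : A, px a = i /\ py a = j.
Proof.
move=> h; have pV : point i j \in A by rewrite mem_hex_points pointE0 pointE1.
by exists [` pV]%fset; rewrite /px /py /= pointE0 pointE1.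
Qed.

Definition adj a b := hex_norm (px b - px a) (py b - py a) == 1.

Lemma adj_sym a b : adj a b = adj b a.
Proof. by rewrite /adj /hex_norm; congr (_ == _); ring. Qed.

Lemma adj_neq a b : adj a b -> a != b.
Proof. by apply: contraTneq => ->; rewrite /adj !subrr. Qed.

Definition honeycomb : {set {set A}} :=
  [set T : {set A} | [exists a, exists b, exists d,
    [&& adj a b, adj a d, adj b d & T == [set a; b; d]%SET]]]%SET.

Lemma honeycombP T : reflect
  (exists a b d, [/\ adj a b, adj a d, adj b d & T = [set a; b; d]%SET])
  (T \in honeycomb).
Proof.
rewrite inE; apply: (iffP existsP) => [[a /existsP[b /existsP[d /and4P[h1 h2 h3 /eqP h4]]]]|].
  by exists a, b, d.
move=> [a [b [d [h1 h2 h3 h4]]]]; exists a; apply/existsP; exists b; apply/existsP.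
by exists d; rewrite h1 h2 h3 h4 eqxx.
Qed.

Lemma adj_ar a b d : adj a b -> adj a d -> adj b d -> ar a b d = 1 \/ ar a b d = -1.
Proof.
move=> /eqP/hex_normE h1 /eqP/hex_normE h2 /eqP; rewrite /ar /hex_norm.
have -> : px d - px b = (px d - px a) - (px b - px a) by ring.
have -> : py d - py b = (py d - py a) - (py b - py a) by ring.
move: (px b - px a) (py b - py a) (px d - px a) (py d - py a) h1 h2; clear.
move=> i j i' j'; case=> [|[|[|[|[|]]]]] [-> ->]; case=> [|[|[|[|[|]]]]] [-> ->]; lia.
Qed.

Lemma honeycomb_unimodular T : T \in honeycomb -> unimodular_triangle T.
Proof.
case/honeycombP=> a [b [d [h1 h2 h3 ->]]]; exists a, b, d; split=> //.
by rewrite area2_ar; case: (adj_ar h1 h2 h3) => ->.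
Qed.

Lemma honeycomb_clique T a b : T \in honeycomb -> a \in T -> b \in T ->
  a != b -> adj a b.
Proof.
case/honeycombP=> x [y [z [h1 h2 h3 ->]]]; rewrite !inE -!orbA.
by case/or3P=> /eqP->; case/or3P=> /eqP->; rewrite ?eqxx // 1?adj_sym.
Qed.

(* Two independent conditions: nonadjacent points are never in a common cell,
   and every honeycomb triangle is a cell. *)
Definition short_pairs c := forall a b, a != b -> ~~ adj a b ->
  exists a' b', [/\ px a' + px b' = px a + px b, py a' + py b' = py a + py b &
    c a' + c b' < c a + c b].

(** The height of [c x] above the affine function that interpolates [c] at [a], [b], [d]; the two
    integers are the coordinates of [x] from Cramer's rule. *)
Definition excess c a b d x : R := c x - c a
  - (ar a b d * ar a x d)%:~R * (c b - c a)
  - (ar a b d * ar a b x)%:~R * (c d - c a).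

Definition convex_cells c := forall a b d x, adj a b -> adj a d -> adj b d ->
  x \notin [set a; b; d]%SET -> 0 < excess c a b d x.

Lemma cell_clique c v a b : short_pairs c -> a \in argmin c v ->
  b \in argmin c v -> a != b -> adj a b.
Proof.
move=> sp av bv ab; apply: contraT => nadj.
have [a' [b' [hx hy hc]]] := sp a b ab nadj.
have ha := argminP _ _ _ av a'; have hb := argminP _ _ _ bv b'.
move: ha hb; rewrite /value.
have := congr1 (fun z : int => z%:~R : R) hx; have := congr1 (fun z : int => z%:~R : R) hy.
rewrite /= !intrD => hy' hx' ha hb.
have E : (px a')%:~R * v 0 0 + (py a')%:~R * v 1 0 + ((px b')%:~R * v 0 0 + (py b')%:~R * v 1 0)
  = (px a)%:~R * v 0 0 + (py a)%:~R * v 1 0 + ((px b)%:~R * v 0 0 + (py b)%:~R * v 1 0).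
  transitivity (((px a')%:~R + (px b')%:~R) * v 0 0 + ((py a')%:~R + (py b')%:~R) * v 1 0); first by ring.
  by rewrite hx' hy'; ring.
by exfalso; move: E ha hb hc; lra.
Qed.

Lemma no_4_clique a b d x : adj a b -> adj a d -> adj b d -> adj x a ->
  adj x b -> adj x d -> False.
Proof.
rewrite (adj_sym x a) (adj_sym x b) (adj_sym x d).
move=> /eqP/hex_normE h1 /eqP/hex_normE h2 /eqP h3 /eqP/hex_normE h4 /eqP h5 /eqP.
move: h3 h5; rewrite /hex_norm.
have -> : px d - px b = (px d - px a) - (px b - px a) by ring.
have -> : py d - py b = (py d - py a) - (py b - py a) by ring.
have -> : px x - px b = (px x - px a) - (px b - px a) by ring.
have -> : py x - py b = (py x - py a) - (py b - py a) by ring.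
have -> : px x - px d = (px x - px a) - (px d - px a) by ring.
have -> : py x - py d = (py x - py a) - (py d - py a) by ring.
move: (px b - px a) (py b - py a) (px d - px a) (py d - py a) (px x - px a) (py x - py a) h1 h2 h4; clear.
move=> i j i' j' i'' j''; case=> [|[|[|[|[|]]]]] [-> ->]; case=> [|[|[|[|[|]]]]] [-> ->];
  case=> [|[|[|[|[|]]]]] [-> ->]; by [].
Qed.

Lemma excess_value c v a b d x : ar a b d = 1 \/ ar a b d = -1 ->
  value c v b = value c v a -> value c v d = value c v a ->
  excess c a b d x = value c v x - value c v a.
Proof.
move=> har hb hd.
have hx : px x - px a = (ar a b d * ar a x d) * (px b - px a)
    + (ar a b d * ar a b x) * (px d - px a).
  by apply: etrans (sign_solve har (cramer_x a b d x)) _; ring.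
have hy : py x - py a = (ar a b d * ar a x d) * (py b - py a)
    + (ar a b d * ar a b x) * (py d - py a).
  by apply: etrans (sign_solve har (cramer_y a b d x)) _; ring.
rewrite /excess; move: (ar a b d * ar a x d) (ar a b d * ar a b x) hx hy.
move=> be ga hx hy.
have hx' := congr1 (fun z : int => z%:~R : R) hx.
have hy' := congr1 (fun z : int => z%:~R : R) hy.
move: hx' hy'; rewrite /= !(intrD, intrM, intrN) => hx' hy'.
transitivity (value c v x - value c v a - be%:~R * (value c v b - value c v a)
  - ga%:~R * (value c v d - value c v a)); last by rewrite hb hd; ring.
rewrite /value; apply/eqP; rewrite -subr_eq0; apply/eqP.
transitivity (- ((px x)%:~R - (px a)%:~R - (be%:~R * ((px b)%:~R - (px a)%:~R) + ga%:~R * ((px d)%:~R - (px a)%:~R))) * v 0 0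
  - ((py x)%:~R - (py a)%:~R - (be%:~R * ((py b)%:~R - (py a)%:~R) + ga%:~R * ((py d)%:~R - (py a)%:~R))) * v 1 0); first by ring.
by rewrite hx' hy' !subrr; ring.
Qed.

(** For a honeycomb triangle, [v] is the point where its three values agree, and positive excess
    excludes all other points. Conversely, a two-dimensional cell is a clique for [adj], and there
    are no cliques of four points. *)
Lemma honeycomb_induced c : short_pairs c -> convex_cells c -> induces c honeycomb.
Proof.
move=> sp cc T; split=> [/honeycombP[a [b [d [h1 h2 h3 TE]]]]|[[a [b [d [aT bT dT]]]]]].
  have har := adj_ar h1 h2 h3; split.
    exists a, b, d; rewrite TE !inE !eqxx !orbT; split=> //.
    by rewrite area2_ar; case: har => ->.
  have det0 : (px b - px a)%:~R * (py d - py a)%:~R - (px d - px a)%:~R * (py b - py a)%:~R != 0 :> R.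
    by rewrite -!intrM -intrB intr_eq0 -/(ar a b d); case: har => ->.
  have [v0 [v1 [e1 e2]]] := solve_linear2 (c a - c b) (c a - c d) det0.
  pose v : 'cV[R]_2 := \col_i (if i == 0 then v0 else v1).
  have vE x : value c v x = c x + ((px x)%:~R * v0 + (py x)%:~R * v1) by rewrite /value !mxE.
  have vb : value c v b = value c v a.
    by rewrite !vE; move: e1; rewrite !intrB; lra.
  have vd : value c v d = value c v a.
    by rewrite !vE; move: e2; rewrite !intrB; lra.
  have va x : value c v a <= value c v x /\ (x \notin T -> value c v a < value c v x).
    have [xT|xT] := boolP (x \in T).
      split=> //; move: xT; rewrite TE !inE -orbA.
      by case/or3P=> /eqP->; rewrite ?vb ?vd.
    have pos : 0 < excess c a b d x by apply: cc => //; rewrite -TE.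
    by move: pos; rewrite (excess_value x har vb vd) subr_gt0 => lt; split=> //; exact: ltW.
  exists v; apply/setP => x; apply/argminP/idP => [h|].
    apply: contraT => /(proj2 (va x)); rewrite ltNge; have -> // := h a.
  by rewrite TE !inE -orbA => /or3P[] /eqP-> y; rewrite ?vb ?vd; exact: (proj1 (va y)).
rewrite area2_ar => art [v vT].
have cl x y : x \in T -> y \in T -> x != y -> adj x y.
  by rewrite -vT => xv yv; exact: cell_clique sp xv yv.
have n01 : a != b by apply: contraNneq art => ->; rewrite /ar !subrr !mul0r mulr0 subrr.
have n02 : a != d by apply: contraNneq art => ->; rewrite /ar !subrr !mul0r mulr0 subrr.
have n12 : b != d by apply: contraNneq art => ->; rewrite /ar mulrC subrr.
apply/honeycombP; exists a, b, d; split; try exact: cl.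
apply/eqP; rewrite finset.eqEsubset; apply/andP; split; last first.
  by apply/fintype.subsetP => x; rewrite !inE -orbA => /or3P[] /eqP->.
apply/fintype.subsetP => x xT; apply: contraT; rewrite !inE !negb_or => /andP[/andP[xa xb] xd].
case: (@no_4_clique a b d x); exact: cl.
Qed.


(** Moving both ends towards each other by a unit step lowers the sum of the norms. The step lies
    between 0 and (u, v) in both coordinates and in their difference, so the hexagon inequalities,
    which bound just these three, persist. *)
Lemma hex_step (x y u v : int) : in_hex k x y -> in_hex k (x + u) (y + v) ->
  ~ (u = 0 /\ v = 0) -> hex_norm u v <> 1 ->
  exists s t, [/\ in_hex k (x + s) (y + t), in_hex k (x + u - s) (y + v - t) &
    hex_norm (x + s) (y + t) + hex_norm (x + u - s) (y + v - t) <
    hex_norm x y + hex_norm (x + u) (y + v)].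
Proof.
move=> h1 h2 n0 n1; have n s t : hex_norm s t = 1 -> ~ (u = s /\ v = t).
  by move=> st [us vt]; apply: n1; rewrite us vt.
have e1 := n 1 0 erefl; have e2 := n 1 1 erefl; have e3 := n 0 1 erefl.
have e4 := n (-1) 0 erefl; have e5 := n (-1) (-1) erefl; have e6 := n 0 (-1) erefl.
clear n n1; move: h1 h2; rewrite /in_hex /hex_norm => h1 h2.
have [c|[c|[c|[c|[c|c]]]]] : (u > 0 /\ u > v) \/ (u > 0 /\ u = v) \/ (v > 0 /\ v > u /\ u >= 0)
   \/ (u < 0 /\ u < v) \/ (u < 0 /\ u = v) \/ (v < 0 /\ v < u /\ u <= 0).
- by clear -n0; lia.
- by exists 1, 0; split; move: h1 h2 c e1; clear; lia.
- by exists 1, 1; split; move: h1 h2 c e2; clear; lia.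
- by exists 0, 1; split; move: h1 h2 c e3; clear; lia.
- by exists (-1), 0; split; move: h1 h2 c e4; clear; lia.
- by exists (-1), (-1); split; move: h1 h2 c e5; clear; lia.
- by exists 0, (-1); split; move: h1 h2 c e6; clear; lia.
Qed.

Definition hex_height (x : A) : R := (hex_norm (px x) (py x))%:~R.

Lemma hex_height_short : short_pairs hex_height.
Proof.
move=> a b ab nadj.
have bx0 : px a + (px b - px a) = px b by rewrite addrC subrK.
have by0 : py a + (py b - py a) = py b by rewrite addrC subrK.
have [|||s [t [h1 h2 lt]]] := @hex_step (px a) (py a) (px b - px a) (py b - py a) (in_hexP a).
- by rewrite bx0 by0; exact: in_hexP.
- move=> [hx hy]; case/eqP: ab; apply: pxy_inj; apply/esym/eqP.
    by rewrite -subr_eq0 hx.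
  by rewrite -subr_eq0 hy.
- by move: nadj; rewrite /adj => /eqP.
have [a' [ax ay]] := hex_at h1; have [b' [bx b_y]] := hex_at h2.
exists a', b'; split.
- by rewrite ax bx; clear; ring.
- by rewrite ay b_y; clear; ring.
rewrite /hex_height -!intrD ltr_int ax ay bx b_y.
by move: lt; rewrite bx0 by0.
Qed.

(** As the three edges of the triangle have norm 1, the excess at the point with coordinates [be],
    [ga] is be^2 + ga^2 + be ga - be - ga. Among integral points this vanishes at the three vertices
    only and is positive elsewhere. *)
Lemma hex_height_convex : convex_cells hex_height.
Proof.
move=> a b d x h1 h2 h3; rewrite !inE !negb_or => /andP[/andP[xa xb] xd].
have har := adj_ar h1 h2 h3.
rewrite /excess /hex_height -!intrB -!intrM -!intrB ltr0z.
have hx : px x - px a = (ar a b d * ar a x d) * (px b - px a)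
    + (ar a b d * ar a b x) * (px d - px a).
  by apply: etrans (sign_solve har (cramer_x a b d x)) _; ring.
have hy : py x - py a = (ar a b d * ar a x d) * (py b - py a)
    + (ar a b d * ar a b x) * (py d - py a).
  by apply: etrans (sign_solve har (cramer_y a b d x)) _; ring.
move: (ar a b d * ar a x d) (ar a b d * ar a b x) hx hy => be ga hx hy.
have n00 : ~ (be = 0 /\ ga = 0).
  move=> [b0 g0]; case/eqP: xa; apply: pxy_inj; apply/eqP; rewrite -subr_eq0.
    by rewrite hx b0 g0 !mul0r addr0.
  by rewrite hy b0 g0 !mul0r addr0.
have n10 : ~ (be = 1 /\ ga = 0).
  move=> [b0 g0]; case/eqP: xb; move: hx hy; rewrite b0 g0 !mul1r !mul0r !addr0.
  by move=> /addIr hx /addIr hy; exact: pxy_inj.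
have n01 : ~ (be = 0 /\ ga = 1).
  move=> [b0 g0]; case/eqP: xd; move: hx hy; rewrite b0 g0 !mul1r !mul0r !add0r.
  by move=> /addIr hx /addIr hy; exact: pxy_inj.
move: h1 h2 h3 => /eqP h1 /eqP h2 /eqP h3.
have {}hx : px x = px a + be * (px b - px a) + ga * (px d - px a) by rewrite -addrA -hx addrC subrK.
have {}hy : py x = py a + be * (py b - py a) + ga * (py d - py a) by rewrite -addrA -hy addrC subrK.
have -> : hex_norm (px x) (py x) - hex_norm (px a) (py a)
    - be * (hex_norm (px b) (py b) - hex_norm (px a) (py a))
    - ga * (hex_norm (px d) (py d) - hex_norm (px a) (py a))
  = (be * be + be * ga - be) * hex_norm (px b - px a) (py b - py a)
    + (ga * ga + be * ga - ga) * hex_norm (px d - px a) (py d - py a)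
    - be * ga * hex_norm (px d - px b) (py d - py b).
  by rewrite hx hy /hex_norm; ring.
rewrite h1 h2 h3 !mulr1; move: n00 n10 n01; clear => n00 n10 n01.
have -> : be * be + be * ga - be + (ga * ga + be * ga - ga) - be * ga =
  be * be + ga * ga + be * ga - be - ga by ring.
(* Twelve times the form is 3 (2 be + ga - 1)^2 + (3 ga - 1)^2 - 4, so a nonpositive value leaves
   only 0 and 1 for [ga]. *)
have sq1 := sqr_ge0 (2 * be + ga - 1); have sq2 := sqr_ge0 (3 * ga - 1).
rewrite expr2 in sq1; rewrite expr2 in sq2.
rewrite ltNge; apply/negP => le0.
have g1 : 0 <= ga <= 1 by nia.
have [gE|gE] : ga = 0 \/ ga = 1 by lia.
  have le1 : be * be - be <= 0 by move: le0; rewrite gE; clear; lia.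
  have [bE|bE] : be = 0 \/ be = 1 by clear -le1; nia.
    by apply: n00.
  by apply: n10.
have le1 : be * be <= 0 by move: le0; rewrite gE; clear; lia.
have bE : be = 0 by clear -le1; nia.
by apply: n01.
Qed.

(** Both conditions amount to finitely many strict inequalities, linear in the coefficients once a
    better pair [F] is fixed for each nonadjacent pair; they survive a small perturbation. *)
Lemma honeycomb_near (h : A -> R) : exists2 r, 0 < r &
  induces (fun x => hex_height x + r * h x) honeycomb.
Proof.
have /boolp.choice[F FP] : forall ab : A * A, exists ab' : A * A,
    ab.1 != ab.2 -> ~~ adj ab.1 ab.2 ->
    [/\ px ab'.1 + px ab'.2 = px ab.1 + px ab.2, py ab'.1 + py ab'.2 = py ab.1 + py ab.2 &
    hex_height ab'.1 + hex_height ab'.2 < hex_height ab.1 + hex_height ab.2].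
  move=> [a b] /=; have [ab|] := boolP ((a != b) && ~~ adj a b); last first.
    by move=> H; exists (a, b) => h1 h2; rewrite h1 h2 in H.
  case/andP: ab => h1 h2; have [a' [b' hab]] := hex_height_short h1 h2.
  by exists (a', b').
have pairs (ab : A * A) : (ab.1 != ab.2) && ~~ adj ab.1 ab.2 -> 0 < hex_height ab.1 + hex_height ab.2
    - hex_height (F ab).1 - hex_height (F ab).2.
  case/andP=> h1 h2; have [_ _ lt] := FP ab h1 h2.
  by rewrite -!addrA -opprD addrA subr_gt0.
have [r1 r10 h1] := finite_small (p := fun ab : A * A => (ab.1 != ab.2) && ~~ adj ab.1 ab.2)
  (fun ab => h ab.1 + h ab.2 - h (F ab).1 - h (F ab).2) pairs.
have cells (z : A * A * A * A) :
    [&& adj z.1.1.1 z.1.1.2, adj z.1.1.1 z.1.2, adj z.1.1.2 z.1.2 & z.2 \notin [set z.1.1.1; z.1.1.2; z.1.2]%SET] ->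
    0 < excess hex_height z.1.1.1 z.1.1.2 z.1.2 z.2.
  by case/and4P=> *; exact: hex_height_convex.
have [r2 r20 h2] := finite_small (fun z : A * A * A * A => excess h z.1.1.1 z.1.1.2 z.1.2 z.2) cells.
exists (Num.min r1 r2); first by rewrite lt_min r10.
set r := Num.min r1 r2.
have hr1 : 0 < r <= r1 by rewrite lt_min r10 r20 ge_min lexx.
have hr2 : 0 < r <= r2 by rewrite lt_min r10 r20 ge_min lexx orbT.
apply: honeycomb_induced.
  move=> a b ab nadj; have [e1 e2 _] := FP (a, b) ab nadj.
  exists (F (a, b)).1, (F (a, b)).2; split=> //.
  have := h1 r hr1 (a, b); rewrite /= ab nadj => /(_ isT); lra.
move=> a b d x e1 e2 e3 e4; have := h2 r hr2 (a, b, d, x); rewrite /= e1 e2 e3 e4 => /(_ isT).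
by congr (0 < _); rewrite /excess; ring.
Qed.

End Honeycomb.

(** * The skeleton of the honeycomb *)

Lemma set2_eq (T : finType) (a b a' b' : T) : [set a; b]%SET = [set a'; b']%SET ->
  a != b -> (a' = a /\ b' = b) \/ (a' = b /\ b' = a).
Proof.
move=> E ab; have : a \in [set a'; b']%SET by rewrite -E !inE eqxx.
have : b \in [set a'; b']%SET by rewrite -E !inE eqxx orbT.
rewrite !inE => /orP[]/eqP h1 /orP[]/eqP h2.
- by rewrite h1 h2 eqxx in ab.
- by right.
- by left.
- by rewrite h1 h2 eqxx in ab.
Qed.

Lemma connect_closed (T : finType) (r : rel T) (C : {set T}) x :
  (forall y z, y \in C -> r y z -> z \in C) -> x \in C ->
  forall y, connect r x y -> y \in C.
Proof.
move=> cl xC y /connectP[s hs ->]; elim: s x xC hs => //= z s IH x xC /andP[xz hs].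
exact: IH (cl _ _ xC xz) hs.
Qed.

Section HoneycombSkeleton.
Variables (R : realType) (k : nat).
Hypothesis k2 : (2 <= k)%N.
Notation A := (hex_points k).
Notation D := (honeycomb k).
Implicit Types (a b d p q x y z w : A) (T e : {set A}).

Let unimodD := @honeycomb_unimodular k.
Let heightD : induces (@hex_height R k) D :=
  honeycomb_induced (@hex_height_short R k) (@hex_height_convex R k).

Definition inner a := inside_hex k (px a) (py a).

(* Rotations by 60 degrees about [a], for the metric given by [hex_norm]. *)
Definition rotl a b d := px d = px a + (px b - px a) - (py b - py a) /\
  py d = py a + (px b - px a).
Definition rotr a b d := px d = px a + (py b - py a) /\
  py d = py a + (py b - py a) - (px b - px a).

Lemma rotl_inj a b d d' : rotl a b d -> rotl a b d' -> d = d'.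
Proof. by move=> [h1 h2] [h3 h4]; apply: pxy_inj; rewrite ?h1 ?h2. Qed.

Lemma rotr_inj a b d d' : rotr a b d -> rotr a b d' -> d = d'.
Proof. by move=> [h1 h2] [h3 h4]; apply: pxy_inj; rewrite ?h1 ?h2. Qed.

Lemma rotlK a b d : rotl a b d <-> rotr a d b.
Proof. by rewrite /rotl /rotr; split=> -[h1 h2]; split; lia. Qed.

Lemma common_nbr a b w : adj a b -> adj a w -> adj b w -> rotl a b w \/ rotr a b w.
Proof.
move=> /eqP/hex_normE h1 /eqP/hex_normE h2 /eqP; rewrite /hex_norm /rotl /rotr.
have -> : px w - px b = (px w - px a) - (px b - px a) by ring.
have -> : py w - py b = (py w - py a) - (py b - py a) by ring.
move=> h3; suff : (px w - px a = (px b - px a) - (py b - py a) /\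
    py w - py a = px b - px a) \/ (px w - px a = py b - py a /\
    py w - py a = (py b - py a) - (px b - px a)) by clear; lia.
move: h3; move: (px b - px a) (py b - py a) (px w - px a) (py w - py a) h1 h2; clear.
move=> i j i' j'; case=> [|[|[|[|[|]]]]] [-> ->]; case=> [|[|[|[|[|]]]]] [-> ->]; lia.
Qed.

Lemma rotl_adj a b d : adj a b -> rotl a b d -> adj a d /\ adj b d.
Proof.
rewrite /adj /hex_norm => /eqP h [-> ->]; split; apply/eqP; rewrite -[RHS]h; ring.
Qed.

Lemma rotr_adj a b d : adj a b -> rotr a b d -> adj a d /\ adj b d.
Proof.
rewrite /adj /hex_norm => /eqP h [-> ->]; split; apply/eqP; rewrite -[RHS]h; ring.
Qed.

Lemma rot_neq a b d d' : adj a b -> rotl a b d -> rotr a b d' -> d != d'.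
Proof.
move=> /eqP/hex_normE h [h1 h2] [h3 h4]; apply/eqP => E; rewrite {}E in h1 h2.
by move: h h1 h2 h3 h4; clear; lia.
Qed.

Lemma inner_rot a b : adj a b -> inner a \/ inner b ->
  exists d d', rotl a b d /\ rotr a b d'.
Proof.
move=> /eqP/hex_normE h ab; have ha := in_hexP a; have hb := in_hexP b.
have [|d [dx dy]] := @hex_at k (px a + (px b - px a) - (py b - py a)) (py a + (px b - px a)).
  by move: h ab ha hb; rewrite /inner /inside_hex /in_hex; clear; lia.
have [|d' [d'x d'y]] := @hex_at k (px a + (py b - py a)) (py a + (py b - py a) - (px b - px a)).
  by move: h ab ha hb; rewrite /inner /inside_hex /in_hex; clear; lia.
by exists d, d'.
Qed.

(** Converse of [inner_rot]: together they show that an edge lies in two triangles exactly when one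
    of its ends is interior. *)
Lemma rot_inner a b d d' : adj a b -> rotl a b d -> rotr a b d' -> inner a \/ inner b.
Proof.
move=> /eqP/hex_normE h [h1 h2] [h3 h4].
have := in_hexP a; have := in_hexP b; have := in_hexP d; have := in_hexP d'.
rewrite h1 h2 h3 h4; move: h; rewrite /inner /inside_hex /in_hex; clear -k2; lia.
Qed.

Lemma honeycomb_cell a b d : adj a b -> adj a d -> adj b d -> [set a; b; d]%SET \in D.
Proof. by move=> h1 h2 h3; apply/honeycombP; exists a, b, d. Qed.

Lemma honeycomb_third T a b : T \in D -> a \in T -> b \in T -> adj a b ->
  exists2 w, T = [set a; b; w]%SET & rotl a b w \/ rotr a b w.
Proof.
move=> TD aT bT ab.
have [w [wT [_ aw bw] TE]] := cell_third unimodD TD aT bT (adj_neq ab).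
exists w => //; apply: common_nbr => //.
  exact: honeycomb_clique TD aT wT aw.
exact: honeycomb_clique TD bT wT bw.
Qed.

Lemma bounded_inner a b : adj a b -> inner a \/ inner b ->
  [set a; b]%SET \in bounded_edges D.
Proof.
move=> ab /(inner_rot ab)[d [d' [hd hd']]].
have [ad bd] := rotl_adj ab hd; have [ad' bd'] := rotr_adj ab hd'.
rewrite inE cards2 (adj_neq ab) /=; apply/cards2P.
exists [set a; b; d]%SET, [set a; b; d']%SET; split.
  apply/eqP => /setP/(_ d); rewrite !inE eqxx orbT (negbTE (rot_neq ab hd hd')) orbF.
  by rewrite !(eq_sym d) (negbTE (adj_neq ad)) (negbTE (adj_neq bd)).
apply/setP => T; rewrite [LHS]inE in_set2; apply/andP/orP => [[TD eT]|].
  have [aT bT] : a \in T /\ b \in T by split; apply: (fintype.subsetP eT); rewrite !inE eqxx ?orbT.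
  have [w -> [hw|hw]] := honeycomb_third TD aT bT ab.
    by left; rewrite (rotl_inj hw hd).
  by right; rewrite (rotr_inj hw hd').
have sub w : [set a; b]%SET \subset [set a; b; w]%SET.
  by apply/fintype.subsetP => x; rewrite !inE => ->.
by case=> /eqP->; rewrite sub honeycomb_cell.
Qed.

Lemma bounded_inv e : e \in bounded_edges D ->
  exists a b, [/\ e = [set a; b]%SET, adj a b & inner a].
Proof.
move=> /(bounded_edge_flip unimodD heightD)[a [b [d [d' [n f]]]]].
have [ab ad bd] := flip_neq f; have [ad' bd' dd'] := flip_neq' f.
have cl T := @honeycomb_clique k T.
have [aT bT dT] : [/\ a \in [set a; b; d]%SET, b \in [set a; b; d]%SET & d \in [set a; b; d]%SET].
  by rewrite !inE !eqxx !orbT.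
have [aT' bT' dT'] : [/\ a \in [set a; b; d']%SET, b \in [set a; b; d']%SET & d' \in [set a; b; d']%SET].
  by rewrite !inE !eqxx !orbT.
have hab := cl _ _ _ (flip_cell f) aT bT ab.
have hd := common_nbr hab (cl _ _ _ (flip_cell f) aT dT ad) (cl _ _ _ (flip_cell f) bT dT bd).
have hd' := common_nbr hab (cl _ _ _ (flip_cell' f) aT' dT' ad') (cl _ _ _ (flip_cell' f) bT' dT' bd').
have [h|h] : inner a \/ inner b.
  case: hd hd' => hd [] hd'.
  - by rewrite (rotl_inj hd hd') eqxx in dd'.
  - exact: rot_inner hab hd hd'.
  - exact: rot_inner hab hd' hd.
  - by rewrite (rotr_inj hd hd') eqxx in dd'.
  by exists a, b; split=> //; exact: flip_edge f.
by exists b, a; split=> //; [rewrite finset.setUC; exact: flip_edge f | rewrite adj_sym].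
Qed.

Lemma not_bounded a b : ~~ inner a -> ~~ inner b -> [set a; b]%SET \notin bounded_edges D.
Proof.
move=> na nb; apply/negP => /bounded_inv[x [y [E xy ix]]].
have : x \in [set a; b]%SET by rewrite E !inE eqxx.
by rewrite !inE => /orP[]/eqP xE; rewrite xE ?(negbTE na) ?(negbTE nb) in ix.
Qed.

Lemma honeycomb_weight (h : A -> R) a b d d' : adj a b -> rotl a b d -> rotr a b d' ->
  \sum_x edge_weight R D [set a; b]%SET x * h x = h d + h d' - h a - h b.
Proof.
move=> ab hd hd'; have eB := bounded_inner ab (rot_inner ab hd hd').
have [a2 [b2 [d2 [d2' [n [f ->]]]]]] := edge_weightP unimodD heightD eB.
have [n1 n2 n3] := flip_neq f; have [n1' n2' n3'] := flip_neq' f.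
have cl T := @honeycomb_clique k T.
have opp w : [set a2; b2; w]%SET \in D -> a2 != w -> b2 != w -> w = d \/ w = d'.
  move=> TD nw nw'; have [aT bT wT] : [/\ a2 \in [set a2; b2; w]%SET,
    b2 \in [set a2; b2; w]%SET & w \in [set a2; b2; w]%SET] by rewrite !inE !eqxx !orbT.
  have h1 := cl _ _ _ TD aT wT nw; have h2 := cl _ _ _ TD bT wT nw'.
  have [hw|hw] : rotl a b w \/ rotr a b w.
    by case: (set2_eq (flip_edge f) (adj_neq ab)) => -[aE bE]; rewrite aE in h1; rewrite bE in h2; exact: common_nbr.
    by left; exact: rotl_inj hw hd.
  by right; exact: rotr_inj hw hd'.
have dE : (d2 = d /\ d2' = d') \/ (d2 = d' /\ d2' = d).
  have := opp _ (flip_cell f) n2 n3; have := opp _ (flip_cell' f) n1' n2'.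
  by move=> [h1|h1] [h2|h2]; [rewrite h1 h2 eqxx in n3' | right | left | rewrite h1 h2 eqxx in n3'].
have nE : n = 1.
  have hx : px d2 + px d2' = px a2 + px b2.
    case: hd hd' => [h1 h2] [h3 h4].
    transitivity (px a + px b); first by case: dE => -[-> ->]; rewrite h1 h3; ring.
    by case: (set2_eq (flip_edge f) (adj_neq ab)) => -[-> ->] //; rewrite addrC.
  have hy : py d2 + py d2' = py a2 + py b2.
    case: hd hd' => [h1 h2] [h3 h4].
    transitivity (py a + py b); first by case: dE => -[-> ->]; rewrite h2 h4; ring.
    by case: (set2_eq (flip_edge f) (adj_neq ab)) => -[-> ->] //; rewrite addrC.
  have fx := flip_x f; have fy := flip_y f; rewrite hx in fx; rewrite hy in fy.
  apply/eqP; rewrite -subr_eq0; apply: contraNT n1 => nn; apply/eqP; apply: pxy_inj.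
    by apply: (mulfI nn); move: fx; clear; lia.
  by apply: (mulfI nn); move: fy; clear; lia.
rewrite flip_weight_sum nE (_ : (2 - 1)%:~R = 1) // !mul1r.
case: dE => -[-> ->]; case: (set2_eq (flip_edge f) (adj_neq ab)) => -[-> ->]; ring.
Qed.

(** Nothing is retracted: a triangle with a bounded edge has an interior vertex, and then both of
    its edges at that vertex are bounded. *)
Lemma core_honeycomb : core D = bounded_edges D.
Proof.
have stable : retract_leaves D (bounded_edges D) = bounded_edges D.
  apply/setP => e; rewrite inE; case eB: (e \in bounded_edges D) => //=.
  apply/forall_inP => T TD; apply/implyP => eT; apply/negP => /cards1P[e0 E].
  have [x [y [eE xy ix]]] := bounded_inv eB.
  have [xT yT] : x \in T /\ y \in T by split; apply: (fintype.subsetP eT); rewrite eE !inE eqxx ?orbT.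
  have [w TE hw] := honeycomb_third TD xT yT xy.
  have [xw yw] : adj x w /\ adj y w by case: hw => hw; [exact: rotl_adj hw | exact: rotr_adj hw].
  have h1 : e \in [set e0]%SET by rewrite -E inE eB eT.
  have h2 : [set x; w]%SET \in [set e0]%SET.
    rewrite -E inE bounded_inner //=; last by left.
    by rewrite TE; apply/fintype.subsetP => v; rewrite !inE => /orP[]->; rewrite ?orbT.
  have wE : w \in [set x; y]%SET.
    by move: h1 h2; rewrite eE => /set1P -> /set1P <-; rewrite !inE eqxx orbT.
  by move: wE; rewrite !inE !(eq_sym w) (negbTE (adj_neq xw)) (negbTE (adj_neq yw)).
by rewrite /core; elim: #|_| => //= n ->.
Qed.

Lemma valence_inner x y w T : T = [set x; y; w]%SET -> adj x y -> adj x w ->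
  adj y w -> inner x -> inner y -> valence (core D) T != 2%N.
Proof.
move=> TE xy xw yw ix iy; rewrite core_honeycomb /valence.
pose E3 := ([set x; y] |: ([set x; w] |: [set [set y; w]]))%SET.
have sub : E3 \subset [set e in bounded_edges D | e \subset T]%SET.
  apply/fintype.subsetP => e; rewrite !in_setU1 finset.in_set1 => he.
  apply/setIdP; rewrite TE.
  case/or3P: he => /eqP->; split; try by apply: bounded_inner => //; left.
  - by apply/fintype.subsetP => v; rewrite !inE => ->.
  - by apply/fintype.subsetP => v; rewrite !inE => /orP[]->; rewrite ?orbT.
  - by apply/fintype.subsetP => v; rewrite !inE => /orP[]->; rewrite ?orbT.
have := subset_leq_card sub; rewrite /E3 !cardsU1 cards1 !in_setU1 !finset.in_set1.
have neq (u v u' v' : A) : u \notin [set u'; v']%SET -> ([set u; v] == [set u'; v'] :> {set A})%SET = false.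
  by move=> h; apply/eqP => E; rewrite -E !inE eqxx in h.
rewrite (finset.setUC [set x] [set y]) (neq y x x w); last first.
  by rewrite !inE negb_or (eq_sym y x) (adj_neq xy) (adj_neq yw).
rewrite (finset.setUC [set y] [set x]) (neq x y y w); last first.
  by rewrite !inE negb_or (adj_neq xy) (adj_neq xw).
rewrite (neq x w y w); last by rewrite !inE negb_or (adj_neq xy) (adj_neq xw).
by rewrite /= => h; apply/eqP => E; rewrite E in h.
Qed.

Lemma class_skeleton (e0 : {set A}) (C : {set {set A}}) : C \subset core D -> e0 \in C ->
  (forall e e', e \in C -> smooth_rel D e e' -> e' \in C) ->
  (forall e, e \in C -> e = e0 \/ smooth_rel D e0 e) -> C \in skeleton_edges D.
Proof.
move=> /fintype.subsetP CC e0C cl con; apply/imsetP; exists e0; first exact: CC.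
apply/setP => e; rewrite [RHS]inE; apply/idP/andP => [eC|[_ ce]].
  split; first exact: CC.
  by case: (con e eC) => [->|h]; [exact: connect0 | exact: connect1].
exact: connect_closed cl e0C e ce.
Qed.

(** Every triangle on such an edge is 3-valent in the core, so smoothing merges it with nothing. *)
Lemma inner_class a b : adj a b -> inner a -> inner b ->
  [set [set a; b]%SET]%SET \in skeleton_edges D.
Proof.
move=> ab ia ib; have eB : [set a; b]%SET \in core D.
  by rewrite core_honeycomb bounded_inner //; left.
apply: (@class_skeleton [set a; b]%SET).
- by rewrite finset.sub1set.
- by rewrite finset.in_set1.
- move=> e e' /set1P-> /and3P[_ _ /exists_inP[T TD /and3P[/eqP v2 eT _]]].
  have [aT bT] : a \in T /\ b \in T by split; apply: (fintype.subsetP eT); rewrite !inE eqxx ?orbT.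
  have [w TE hw] := honeycomb_third TD aT bT ab.
  have [aw bw] : adj a w /\ adj b w by case: hw => hw; [exact: rotl_adj hw | exact: rotr_adj hw].
  by have := valence_inner TE ab aw bw ia ib; rewrite v2.
- by move=> e /set1P->; left.
Qed.

Section Corner.
Variables p q q1 q2 r1 r2 : A.
Hypotheses (ip : inner p) (nq : ~~ inner q) (nq1 : ~~ inner q1) (nq2 : ~~ inner q2).
Hypotheses (ir1 : inner r1) (ir2 : inner r2) (pq : adj p q).
Hypotheses (hq1 : rotl p q q1) (hq2 : rotr p q q2).
Hypotheses (hr1 : rotl p q1 r1) (hr2 : rotr p q2 r2).

Lemma corner_step x : adj p x -> adj q x -> ~~ inner x ->
  smooth_rel D [set p; q]%SET [set p; x]%SET.
Proof.
move=> ax qx nx; have TD := honeycomb_cell pq ax qx.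
have e0C : [set p; q]%SET \in core D by rewrite core_honeycomb bounded_inner //; left.
have s0 : [set p; q]%SET \subset [set p; q; x]%SET by apply/fintype.subsetP => v; rewrite !inE => ->.
have s1 : [set p; x]%SET \subset [set p; q; x]%SET.
  by apply/fintype.subsetP => v; rewrite !inE => /orP[]->; rewrite ?orbT.
have ne : [set p; q]%SET != [set p; x]%SET.
  apply/eqP => E; have : q \in [set p; x]%SET by rewrite -E !inE eqxx orbT.
  by rewrite !inE (eq_sym q) (negbTE (adj_neq pq)) (negbTE (adj_neq qx)).
apply: (proj2 (core_pair TD e0C s0 s1 ne _)) => e eC eT.
case: (subset_triple (core_card eC) eT) => eE; [by left | by right |].
by rewrite core_honeycomb eE (negbTE (not_bounded nq nx)) in eC.
Qed.

Lemma corner_side x r e' : adj p x -> ~~ inner x -> inner r ->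
  (forall w, rotl p x w \/ rotr p x w -> w = q \/ w = r) ->
  smooth_rel D [set p; x]%SET e' -> e' = [set p; x]%SET \/ e' = [set p; q]%SET.
Proof.
move=> ax nx ir nbr /and3P[_ e'C /exists_inP[T TD /and3P[/eqP v2 eT e'T]]].
have [pT xT] : p \in T /\ x \in T by split; apply: (fintype.subsetP eT); rewrite !inE eqxx ?orbT.
have [w TE hw] := honeycomb_third TD pT xT ax.
have [pw xw] : adj p w /\ adj x w by case: hw => hw; [exact: rotl_adj hw | exact: rotr_adj hw].
case: (nbr w hw) => wE; rewrite wE {hw wE} in TE pw xw.
  rewrite TE in e'T; case: (subset_triple (core_card e'C) e'T) => eE; [by left | by right |].
  by rewrite core_honeycomb eE (negbTE (not_bounded nx nq)) in e'C.
have TE' : T = [set p; r; x]%SET by rewrite TE -!finset.setUA (finset.setUC [set x]%SET).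
by have := valence_inner TE' pw ax (etrans (adj_sym r x) xw) ip ir; rewrite v2.
Qed.

(** Here [q] plays a corner of the hexagon, with boundary neighbours [q1], [q2] and inner neighbour
    [p]. The triangles on [p q] are 2-valent, which merges [p q] with [p q1] and [p q2]; beyond
    these, the triangles at [r1], [r2] are 3-valent and the merging stops. *)
Lemma corner_class :
  ([set p; q] |: [set [set p; q1]; [set p; q2]])%SET \in skeleton_edges D.
Proof.
have [pq1 qq1] := rotl_adj pq hq1; have [pq2 qq2] := rotr_adj pq hq2.
have inC x : adj p x -> [set p; x]%SET \in core D.
  by move=> px_; rewrite core_honeycomb bounded_inner //; left.
apply: (@class_skeleton [set p; q]%SET).
- by apply/fintype.subsetP => e; rewrite in_setU1 in_set2 => /or3P[]/eqP->; exact: inC.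
- by rewrite in_setU1 eqxx.
- move=> e e'; rewrite !in_setU1 !finset.in_set1 => /or3P[]/eqP-> h.
  + case/and3P: h => _ e'C /exists_inP[T TD /and3P[_ eT e'T]].
    have [pT qT] : p \in T /\ q \in T by split; apply: (fintype.subsetP eT); rewrite !inE eqxx ?orbT.
    have [w TE hw] := honeycomb_third TD pT qT pq; rewrite TE in e'T.
    have wq : w = q1 \/ w = q2.
      by case: hw => hw; [left; exact: rotl_inj hw hq1 | right; exact: rotr_inj hw hq2].
    have nw : ~~ inner w by case: wq => ->.
    case: (subset_triple (core_card e'C) e'T) => eE.
    * by rewrite eE eqxx.
    * by rewrite eE; case: wq => ->; rewrite eqxx ?orbT.
    * by rewrite core_honeycomb eE (negbTE (not_bounded nq nw)) in e'C.
  + have nb w : rotl p q1 w \/ rotr p q1 w -> w = q \/ w = r1.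
      move=> [hw|hw]; first by right; exact: rotl_inj hw hr1.
      by left; apply: rotr_inj hw _; apply/rotlK.
    by case: (corner_side pq1 nq1 ir1 nb h) => ->; rewrite eqxx ?orbT.
  + have nb w : rotl p q2 w \/ rotr p q2 w -> w = q \/ w = r2.
      move=> [hw|hw]; last by right; exact: rotr_inj hw hr2.
      by left; apply: rotl_inj hw _; apply/rotlK.
    by case: (corner_side pq2 nq2 ir2 nb h) => ->; rewrite eqxx ?orbT.
- move=> e; rewrite in_setU1 in_set2 => /or3P[]/eqP->; first by left.
    by right; exact: corner_step.
  by right; exact: corner_step.
Qed.

Variable h : A -> R.
Hypothesis h0 : \sum_x h x *: column R D x = 0.

Lemma class_relation S : S \in skeleton_edges D ->
  \sum_(e in S) \sum_x edge_weight R D e x * h x = 0.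
Proof.
move=> SD; have := sum_columnE h (exist _ S SD).
by rewrite h0 ffunE => /esym.
Qed.

(** In the sum of the three merged lengths [h q1] and [h q2] cancel. *)
Lemma corner_relation : h q + h r1 + h r2 = 3 * h p.
Proof.
have [pq1 qq1] := rotl_adj pq hq1; have [pq2 qq2] := rotr_adj pq hq2.
have neq x y : x != y -> p != x -> ([set p; x] == [set p; y] :> {set A})%SET = false.
  move=> xy px_; apply/eqP => E; have : x \in [set p; y]%SET by rewrite -E !inE eqxx orbT.
  by rewrite !inE (negbTE xy) orbF eq_sym (negbTE px_).
have := class_relation corner_class.
rewrite big_setU1 /=; last first.
  by rewrite in_set2 !neq ?(adj_neq pq) ?(adj_neq qq1) ?(adj_neq qq2).
rewrite big_setU1 /=; last first.
  by rewrite finset.in_set1 neq ?(adj_neq pq1) ?(rot_neq pq hq1 hq2).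
rewrite big_set1 (honeycomb_weight h pq hq1 hq2).
rewrite (honeycomb_weight h pq1 hr1 (proj1 (rotlK _ _ _) hq1)).
rewrite (honeycomb_weight h pq2 (proj2 (rotlK _ _ _) hq2) hr2).
lra.
Qed.

End Corner.

Lemma rhombus_relation (h : A -> R) a b d d' : \sum_x h x *: column R D x = 0 ->
  adj a b -> inner a -> inner b -> rotl a b d -> rotr a b d' ->
  h d + h d' = h a + h b.
Proof.
move=> h0 ab ia ib hd hd'; have := class_relation h0 (inner_class ab ia ib).
rewrite big_set1 (honeycomb_weight h ab hd hd'); lra.
Qed.

End HoneycombSkeleton.

(** * Linear relations between the columns of the honeycomb *)

Section Kernel.
Variables (R : realType) (k : nat).
Hypothesis k2 : (2 <= k)%N.
Notation A := (hex_points k).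
Notation D := (honeycomb k).
Notation K := (k%:Z).
Notation inside := (inside_hex k).

Variable h : A -> R.
Hypothesis h0 : \sum_x h x *: column R D x = 0.

(** Extension of [h] by 0 to all integer coordinates, so that the relations can be written without
    naming elements of the finite type. *)
Definition on_grid (x y : int) : R :=
  if [pick a : A | (px a == x) && (py a == y)] is Some a then h a else 0.

Lemma on_gridE a : on_grid (px a) (py a) = h a.
Proof.
rewrite /on_grid; case: pickP => [b /andP[/eqP hx /eqP hy]|/(_ a)].
  by congr h; exact: pxy_inj.
by rewrite !eqxx.
Qed.

Lemma inside_hex_at (x y i j : int) : inside x y ->
  [|| hex_norm i j == 1 | hex_norm i j == 0] ->
  exists2 a : A, px a = x + i & py a = y + j.
Proof.
move=> xy ij; suff /hex_at[a [ax ay]] : in_hex k (x + i) (y + j) by exists a.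
move: xy; rewrite /inside_hex /in_hex; case/orP: ij => /eqP.
  by move/hex_normE; clear; lia.
rewrite /hex_norm => ij0; have [-> ->] : i = 0 /\ j = 0 by clear -ij0; nia.
by clear; lia.
Qed.

Lemma adj_at (a b : A) (x y i j : int) : hex_norm i j = 1 -> px a = x -> py a = y ->
  px b = x + i -> py b = y + j -> adj a b.
Proof.
move=> ij ax ay bx b_y; rewrite /adj ax ay bx b_y.
by rewrite (addrC x) (addrC y) !addrK ij.
Qed.

(** The coordinates and side conditions are packed in one boolean, which [lia] settles at each
    use. *)
Lemma rhombus (i j x y x' y' u v u' v' : int) : hex_norm i j = 1 ->
  [&& x' == x + i, y' == y + j, u == x + i - j, v == y + i, u' == x + j,
      v' == y + j - i, inside x y & inside x' y'] ->
  on_grid u v + on_grid u' v' = on_grid x y + on_grid x' y'.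
Proof.
move=> ij /and4P[/eqP-> /eqP-> /eqP-> /and5P[/eqP-> /eqP-> /eqP-> xy xy']].
have [a ax ay] := inside_hex_at xy (isT : [|| hex_norm 0 0 == 1 | hex_norm 0 0 == 0]).
rewrite !addr0 in ax ay.
have [|b bx b_y] := inside_hex_at (i := i) (j := j) xy; first by rewrite ij.
have ab : adj a b := adj_at ij ax ay bx b_y.
have ia : inner a by rewrite /inner ax ay.
have ib : inner b by rewrite /inner bx b_y.
have [d [d' [hd hd']]] := inner_rot ab (or_introl ia).
have := rhombus_relation k2 h0 ab ia ib hd hd'.
rewrite -!on_gridE ax ay bx b_y; case: hd hd' => [-> ->] [-> ->].
rewrite ax ay bx b_y => E; rewrite -[RHS]E; congr (on_grid _ _ + on_grid _ _); ring.
Qed.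

Lemma corner (i j x y q1 q2 : int) : hex_norm i j = 1 ->
  [&& q1 == x + i, q2 == y + j, inside x y, ~~ inside (x + i) (y + j),
     ~~ inside (x + i - j) (y + i), ~~ inside (x + j) (y + j - i),
     inside (x - j) (y + i - j) & inside (x + j - i) (y - i)] ->
  on_grid q1 q2 + on_grid (x - j) (y + i - j) + on_grid (x + j - i) (y - i) =
  3 * on_grid x y.
Proof.
move=> ij /and4P[/eqP-> /eqP-> xy /and5P[nq nq1 nq2 ir1 ir2]].
have [p ax ay] := inside_hex_at xy (isT : [|| hex_norm 0 0 == 1 | hex_norm 0 0 == 0]).
rewrite !addr0 in ax ay.
have [|q qx qy] := inside_hex_at (i := i) (j := j) xy; first by rewrite ij.
have ip : inner p by rewrite /inner ax ay.
have pq : adj p q := adj_at ij ax ay qx qy.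
have [x1 [x2 [hx1 hx2]]] := inner_rot pq (or_introl ip).
have [pq1 _] := rotl_adj pq hx1; have [pq2 _] := rotr_adj pq hx2.
have [r1 [_ [hr1 _]]] := inner_rot pq1 (or_introl ip).
have [_ [r2 [_ hr2]]] := inner_rot pq2 (or_introl ip).
have [e1 e2] : px x1 = x + i - j /\ py x1 = y + i.
  by case: hx1 => -> ->; rewrite ax ay qx qy; split; ring.
have [e3 e4] : px x2 = x + j /\ py x2 = y + j - i.
  by case: hx2 => -> ->; rewrite ax ay qx qy; split; ring.
have [e5 e6] : px r1 = x - j /\ py r1 = y + i - j.
  by case: hr1 => -> ->; rewrite ax ay e1 e2; split; ring.
have [e7 e8] : px r2 = x + j - i /\ py r2 = y - i.
  by case: hr2 => -> ->; rewrite ax ay e3 e4; split; ring.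
have := corner_relation k2 ip (_ : ~~ inner q) (_ : ~~ inner x1) (_ : ~~ inner x2)
  (_ : inner r1) (_ : inner r2) pq hx1 hx2 hr1 hr2 h0.
rewrite /inner qx qy e1 e2 e3 e4 e5 e6 e7 e8 => /(_ nq nq1 nq2 ir1 ir2).
by rewrite -!on_gridE qx qy e5 e6 e7 e8 ax ay.
Qed.

Hypotheses (z11 : on_grid 1 1 = 0) (z21 : on_grid 2 1 = 0) (z22 : on_grid 2 2 = 0).

(** A rhombus with three zeros has a fourth. The zeros at (1, 1), (2, 1), (2, 2) start an induction
    to the right, and for [n < k] these points sweep out the whole interior. *)
Lemma kernel_strip (n : nat) : (n < k)%N ->
  [/\ on_grid (n%:Z + 1) 1 = 0, on_grid (n%:Z + 1) 2 = 0,
      on_grid (n%:Z + 2) 2 = 0 & on_grid (n%:Z + 2) 3 = 0].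
Proof.
elim: n => [_|n IH nk].
  have z12 : on_grid 1 2 = 0.
    have : on_grid 1 2 + on_grid 2 1 = on_grid 1 1 + on_grid 2 2.
    by apply: (@rhombus 1 1 1 1 2 2 1 2 2 1  erefl); rewrite /inside_hex; clear -k2; lia.
  by rewrite z11 z21 z22 !addr0.
  have z23 : on_grid 2 3 = 0.
    have : on_grid 2 3 + on_grid 1 1 = on_grid 1 2 + on_grid 2 2.
    by apply: (@rhombus 1 0 1 2 2 2 2 3 1 1  erefl); rewrite /inside_hex; clear -k2; lia.
  by rewrite z11 z12 z22 !addr0.
  by split.
have [a1 a2 a3 a4] := IH (ltnW nk).
have b1 : on_grid (n%:Z + 2) 1 = 0.
  have : on_grid (n%:Z + 1) 2 + on_grid (n%:Z + 2) 1 = on_grid (n%:Z + 1) 1 + on_grid (n%:Z + 2) 2.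
    by apply: (@rhombus 1 1 (n%:Z + 1) 1 (n%:Z + 2) 2 (n%:Z + 1) 2 (n%:Z + 2) 1 erefl); rewrite /inside_hex; clear -nk; lia.
  by rewrite a1 a2 a3 add0r addr0.
have b3 : on_grid (n%:Z + 3) 2 = 0.
  have : on_grid (n%:Z + 1) 1 + on_grid (n%:Z + 3) 2 = on_grid (n%:Z + 2) 1 + on_grid (n%:Z + 2) 2.
    by apply: (@rhombus 0 1 (n%:Z + 2) 1 (n%:Z + 2) 2 (n%:Z + 1) 1 (n%:Z + 3) 2 erefl); rewrite /inside_hex; clear -nk; lia.
  by rewrite a1 b1 a3 add0r addr0.
have b4 : on_grid (n%:Z + 3) 3 = 0.
  have : on_grid (n%:Z + 1) 2 + on_grid (n%:Z + 3) 3 = on_grid (n%:Z + 2) 2 + on_grid (n%:Z + 2) 3.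
    by apply: (@rhombus 0 1 (n%:Z + 2) 2 (n%:Z + 2) 3 (n%:Z + 1) 2 (n%:Z + 3) 3 erefl); rewrite /inside_hex; clear -nk; lia.
  by rewrite a2 a3 a4 add0r addr0.
rewrite (_ : n.+1%:Z + 1 = n%:Z + 2); last by clear; lia.
by rewrite (_ : n.+1%:Z + 2 = n%:Z + 3); last by clear; lia.
Qed.

Lemma kernel_inside x y : inside x y -> on_grid x y = 0.
Proof.
move=> xy; have [n [nE nk]] : exists n : nat, (n < k)%N /\ (y = 1 /\ x = n%:Z + 1 \/
    y = 2 /\ x = n%:Z + 1 \/ y = 2 /\ x = n%:Z + 2 \/ y = 3 /\ x = n%:Z + 2).
  have [le|gt] := lerP x K; last first.
    by exists `|(K - 1)%R|%N; move: xy gt; rewrite /inside_hex; clear -k2; lia.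
  have [y3|y3] := eqVneq y 3.
    by exists `|(x - 2)%R|%N; move: xy le; rewrite y3 /inside_hex; clear -k2; lia.
  by exists `|(x - 1)%R|%N; move: xy le y3; rewrite /inside_hex; clear -k2; lia.
have [a1 a2 a3 a4] := kernel_strip nE.
by case: nk => [[-> ->]|[[-> ->]|[[-> ->]|[-> ->]]]].
Qed.

(** For a boundary point other than a corner: it completes a rhombus whose three other vertices are
    interior. The alternatives tell on which side of the shared edge it lies. *)
Lemma kernel_side i j x y x' y' x'' y'' u v : hex_norm i j = 1 ->
  [&& x'' == x' + i, y'' == y' + j, inside x' y', inside x'' y'', inside u v &
   [&& x == x' + i - j, y == y' + i, u == x' + j & v == y' + j - i] ||
   [&& u == x' + i - j, v == y' + i, x == x' + j & y == y' + j - i]] ->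
  on_grid x y = 0.
Proof.
move=> ij /and3P[h1 h2 /and4P[h3 h4 h5 /orP[|] /and4P[h6 h7 h8 h9]]].
  have : on_grid x y + on_grid u v = on_grid x' y' + on_grid x'' y''.
    by apply: (rhombus ij); rewrite h1 h2 h3 h4 h6 h7 h8 h9.
  by rewrite (kernel_inside h3) (kernel_inside h4) (kernel_inside h5) !addr0.
have : on_grid u v + on_grid x y = on_grid x' y' + on_grid x'' y''.
  by apply: (rhombus ij); rewrite h1 h2 h3 h4 h6 h7 h8 h9.
by rewrite (kernel_inside h3) (kernel_inside h4) (kernel_inside h5) add0r addr0.
Qed.

Lemma kernel_tip i j x y x' y' : hex_norm i j = 1 ->
  [&& x == x' + i, y == y' + j, inside x' y', ~~ inside (x' + i) (y' + j),
   ~~ inside (x' + i - j) (y' + i), ~~ inside (x' + j) (y' + j - i),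
   inside (x' - j) (y' + i - j) & inside (x' + j - i) (y' - i)] ->
  on_grid x y = 0.
Proof.
move=> ij H; have := corner ij H; case/and4P: H => _ _ h1 /and5P[_ _ _ h2 h3].
by rewrite (kernel_inside h1) (kernel_inside h2) (kernel_inside h3) !addr0 mulr0.
Qed.

(** The horizontal sides, the midpoints of the four other sides, which have lattice length 2, and
    the six corners. *)
Lemma boundary_cases x y : in_hex k x y -> ~~ inside x y ->
  (y = 0 /\ 1 <= x <= K - 1) \/ (y = 4 /\ 3 <= x <= K + 1) \/
  ((x = 0 /\ y = 1) \/ (x = 1 /\ y = 3) \/ (x = K + 1 /\ y = 1) \/
   (x = K + 2 /\ y = 3)) \/
  ((x = 0 /\ y = 0) \/ (x = K /\ y = 0) \/ (x = K + 2 /\ y = 2) \/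
   (x = K + 2 /\ y = 4) \/ (x = 2 /\ y = 4) \/ (x = 0 /\ y = 2)).
Proof.
rewrite /inside_hex /in_hex => /and5P[x0 xk y0 y4 /andP[xy1 xy2]] nxy.
have [yE|[yE|[yE|[yE|yE]]]] : y = 0 \/ y = 1 \/ y = 2 \/ y = 3 \/ y = 4.
- by clear -y0 y4; lia.
- have [xE|[xE|xE]] : x = 0 \/ 1 <= x <= K - 1 \/ x = K by clear -x0 xy2 yE; lia.
  + by do 3!right; left.
  + by left.
  + by do 4!right; left.
- by do 2!right; left; clear -nxy x0 xy2 yE; lia.
- by do 3!right; clear -nxy x0 xk yE; lia.
- by do 2!right; left; clear -nxy xy1 xk yE; lia.
- have [xE|[xE|xE]] : x = 2 \/ 3 <= x <= K + 1 \/ x = K + 2 by clear -xk xy1 yE; lia.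
  + by do 7!right; left.
  + by right; left.
  + by do 6!right; left.
Qed.

Lemma kernel_boundary x y : in_hex k x y -> ~~ inside x y -> on_grid x y = 0.
Proof.
move=> xy nxy; have [[y0 hx]|[[y4 hx]|[H|H]]] := boundary_cases xy nxy.
- apply: (@kernel_side 1 0 _ _ x 1 (x + 1) 1 (x + 1) 2 erefl); move: hx; rewrite y0 /inside_hex; clear -k2; lia.
- apply: (@kernel_side 1 0 _ _ (x - 1) 3 x 3 (x - 1) 2 erefl); move: hx; rewrite y4 /inside_hex; clear -k2; lia.
- case: H => [[xE yE]|[[xE yE]|[[xE yE]|[xE yE]]]].
  + by apply: (@kernel_side 0 1 _ _ 1 1 1 2 2 2 erefl); rewrite xE yE /inside_hex; clear -k2; lia.
  + by apply: (@kernel_side 1 1 _ _ 1 2 2 3 2 2 erefl); rewrite xE yE /inside_hex; clear -k2; lia.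
  + by apply: (@kernel_side 1 1 _ _ K 1 (K + 1) 2 K 2 erefl); rewrite xE yE /inside_hex; clear -k2; lia.
  + by apply: (@kernel_side 0 1 _ _ (K + 1) 2 (K + 1) 3 K 2 erefl); rewrite xE yE /inside_hex; clear -k2; lia.
- case: H => [[xE yE]|[[xE yE]|[[xE yE]|[[xE yE]|[[xE yE]|[xE yE]]]]]].
  + by apply: (@kernel_tip (-1) (-1) _ _ 1 1 erefl); rewrite xE yE /inside_hex; clear -k2; lia.
  + by apply: (@kernel_tip 0 (-1) _ _ K 1 erefl); rewrite xE yE /inside_hex; clear -k2; lia.
  + by apply: (@kernel_tip 1 0 _ _ (K + 1) 2 erefl); rewrite xE yE /inside_hex; clear -k2; lia.
  + by apply: (@kernel_tip 1 1 _ _ (K + 1) 3 erefl); rewrite xE yE /inside_hex; clear -k2; lia.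
  + by apply: (@kernel_tip 0 1 _ _ 2 3 erefl); rewrite xE yE /inside_hex; clear -k2; lia.
  + by apply: (@kernel_tip (-1) 0 _ _ 1 2 erefl); rewrite xE yE /inside_hex; clear -k2; lia.
Qed.

Lemma kernel_zero a : h a = 0.
Proof.
rewrite -on_gridE; case: (boolP (inside (px a) (py a))); first exact: kernel_inside.
exact: kernel_boundary (in_hexP a).
Qed.

End Kernel.

(** * Equality and the conclusion *)

Lemma honeycomb_cone_dim (R : realType) (k : nat) : (2 <= k)%N ->
  (5 * k + 6 <= cone_dim (@skeleton_cone R (hex_points k) (honeycomb k)))%N.
Proof.
move=> k2; have at_ x y : in_hex k x y -> exists a : hex_points k, px a = x /\ py a = y.
  exact: hex_at.
have [|t0 [x0 y0]] := at_ 1 1; first by rewrite /in_hex; clear -k2; lia.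
have [|t1 [x1 y1]] := at_ 2 1; first by rewrite /in_hex; clear -k2; lia.
have [|t2 [x2 y2]] := at_ 2 2; first by rewrite /in_hex; clear -k2; lia.
pose B := (~: [set t0; t1; t2])%SET.
have cardB : (5 * k + 6 <= #|B|)%N.
  have := cardsC [set t0; t1; t2]%SET; rewrite -/B -cardfE (card_hex_points k2).
  have : (#|[set t0; t1; t2]%SET| <= 3)%N.
    by rewrite finset.setUC cardsU1 cards2; case: (_ \notin _); case: (_ != _).
  by clear; lia.
apply: (leq_trans cardB).
apply: (cone_dim_ge (@honeycomb_unimodular k)
  (honeycomb_induced (@hex_height_short R k) (@hex_height_convex R k)) (@honeycomb_near R k)).
move=> h hB h0; have zero t : t \in [set t0; t1; t2]%SET -> h t = 0.
  by move=> tB; apply: hB; rewrite inE negbK.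
apply: (kernel_zero k2 h0).
- by have := on_gridE h t0; rewrite x0 y0 => ->; apply: zero; rewrite !inE eqxx.
- by have := on_gridE h t1; rewrite x1 y1 => ->; apply: zero; rewrite !inE eqxx orbT.
- by have := on_gridE h t2; rewrite x2 y2 => ->; apply: zero; rewrite !inE eqxx orbT.
Qed.

Lemma dim_M_polygon_le (R : realType) (P : set 'cV[R]_2) k :
  lattice_polygon P -> genus P = (3 * k + 1)%N -> (2 <= k)%N -> egon P = 4 ->
  (dim_M_polygon P <= 5 * k + 6)%N.
Proof.
move=> hP gP k2 eP; apply: max_of_le => _ [D rD <-].
apply: cone_dim_upper gP k2 _ rD => //.
move: eP; rewrite /egon; case: ifP => // _.
by move: (lw _) => l; clear; lia.
Qed.

Lemma dim_M_hexagon (R : realType) k : (2 <= k)%N ->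
  (5 * k + 6 <= dim_M_polygon (@hexagon R k))%N.
Proof.
move=> k2; rewrite /dim_M_polygon.
(* The upper bound also guarantees that the maximum over the triangulations exists. *)
have : forall j, [set cone_dim (@skeleton_cone R (lattice_points (@hexagon R k)) D)
    | D in @regular_unimodular R (lattice_points (@hexagon R k))] j -> (j <= 5 * k + 6)%N.
  move=> _ [D rD <-]; apply: cone_dim_upper rD => //.
  - exact: hexagon_lattice.
  - exact: hexagon_genus.
  - exact: hexagon_lw.
rewrite hexagon_points // => up.
apply: leq_trans (honeycomb_cone_dim R k2) (max_of_ge up _).
exists (honeycomb k) => //; split; first exact: honeycomb_unimodular.
exists (@hex_height R k).
exact: honeycomb_induced (@hex_height_short R k) (@hex_height_convex R k).
Qed.

Lemma floor_U k : Num.floor (U (3 * k + 1) 4) = (5 * k + 6)%:Z.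
Proof.
have gE : (3 * k + 1)%:R = 3 * k%:R + 1 :> rat by rewrite natrD natrM.
have E : (5 * k + 6)%:Z%:~R = 5 * k%:R + 6 :> rat by rewrite -pmulrn natrD natrM.
have -> : U (3 * k + 1) 4 = 5 * k%:R + 6 + 2 / 3.
  by rewrite /U gE; field.
by apply: floor_def; rewrite intrD E; apply/andP; split; lra.
Qed.

Theorem theorem7p2 (R : realType) (g : nat)
    (hg : (7 <= g)%N) (hg3 : (g = 1 %[mod 3])%N) :
  ((dim_M_nd R g 4)%:Z = Num.floor (U g 4))%R.
Proof.
have [k gE] : exists k, g = (3 * k + 1)%N by exists (g %/ 3)%N; lia.
have k2 : (2 <= k)%N by lia.
rewrite gE floor_U; congr Posz; apply/eqP; rewrite eqn_leq /dim_M_nd; apply/andP.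
(* Used twice: as the inequality itself, and to know that the maximum over the polygons is
   attained. *)
have up : forall j, [set dim_M_polygon P | P in [set P : set 'cV[R]_2 |
    [/\ lattice_polygon P, genus P = (3 * k + 1)%N & egon P = 4%:Z]]] j ->
    (j <= 5 * k + 6)%N.
  by move=> _ [P [hP gP eP] <-]; exact: dim_M_polygon_le.
split; first exact: max_of_le.
apply: leq_trans (dim_M_hexagon R k2) (max_of_ge up _).
exists (@hexagon R k) => //; split; first exact: hexagon_lattice.
  exact: hexagon_genus.
exact: hexagon_egon.
Qed.
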